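(* Let $\mu_{\boldsymbol p}$ be a Gatzouras--Lalley measure with separation of principal projections and with two columns (i.e. $\#\eta(\mathcal I)=2$), where $\boldsymbol p\in\mathcal P$ is strictly positive. Then for all $\alpha\in\mathbb R$, $$f_{\boldsymbol p}(\alpha)=\max_{\boldsymbol w\in\mathcal P}\{v(\boldsymbol w):u_{\boldsymbol p}(\boldsymbol w)=\alpha\}=\max_{\boldsymbol v\in\eta(\mathcal P)}\Bigl\{\frac{H(\boldsymbol v)}{\chi_1(\boldsymbol v)}+T^*_{\boldsymbol p}\Bigl(\boldsymbol v,\ \alpha-\frac{H(\boldsymbol v,\eta(\boldsymbol p))}{\chi_1(\boldsymbol v)}\Bigr)\Bigr\},$$ where a maximum over the empty set is $-\infty$.
   Context: **Gatzouras--Lalley IFS.** Let $\mathcal I$ be a finite index set with $\#\mathcal I\ge 2$. For $i\in\mathcal I$, $j\in\{1,2\}$ let $\beta_{i,j}\in(0,1)$ and $d_{i,j}\in\mathbb R$, and set $T_i(x_1,x_2)=(\beta_{i,1}x_1+d_{i,1},\beta_{i,2}x_2+d_{i,2})$ and $S_i(x)=\beta_{i,1}x+d_{i,1}$. Assume $T_i((0,1)^2)\subset(0,1)^2$ for all $i$. Write $i\sim j$ if $S_i=S_j$; let $\eta(\mathcal I)$ be the set of equivalence classes (the ''columns'') and $\eta:\mathcal I\to\eta(\mathcal I)$ the quotient map; $S_\ell$ and $\beta_{\ell,1}$ are well defined for $\ell\in\eta(\mathcal I)$. The IFS is Gatzouras--Lalley if (i) $\beta_{i,1}>\beta_{i,2}$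 for all $i$; (ii) $T_i((0,1)^2)\cap T_j((0,1)^2)=\varnothing$ for $i\ne j$ in $\mathcal I$; (iii) $S_\ell((0,1))\cap S_{m}((0,1))=\varnothing$ for $\ell\ne m$ in $\eta(\mathcal I)$. Let $\Lambda$ be the unique non-empty compact set with $\Lambda=\bigcup_iT_i(\Lambda)$ and let $\eta(\Lambda)$ be its projection to the first coordinate. The IFS has *separation of principal projections* if $T_i(\Lambda)\cap T_j(\Lambda)=\varnothing$ for $i\neq j$ in $\mathcal I$ and $S_\ell(\eta(\Lambda))\cap S_m(\eta(\Lambda))=\varnothing$ for $\ell\ne m$ in $\eta(\mathcal I)$. **Measures.** $\mathcal P$ is the simplex of probability vectors on $\mathcal I$, $\eta(\mathcal P)$ the simplex of probability vectors on $\eta(\mathcal I)$, and $\eta:\mathcal P\to\eta(\mathcal P)$ is $\eta(\boldsymbol w)_\ell=\sum_{i\in\eta^{-1}(\ell)}w_i$. For $\boldsymbol p\in\mathcal P$, $\mu_{\boldsymbol p}$ is the unique Borel probability measure with $\mu_{\boldsymbol p}=\sum_ip_i\,\mu_{\boldsymbol p}\circ T_i^{-1}$, called a Gatzouras--Lalley measure. **Entropy and exponents.** For probability vectors on a common finite set, $H(\boldsymbol w,\boldsymbol q)=\sum_{i:w_i>0}w_i\log(1/q_i)$ and $H(\boldsymbol w)=H(\boldsymbol w,\boldsymbol w)$. $\chi_j(\boldsymbol w)=\sum_iw_i\log(1/\beta_{i,j})$; $\chi_1(\boldsymbol w)$ depends only on $\eta(\boldsymbol w)$, and $\chi_1(\boldsymbol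 v)=\sum_\ell v_\ell\log(1/\beta_{\ell,1})$ for $\boldsymbol v\in\eta(\mathcal P)$. Define $$v(\boldsymbol w)=\frac{H(\eta(\boldsymbol w))}{\chi_1(\eta(\boldsymbol w))}+\frac{H(\boldsymbol w)-H(\eta(\boldsymbol w))}{\chi_2(\boldsymbol w)},\quad u_{\boldsymbol p}(\boldsymbol w)=\frac{H(\eta(\boldsymbol w),\eta(\boldsymbol p))}{\chi_1(\eta(\boldsymbol w))}+\frac{H(\boldsymbol w,\boldsymbol p)-H(\eta(\boldsymbol w),\eta(\boldsymbol p))}{\chi_2(\boldsymbol w)}.$$ **Fibred spectrum.** $T_{\boldsymbol p}(\boldsymbol v,q)$ is the unique real $s$ with $-\sum_{\ell\in\eta(\mathcal I)}v_\ell\log\bigl(\sum_{j\in\eta^{-1}(\ell)}p_j^q\beta_{j,2}^{-s}\bigr)=q\,H(\boldsymbol v,\eta(\boldsymbol p))$, and $T^*_{\boldsymbol p}(\boldsymbol v,\rho)=\inf_{q\in\mathbb R}(q\rho-T_{\boldsymbol p}(\boldsymbol v,q))\in\mathbb R\cup\{-\infty\}$ is its concave conjugate in $q$. **Multifractal spectrum.** $\dim_{\mathrm{loc}}(\mu,x)=\lim_{r\to0}\log\mu(B(x,r))/\log r$ when the limit exists, and $f_{\boldsymbol p}(\alpha)=\dim_{\mathrm H}\{x\in\operatorname{supp}\mu_{\boldsymbol p}:\dim_{\mathrm{loc}}(\mu_{\boldsymbol p},x)\text{ exists and equals }\alpha\}$, with $\dim_{\mathrm H}\varnothing=-\infty$.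 *)

(* Defs.v *)
From HB Require Import structures.
From mathcomp Require Import all_boot all_order all_algebra generic_quotient.
From mathcomp Require Import all_classical all_reals all_analysis.

Set Implicit Arguments.
Unset Strict Implicit.
Unset Printing Implicit Defensive.

Import Order.TTheory GRing.Theory Num.Theory.
Import numFieldNormedType.Exports.

Local Open Scope classical_set_scope.
Local Open Scope ring_scope.
Local Open Scope quotient_scope.

(* The norm of the library on R * R is the sup norm. *)
Definition eucl_dist (R : realType) (x y : R * R) : R :=
  Num.sqrt ((x.1 - y.1) ^+ 2 + (x.2 - y.2) ^+ 2).

Definition eucl_ball (R : realType) (x : R * R) (r : R) : set (R * R) :=
  [set y | eucl_dist x y < r].

(* The empty set has diameter -oo. *)
Definition eucl_diam (R : realType) (U : set (R * R)) : \bar R :=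
  ereal_sup [set (eucl_dist z.1 z.2)%:E | z in U `*` U].

(* diam(U)^s, with the conventions that the empty set contributes 0 and that
   0^0 = 1, so that the case s = 0 gives the counting measure.  It is only used
   for sets of finite diameter. *)
Definition diam_pow (R : realType) (s : R) (U : set (R * R)) : \bar R :=
  if U == set0 then 0%E else (fine (eucl_diam U) `^ s)%:E.

Definition hausdorff_premeasure (R : realType) (s delta : R)
    (A : set (R * R)) : \bar R :=
  ereal_inf [set (\sum_(0 <= k <oo) diam_pow s (U k))%E |
    U in [set U : (set (R * R))^nat |
      A `<=` \bigcup_k U k /\ forall k, (eucl_diam (U k) <= delta%:E)%E]].

Definition hausdorff_measure (R : realType) (s : R) (A : set (R * R)) : \bar R :=
  ereal_sup [set hausdorff_premeasure s delta A |
    delta in [set delta : R | 0 < delta]].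

Definition hausdorff_dim (R : realType) (A : set (R * R)) : \bar R :=
  if A == set0 then -oo%E else
  ereal_inf [set s%:E | s in [set s : R | 0 <= s /\ hausdorff_measure s A = 0%E]].

(* The product sigma-algebra of two copies of the Borel line, that is, the
   Borel sigma-algebra of the plane. *)
Definition plane (R : realType) := (measurableTypeR R * measurableTypeR R)%type.

Definition msupp (R : realType) (mu : set (R * R) -> \bar R) : set (R * R) :=
  [set x | forall r : R, 0 < r -> (0 < mu (eucl_ball x r))%E].

Definition has_local_dim (R : realType) (mu : set (R * R) -> \bar R)
    (x : R * R) (alpha : R) : Prop :=
  ln (fine (mu (eucl_ball x r))) / ln r @[r --> 0^'+] --> alpha.

Definition multifractal_spectrum (R : realType) (mu : set (R * R) -> \bar R)
    (alpha : R) : \bar R :=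
  hausdorff_dim [set x | msupp mu x /\ has_local_dim mu x alpha].

Record diag_ifs (R : realType) (I : finType) := DiagIFS {
  beta1 : I -> R;
  beta2 : I -> R;
  d1 : I -> R;
  d2 : I -> R }.

Definition T_map (R : realType) (I : finType) (F : diag_ifs R I) (i : I)
    (x : R * R) : R * R :=
  (beta1 F i * x.1 + d1 F i, beta2 F i * x.2 + d2 F i).

Definition S_map (R : realType) (I : finType) (F : diag_ifs R I) (i : I)
    (x : R) : R :=
  beta1 F i * x + d1 F i.

Definition same_col (R : realType) (I : finType) (F : diag_ifs R I) : rel I :=
  fun i j => `[< S_map F i = S_map F j >].

Lemma same_col_refl (R : realType) (I : finType) (F : diag_ifs R I) :
  reflexive (same_col F).
Proof. by move=> i; apply/asboolP. Qed.

Lemma same_col_sym (R : realType) (I : finType) (F : diag_ifs R I) :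
  symmetric (same_col F).
Proof. by move=> i j; apply/asboolP/asboolP => ->. Qed.

Lemma same_col_trans (R : realType) (I : finType) (F : diag_ifs R I) :
  transitive (same_col F).
Proof. by move=> j i k /asboolP ij /asboolP jk; apply/asboolP; rewrite ij. Qed.

Definition col_equiv (R : realType) (I : finType) (F : diag_ifs R I) :
    equiv_rel I :=
  EquivRel (same_col F) (@same_col_refl R I F) (@same_col_sym R I F)
    (@same_col_trans R I F).

Definition column (R : realType) (I : finType) (F : diag_ifs R I) :=
  {eq_quot col_equiv F}.
HB.instance Definition _ (R : realType) (I : finType) (F : diag_ifs R I) :=
  Quotient.on (column F).
HB.instance Definition _ (R : realType) (I : finType) (F : diag_ifs R I) :=
  [Finite of column F by <:%/].

Definition column_of (R : realType) (I : finType) (F : diag_ifs R I) (i : I) :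
  column F := \pi i.

Lemma column_ofP (R : realType) (I : finType) (F : diag_ifs R I) (i j : I) :
  reflect (S_map F i = S_map F j) (column_of F i == column_of F j).
Proof.
apply: (iffP eqP) => [/(@eqmodP _ (col_equiv F))/asboolP//|ij].
by apply/(@eqmodP _ (col_equiv F))/asboolP.
Qed.

(* With beta_col_col below: S_col and beta_col, defined through a chosen
   representative of the column, are well defined. *)
Lemma S_map_repr (R : realType) (I : finType) (F : diag_ifs R I) (i : I) :
  S_map F (repr (column_of F i)) = S_map F i.
Proof. by apply/column_ofP; rewrite /column_of reprK. Qed.

Definition S_col (R : realType) (I : finType) (F : diag_ifs R I)
    (l : column F) : R -> R := S_map F (repr l).

Definition beta_col (R : realType) (I : finType) (F : diag_ifs R I)
    (l : column F) : R := beta1 F (repr l).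

Lemma beta_col_col (R : realType) (I : finType) (F : diag_ifs R I) (i : I) :
  beta_col (column_of F i) = beta1 F i.
Proof.
have e := S_map_repr F i; move: (congr1 (@^~ 1) e) (congr1 (@^~ 0) e).
by rewrite /S_map !mulr0 !add0r => /[swap] -> /addIr; rewrite !mulr1.
Qed.

Definition unit_itv (R : realType) : set R := `]0, 1[%classic.
Arguments unit_itv : clear implicits.

Definition unit_sq (R : realType) : set (R * R) := unit_itv R `*` unit_itv R.
Arguments unit_sq : clear implicits.

Record gatzouras_lalley (R : realType) (I : finType) (F : diag_ifs R I) : Prop := {
  gl_card : (2 <= #|I|)%N;
  gl_beta1 : forall i, 0 < beta1 F i < 1;
  gl_beta2 : forall i, 0 < beta2 F i < 1;
  gl_sub : forall i, T_map F i @` unit_sq R `<=` unit_sq R;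
  gl_dominated : forall i, beta2 F i < beta1 F i;
  gl_disj : forall i j, i != j ->
    T_map F i @` unit_sq R `&` T_map F j @` unit_sq R = set0;
  gl_col_disj : forall l m : column F, l != m ->
    S_col l @` unit_itv R `&` S_col m @` unit_itv R = set0 }.

(* Holds of exactly one set, by Hutchinson's theorem. *)
Definition is_attractor (R : realType) (I : finType) (F : diag_ifs R I)
    (L : set (R * R)) : Prop :=
  [/\ L !=set0, compact L & L = \bigcup_(i in [set: I]) (T_map F i @` L)].

Definition principal_separation (R : realType) (I : finType)
    (F : diag_ifs R I) (L : set (R * R)) : Prop :=
  (forall i j, i != j -> T_map F i @` L `&` T_map F j @` L = set0) /\
  (forall l m : column F, l != m ->
    S_col l @` (fst @` L) `&` S_col m @` (fst @` L) = set0).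

Definition prob_vec (R : realType) (K : finType) : set (K -> R) :=
  [set w | (forall i, 0 <= w i) /\ \sum_i w i = 1].
Arguments prob_vec : clear implicits.

Definition eta (R : realType) (I : finType) (F : diag_ifs R I) (w : I -> R) :
  column F -> R := fun l => \sum_(i | column_of F i == l) w i.
Arguments eta {R I} F w l.

(* Holds of exactly one Borel probability measure when p is a probability
   vector. *)
Definition is_self_affine (R : realType) (I : finType) (F : diag_ifs R I)
    (p : I -> R) (mu : probability (plane R) R) : Prop :=
  forall A : set (plane R), measurable A ->
    mu A = (\sum_(i : I) (p i)%:E * mu (T_map F i @^-1` A))%E.

Definition cross_entropy (R : realType) (K : finType) (w q : K -> R) : R :=
  \sum_(i | 0 < w i) w i * ln (1 / q i).

Definition entropy (R : realType) (K : finType) (w : K -> R) : R :=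
  cross_entropy w w.

Definition chi2 (R : realType) (I : finType) (F : diag_ifs R I) (w : I -> R) : R :=
  \sum_i w i * ln (1 / beta2 F i).

Definition chi1 (R : realType) (I : finType) (F : diag_ifs R I)
    (v : column F -> R) : R :=
  \sum_(l : column F) v l * ln (1 / beta_col l).

Definition v_dim (R : realType) (I : finType) (F : diag_ifs R I) (w : I -> R) : R :=
  entropy (eta F w) / chi1 (eta F w)
  + (entropy w - entropy (eta F w)) / chi2 F w.

Definition u_dim (R : realType) (I : finType) (F : diag_ifs R I)
    (p w : I -> R) : R :=
  cross_entropy (eta F w) (eta F p) / chi1 (eta F w)
  + (cross_entropy w p - cross_entropy (eta F w) (eta F p)) / chi2 F w.

(* The unique solution s; the default value 0 is irrelevant when p is strictly
   positive, v is a probability vector and all beta2 lie in (0,1). *)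
Definition T_fib (R : realType) (I : finType) (F : diag_ifs R I) (p : I -> R)
    (v : column F -> R) (q : R) : R :=
  xget 0 [set s : R |
    - (\sum_(l : column F)
        v l * ln (\sum_(j | column_of F j == l) p j `^ q * beta2 F j `^ (- s)))
    = q * cross_entropy v (eta F p)].

Definition T_fib_conj (R : realType) (I : finType) (F : diag_ifs R I)
    (p : I -> R) (v : column F -> R) (rho : R) : \bar R :=
  ereal_inf [set (q * rho - T_fib p v q)%:E | q in [set: R]].

(* m is the maximum of A, where the maximum of the empty set is -oo. *)
Definition is_emax (R : realType) (A : set (\bar R)) (m : \bar R) : Prop :=
  (A m /\ ubound A m) \/ (A = set0 /\ m = -oo%E).

(* Main.v *)
Require Import Defs.
From mathcomp Require Import all_boot all_order all_algebra ring lra.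
From mathcomp Require Import all_classical all_reals all_analysis.
From mathcomp Require Import measurable_realfun.

Set Implicit Arguments.
Unset Strict Implicit.
Unset Printing Implicit Defensive.

Import Order.TTheory GRing.Theory Num.Theory.
Import numFieldNormedType.Exports.

Local Open Scope classical_set_scope.
Local Open Scope ring_scope.

(* A point of the attractor is coded by a sequence x of symbols. By separation, its
   ball of radius r is comparable with the approximate square made of the points
   that share the first k symbols and the first l columns with x, where
   beta2(x_1 .. x_k) and beta1(x_1 .. x_l) are comparable to r; so its mass is
   read off from the symbol frequencies w up to k and the column frequencies v
   up to l, and the local dimension is u(w) as soon as v = eta w.

   Upper bound: v is a slowly varying real sequence because there are two
   columns, so at infinitely many scales v is close to eta w, whence u(w) is close
   to alpha. The approximate squares of a given type (w, v) with v close to eta w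
   number at most r^(- v(w) - o(1)), and there are polynomially many types.

   Lower bound: for the Bernoulli measure with weights w, almost every sequence
   has symbol frequencies w, hence local dimension u(w) for mu_p, while the
   approximate squares have mass r^(v(w) + o(1)); the mass distribution principle
   applies.

   Second formula: over the fibre eta w = v, Legendre duality for the
   Gibbs variational principle identifies the conjugate of T_p(v, .) with a maximum
   of (H(w) - H(v)) / chi_2(w). *)

(** * Codings and martingales *)

Section codings.
Variables (R : realType) (I : finType).
Implicit Types (w f g : I -> R) (x y : nat -> I).

(** No measure is put on the space of sequences. Almost sure statements and the mass distribution
    principle are both replaced by choosing letters one at a time: a countable family of nonnegative
    martingales of total initial value below 1 stays below 1 along some sequence. One such choice
    enforces the frequencies and escapes every set of an alleged cheap cover.

    The measure mu is handled alike: iterated self-affinity turns the mass of a ball into an average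
    over finite words, which is compared with the probability of matching an approximate square.

    The obstacle to the upper bound is that a ball sees two scales at once. The local dimension
    constrains only the pair (w, v), and both the candidate dimension and the constraint are
    functions of that pair. Compactness of the simplex, not explicit moduli of continuity, leads
    from approximate constraints to exact ones.

    Radii are written expR (- rho), so that products of contraction ratios and of weights become
    sums along the coding. *)

Definition psum f x n : R := \sum_(m < n) f (x m).

Lemma psum0 f x : psum f x 0 = 0.
Proof. by rewrite /psum big_ord0. Qed.

Lemma psumS f x n : psum f x n.+1 = psum f x n + f (x n).
Proof. by rewrite /psum big_ord_recr. Qed.

Lemma psumD f g x n : psum (fun i => f i + g i) x n = psum f x n + psum g x n.
Proof. by rewrite /psum big_split. Qed.

Lemma psum_const (c : R) x n : psum (fun=> c) x n = n%:R * c.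
Proof. by rewrite /psum sumr_const card_ord mulr_natl. Qed.

Lemma ler_psum f g x n : (forall m, (m < n)%N -> f (x m) <= g (x m)) ->
  psum f x n <= psum g x n.
Proof. by move=> fg; apply: ler_sum => m _; exact: fg. Qed.

Lemma psum_ge (c : R) f x n : (forall i, c <= f i) -> n%:R * c <= psum f x n.
Proof. by move=> cf; rewrite -(psum_const c x); exact: ler_psum. Qed.

Lemma psum_homo f x : (forall i, 0 <= f i) ->
  {homo psum f x : m n / (m <= n)%N >-> m <= n}.
Proof.
move=> f0; apply: homo_leq => [//|? ? ?|n]; first exact: le_trans.
by rewrite psumS lerDl.
Qed.

Lemma psum_crossing f x (c rho : R) : 0 < c -> (forall i, c <= f i) -> 0 <= rho ->
  exists n, psum f x n <= rho < psum f x n.+1.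
Proof.
move=> c0 cf rho0.
have [N hN] : exists N, rho < psum f x N.
  exists (Num.truncn (rho / c)).+1.
  apply: lt_le_trans (psum_ge _ _ cf).
  by rewrite -ltr_pdivrMr// truncnS_gt.
have ex : exists n, rho < psum f x n by exists N.
have := ex_minnP ex; case=> -[|m] hm min.
  by move: hm; rewrite psum0 ltNge rho0.
exists m; rewrite hm andbT leNgt; apply/negP => /min.
by rewrite ltnn.
Qed.

(* An elementary substitute for the Bernoulli measure with weights w: each
   n |-> c j k * \prod_(m < n) h j k m (x m) is a nonnegative martingale for it,
   so a sequence along which the sum of all of them stays below 1 can be
   chosen letter by letter. *)
Lemma martingale_avoidance (J : finType) w (c : J -> nat -> R)
    (h : J -> nat -> nat -> I -> R) :
  prob_vec R I w ->
  (forall j k, 0 <= c j k) -> (forall j k m i, 0 <= h j k m i) ->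
  (forall j k m, \sum_i w i * h j k m i = 1) ->
  (\sum_(j : J) \sum_(0 <= k <oo) (c j k)%:E < 1)%E ->
  exists x, (forall m, 0 < w (x m)) /\
    forall j k n, c j k * \prod_(m < n) h j k m (x m) < 1.
Proof.
move=> [w0 w1] c0 h0 h1 hc.
have [i0 _] : exists i, 0 < w i.
  apply: contrapT => nw; suff: \sum_i w i = 0 by move/eqP; rewrite w1 oner_eq0.
  apply: big1 => i _; apply/eqP; rewrite eq_le w0 andbT leNgt.
  by apply/negP => wi; apply: nw; exists i.
pose M j k v := c j k * \prod_(m < size v) h j k m (nth i0 v m).
have M0 j k v : 0 <= M j k v.
  by apply: mulr_ge0 => //; apply: prodr_ge0 => m _.
have MS j k v i : M j k (rcons v i) = M j k v * h j k (size v) i.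
  rewrite /M size_rcons big_ord_recr/= mulrA nth_rcons ltnn eqxx; congr (_ * _ * _).
  by apply: eq_bigr => m _; rewrite nth_rcons ltn_ord.
(* [Phi v] is the current total of all the martingales after the word v. Its average over the next
   letter is unchanged, so some letter of positive weight keeps it below 1. *)
pose Phi v := (\sum_(j : J) \sum_(0 <= k <oo) (M j k v)%:E)%E.
have Phi0 : (Phi [::] < 1)%E.
  rewrite /Phi; under eq_bigr do under eq_eseriesr do rewrite /M big_ord0 mulr1.
  exact: hc.
have PhiE v : (\sum_i (w i)%:E * Phi (rcons v i) = Phi v)%E.
  rewrite /Phi; under eq_bigr => i _.
    rewrite ge0_sume_distrr; last first.
      by move=> j _; apply: nneseries_ge0 => k _ _; rewrite lee_fin.
    under eq_bigr => j _.
      rewrite -nneseriesZl; last by move=> k _; rewrite lee_fin.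
      over.
    over.
  rewrite exchange_big/=; apply: eq_bigr => j _.
  rewrite -nneseries_sum; last first.
    by move=> i k _; rewrite -EFinM lee_fin mulr_ge0.
  apply: eq_eseriesr => k _; under eq_bigr do rewrite -EFinM.
  rewrite sumEFin; congr (_%:E).
  under eq_bigr do rewrite MS mulrCA.
  by rewrite -mulr_sumr h1 mulr1.
have step v : (Phi v < 1)%E -> exists i, 0 < w i /\ (Phi (rcons v i) < 1)%E.
  move=> v1; apply: contrapT => nex; move: v1; apply/negP; rewrite -leNgt -PhiE.
  have -> : (1 = \sum_i (w i)%:E)%E by rewrite sumEFin w1.
  apply: lee_sum => i _.
  have := w0 i; rewrite le_eqVlt => /predU1P[<-|wi]; first by rewrite mul0e.
  rewrite -[leLHS]mule1; apply: lee_pmul => //; first by rewrite lee_fin w0.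
  by rewrite leNgt; apply/negP => hi; apply: nex; exists i.
pose nxt v := xget i0 [set i | 0 < w i /\ (Phi (rcons v i) < 1)%E].
have nxtP v : (Phi v < 1)%E -> 0 < w (nxt v) /\ (Phi (rcons v (nxt v)) < 1)%E.
  by move=> /step[i hi]; rewrite /nxt; case: xgetP => [? _ //|/(_ i)].
pose V := fix V n := if n is n'.+1 then rcons (V n') (nxt (V n')) else [::].
have VP n : (Phi (V n) < 1)%E.
  by elim: n => [|n IH]//=; have [] := nxtP _ IH.
have sV n : size (V n) = n by elim: n => [|n IH]//=; rewrite size_rcons IH.
have nV n m : (m < n)%N -> nth i0 (V n) m = nxt (V m).
  elim: n => // n IH; rewrite ltnS leq_eqVlt => /predU1P[->|mn] /=.
    by rewrite nth_rcons sV ltnn eqxx.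
  by rewrite nth_rcons sV mn IH.
exists (fun n => nxt (V n)); split=> [m|j k n]; first by have [] := nxtP _ (VP m).
have -> : c j k * \prod_(m < n) h j k m (nxt (V m)) = M j k (V n).
  by rewrite /M sV; congr (_ * _); apply: eq_bigr => m _; rewrite nV.
rewrite -lte_fin; apply: le_lt_trans (VP n); rewrite /Phi.
rewrite (bigD1 j)//= -[leLHS]adde0; apply: leeD; last first.
  by apply: sume_ge0 => j' _; apply: nneseries_ge0 => k' _ _; rewrite lee_fin.
rewrite (@nneseriesD1 _ _ k)//=; last by move=> k' _; rewrite lee_fin.
by rewrite leeDl//; apply: nneseries_ge0 => k' _ _; rewrite lee_fin.
Qed.

End codings.

(** * Geometry of the attractor *)

Lemma compact_positive_bound (R : realType) (T : topologicalType) (K : set T)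
    (f : T -> R) : compact K -> (forall x, K x -> {for x, continuous f}) ->
  (forall x, K x -> 0 < f x) -> exists2 e, 0 < e & forall x, K x -> e <= f x.
Proof.
move=> cK cf f0; have [->|/set0P K0] := eqVneq K set0; first by exists 1.
have cfK : {within K, continuous f}.
  by apply: continuous_in_subspaceT => x /set_mem; exact: cf.
have [c /set_mem Kc fc] := compact_EVT_min K0 cK cfK.
by exists (f c) => [|x Kx]; [exact: f0|apply/fc/mem_set].
Qed.

Lemma finite_positive_bound (R : realType) (J : finType) (P : pred J)
    (f : J -> R) : (forall j, P j -> 0 < f j) ->
  exists2 e, 0 < e & forall j, P j -> e <= f j.
Proof.
move=> f0; exists (\big[Num.min/1]_(j | P j) f j).
  by elim/big_ind: _ => // x y x0 y0; rewrite lt_min x0.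
by move=> j Pj; apply: bigmin_le_cond.
Qed.

Lemma le_sum_norm (R : realType) (J : finType) (f : J -> R) i :
  f i <= \sum_j `|f j|.
Proof. by rewrite (bigD1 i)//= (le_trans (ler_norm _))// lerDl sumr_ge0. Qed.

Lemma mkseq_addn (T : Type) (x : nat -> T) n m :
  mkseq x (n + m) = mkseq x n ++ mkseq (fun k => x (n + k)%N) m.
Proof.
by rewrite /mkseq iotaD map_cat add0n -[in iota n m](addn0 n) iotaDl -map_comp.
Qed.

Section geometry.
Variables (R : realType) (I : finType) (F : diag_ifs R I).
Hypothesis hGL : gatzouras_lalley F.

Definition lyap1 i := - ln (beta1 F i).
Definition lyap2 i := - ln (beta2 F i).

Lemma beta1_gt0 i : 0 < beta1 F i. Proof. by have /andP[] := gl_beta1 hGL i. Qed.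
Lemma beta2_gt0 i : 0 < beta2 F i. Proof. by have /andP[] := gl_beta2 hGL i. Qed.

Lemma lyap1_gt0 i : 0 < lyap1 i.
Proof. by rewrite oppr_gt0 ln_lt0// (gl_beta1 hGL). Qed.

Lemma lyap1_lt_lyap2 i : lyap1 i < lyap2 i.
Proof. by rewrite ltrN2 ltr_ln ?posrE ?beta1_gt0 ?beta2_gt0// (gl_dominated hGL). Qed.

Lemma lyap2_gt0 i : 0 < lyap2 i. Proof. exact: lt_trans (lyap1_gt0 i) (lyap1_lt_lyap2 i). Qed.

Lemma lyap_bound : exists2 c : R, 0 < c & forall i, c <= lyap1 i /\ c <= lyap2 i.
Proof.
have [c c0 hc] := @finite_positive_bound R I xpredT lyap1 (fun i _ => lyap1_gt0 i).
exists c => // i; split; first exact: hc.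
by apply: le_trans (hc i isT) _; exact/ltW/lyap1_lt_lyap2.
Qed.

Lemma expR_lyap1 i : expR (- lyap1 i) = beta1 F i.
Proof. by rewrite opprK lnK// posrE beta1_gt0. Qed.

Lemma expR_lyap2 i : expR (- lyap2 i) = beta2 F i.
Proof. by rewrite opprK lnK// posrE beta2_gt0. Qed.

Definition word_map (u : seq I) (z : R * R) : R * R := foldr (T_map F) z u.

Lemma word_map_rcons u i z : word_map (rcons u i) z = word_map u (T_map F i z).
Proof. by rewrite /word_map -cats1 foldr_cat. Qed.

Lemma word_map_cat u v z : word_map (u ++ v) z = word_map u (word_map v z).
Proof. exact: foldr_cat. Qed.

Lemma word_map_fst u z : (word_map u z).1 = foldr (S_map F) z.1 u.
Proof. by elim: u => //= i u ->. Qed.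

Lemma word_map_columns u v z : map (column_of F) u = map (column_of F) v ->
  (word_map u z).1 = (word_map v z).1.
Proof.
rewrite !word_map_fst; elim: u v => [|i u IH] [|j v]//= [/eqP/column_ofP ij uv].
by rewrite ij (IH v).
Qed.

Lemma word_map_dist1 x n z z' : (word_map (mkseq x n) z).1 -
  (word_map (mkseq x n) z').1 = expR (- psum lyap1 x n) * (z.1 - z'.1).
Proof.
elim: n z z' => [|n IH] z z'; first by rewrite psum0 oppr0 expR0 mul1r.
rewrite mkseqS !word_map_rcons IH psumS [- (psum _ _ _ + _)]opprD expRD expR_lyap1 /=; ring.
Qed.

Lemma word_map_dist2 x n z z' : (word_map (mkseq x n) z).2 -
  (word_map (mkseq x n) z').2 = expR (- psum lyap2 x n) * (z.2 - z'.2).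
Proof.
elim: n z z' => [|n IH] z z'; first by rewrite psum0 oppr0 expR0 mul1r.
rewrite mkseqS !word_map_rcons IH psumS [- (psum _ _ _ + _)]opprD expRD expR_lyap2 /=; ring.
Qed.

Lemma continuous_T_map i : continuous (T_map F i).
Proof.
move=> z; apply: (@cvg_pair _ _ _ _ (nbhs _) (nbhs _) _ _ _
  (fun z => beta1 F i * z.1 + d1 F i) (fun z => beta2 F i * z.2 + d2 F i)).
  by apply: cvgD; [apply: cvgM; [exact: cvg_cst|exact: cvg_fst]|exact: cvg_cst].
by apply: cvgD; [apply: cvgM; [exact: cvg_cst|exact: cvg_snd]|exact: cvg_cst].
Qed.

Lemma continuous_word_map u : continuous (word_map u).
Proof.
elim: u => [|i u IH] z /=; first exact: cvg_id.
by apply: continuous_comp; [exact: IH|exact: continuous_T_map].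
Qed.

Variable L : set (R * R).
Hypothesis hL : is_attractor F L.
Hypothesis hsep : principal_separation F L.

(** A relation instead of a coding map: z lies in every cylinder of x. Points and sequences are
    matched in both directions by the two existence lemmas below. *)
Definition coded z x := forall n, (word_map (mkseq x n) @` L) z.

Lemma attractor_T_map i z : L z -> L (T_map F i z).
Proof. by move=> Lz; have [_ _ ->] := hL; exists i => //; exists z. Qed.

Lemma attractor_word_map u z : L z -> L (word_map u z).
Proof. by move=> Lz; elim: u => //= i u; exact: attractor_T_map. Qed.

Lemma exists_coding z : L z -> exists x, coded z x.
Proof.
have [[z0 Lz0] _ LE] := hL.
have [i0 _ _] : (\bigcup_(i in [set: I]) (T_map F i @` L)) z0 by rewrite -LE.
have /choice[nx nxP] : forall z, exists iz' : I * (R * R),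
    L z -> L iz'.2 /\ T_map F iz'.1 iz'.2 = z.
  move=> {}z; have [|nLz] := pselect (L z); last by exists (i0, z0) => /nLz.
  by rewrite {1}LE => -[i _ [z' Lz' <-]]; exists (i, z').
(* [zs] is a backward orbit of z under the maps; the letters used along it form the coding. *)
move=> Lz; pose zs n := iter n (fun z => (nx z).2) z.
have Lzs n : L (zs n) by elim: n => //= n /nxP[].
exists (fun n => (nx (zs n)).1) => n; exists (zs n) => //.
elim: n => // n IH; rewrite mkseqS word_map_rcons.
by have [_ ->] := nxP _ (Lzs n).
Qed.

(** The cylinders of x are compact and nested, so any cluster point of the images of a base point
    lies in all of them. *)
Lemma exists_coded x : exists z, coded z x.
Proof.
have [[z0 Lz0] cL _] := hL.
pose zs n := word_map (mkseq x n) z0.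
have [|z [Lz clz]] := cL (zs @ \oo) _.
  by exists 0%N => // n _; exact: attractor_word_map.
exists z => n.
have /compact_closed cK : compact (word_map (mkseq x n) @` L).
  apply: continuous_compact => //; apply: continuous_subspaceT.
  exact: continuous_word_map.
apply: cK; first exact: norm_hausdorff.
move=> B zB; apply: clz => //; exists n => // m /= nm.
exists (word_map (mkseq (fun k => x (n + k)%N) (m - n)) z0).
  exact: attractor_word_map.
rewrite -word_map_cat /zs; congr (word_map _ z0).
by rewrite -[in RHS](subnKC nm) mkseq_addn.
Qed.

(** Compactness of the product of L with itself and finiteness of the alphabet make the separation
    quantitative. Distinct symbols may be separated in either coordinate; distinct columns are
    separated in the first. *)
Lemma separation_const : exists2 e : R, 0 < e &
  forall i j z z', L z -> L z' ->
  (i != j -> e <= Num.max `|(T_map F i z).1 - (T_map F j z').1|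
                          `|(T_map F i z).2 - (T_map F j z').2|) /\
  (column_of F i != column_of F j ->
   e <= `|(T_map F i z).1 - (T_map F j z').1|).
Proof.
have [_ cL _] := hL; have cLL := compact_setX cL cL.
have cT1 i (zz : (R * R) * (R * R)) :
    {for zz, continuous (fun zz => (T_map F i zz.1).1)}.
  apply: (@continuous_comp _ _ _ fst (fun z => (T_map F i z).1)).
    exact: cvg_fst.
  apply: (@continuous_comp _ _ _ (T_map F i) fst); first exact: continuous_T_map.
  exact: cvg_fst.
have cT1' i (zz : (R * R) * (R * R)) :
    {for zz, continuous (fun zz => (T_map F i zz.2).1)}.
  apply: (@continuous_comp _ _ _ snd (fun z => (T_map F i z).1)).
    exact: cvg_snd.
  apply: (@continuous_comp _ _ _ (T_map F i) fst); first exact: continuous_T_map.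
  exact: cvg_fst.
have cT2 i (zz : (R * R) * (R * R)) :
    {for zz, continuous (fun zz => (T_map F i zz.1).2)}.
  apply: (@continuous_comp _ _ _ fst (fun z => (T_map F i z).2)).
    exact: cvg_fst.
  apply: (@continuous_comp _ _ _ (T_map F i) snd); first exact: continuous_T_map.
  exact: cvg_snd.
have cT2' i (zz : (R * R) * (R * R)) :
    {for zz, continuous (fun zz => (T_map F i zz.2).2)}.
  apply: (@continuous_comp _ _ _ snd (fun z => (T_map F i z).2)).
    exact: cvg_snd.
  apply: (@continuous_comp _ _ _ (T_map F i) snd); first exact: continuous_T_map.
  exact: cvg_snd.
pose d1 i j (zz : (R * R) * (R * R)) := `|(T_map F i zz.1).1 - (T_map F j zz.2).1|.
pose d2 i j (zz : (R * R) * (R * R)) := `|(T_map F i zz.1).2 - (T_map F j zz.2).2|.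
have cd1 i j zz : {for zz, continuous (d1 i j)}.
  by apply: continuous_comp; [apply: continuousB|exact: norm_continuous].
have cd2 i j zz : {for zz, continuous (d2 i j)}.
  by apply: continuous_comp; [apply: continuousB|exact: norm_continuous].
have ex1 (ij : I * I) : exists e : R, ij.1 != ij.2 -> 0 < e /\
    forall zz, (L `*` L) zz -> e <= Num.max (d1 ij.1 ij.2 zz) (d2 ij.1 ij.2 zz).
  case: ij => i j; have [->|ij] := eqVneq i j; first by exists 0.
  (* The sum of the two gaps is minimised; their maximum is at least half of it, hence the witness e
     / 2. *)
  have [zz _|zz [Lz Lz']|e e0 he] := @compact_positive_bound R _ (L `*` L)
      (fun zz => d1 i j zz + d2 i j zz) cLL.
  - by apply: continuousD.
  - rewrite lt_neqAle addr_ge0 ?normr_ge0// andbT eq_sym paddr_eq0 ?normr_ge0//.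
    apply/negP => /andP[]; rewrite !normr_eq0 !subr_eq0 => /eqP e1 /eqP e2.
    have : (T_map F i @` L `&` T_map F j @` L) (T_map F i zz.1).
      split; first by exists zz.1.
      by exists zz.2 => //; apply/esym; rewrite [LHS]surjective_pairing e1 e2.
    by rewrite (hsep.1 _ _ ij).
  - exists (e / 2) => _; split=> [|zz /he]; first by rewrite divr_gt0.
    by case: (leP (d1 i j zz)) => ?; lra.
have ex2 (ij : I * I) : exists e : R, column_of F ij.1 != column_of F ij.2 ->
    0 < e /\ forall zz, (L `*` L) zz -> e <= d1 ij.1 ij.2 zz.
  case: ij => i j /=; have [_|ij] := eqVneq (column_of F i) (column_of F j).
    by exists 0.
  have [zz _|zz [Lz Lz']|e e0 he] := @compact_positive_bound R _ (L `*` L)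
      (d1 i j) cLL.
  - exact: cd1.
  - rewrite normr_gt0 subr_eq0; apply/negP => /eqP e1.
    have : (S_col (column_of F i) @` (fst @` L) `&`
            S_col (column_of F j) @` (fst @` L)) (T_map F i zz.1).1.
      split; rewrite /S_col.
        by exists zz.1.1; [exists zz.1|rewrite S_map_repr].
      by exists zz.2.1; [exists zz.2|rewrite S_map_repr e1].
    by rewrite (hsep.2 _ _ ij).
  - by exists e.
have [e1 e1P] := choice ex1; have [e2 e2P] := choice ex2.
have [e e0 he] := @finite_positive_bound R _
  (fun ij : I * I => ij.1 != ij.2) e1 (fun ij h => (e1P ij h).1).
have [e' e'0 he'] := @finite_positive_bound R _
  (fun ij : I * I => column_of F ij.1 != column_of F ij.2) e2
  (fun ij h => (e2P ij h).1).
exists (Num.min e e') => [|i j z z' Lz Lz']; first by rewrite lt_min e0.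
split=> ij.
  apply: (@le_trans _ _ e); first by rewrite ge_min lexx.
  by apply: le_trans (he (i, j) ij) _; apply: (e1P (i, j) ij).2 (z, z') _.
apply: (@le_trans _ _ e'); first by rewrite ge_min lexx orbT.
by apply: le_trans (he' (i, j) ij) _; apply: (e2P (i, j) ij).2 (z, z') _.
Qed.

Lemma nth_drop_split (u : seq I) m i0 : (m < size u)%N ->
  u = rcons (take m u) (nth i0 u m) ++ drop m.+1 u.
Proof. by move=> mu; rewrite -take_nth// cat_take_drop. Qed.

(** The words of the approximate square (k, l) of x. The default of [nth] is x m, so that a missing
    letter counts as a match. *)
Definition matches (x : nat -> I) k l (u : seq I) :=
  (forall m, (m < k)%N -> nth (x m) u m = x m) /\
  (forall m, (m < l)%N -> column_of F (nth (x m) u m) = column_of F (x m)).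

Lemma word_split (x : nat -> I) n m : (m < n)%N ->
  mkseq x n = rcons (mkseq x m) (x m) ++ mkseq (fun k => x (m.+1 + k)%N) (n - m.+1).
Proof. by move=> mn; rewrite -mkseqS -mkseq_addn subnKC. Qed.

Lemma psum_lyap1_homo x : {homo psum lyap1 x : m n / (m <= n)%N >-> m <= n}.
Proof. by apply: psum_homo => i; exact/ltW/lyap1_gt0. Qed.

Lemma psum_lyap2_homo x : {homo psum lyap2 x : m n / (m <= n)%N >-> m <= n}.
Proof. by apply: psum_homo => i; exact/ltW/lyap2_gt0. Qed.

Lemma psum_lyap1_le_lyap2 x n : psum lyap1 x n <= psum lyap2 x n.
Proof. by apply: ler_psum => m _; exact/ltW/lyap1_lt_lyap2. Qed.

(** At the first position where the columns differ, both first coordinates have been contracted by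
    the same factor, so the gap [e] survives up to that factor. At the first position before k where
    the symbols differ the whole words agreed so far, and by domination both contraction factors are
    at least expR (- psum lyap2 x k). Strong induction provides the first disagreement. *)
Lemma separation_matches : exists2 e : R, 0 < e &
  forall x n z (u : seq I) z' k l, size u = n -> L z -> L z' ->
  (k <= l)%N -> (l <= n)%N ->
  `|(word_map (mkseq x n) z).1 - (word_map u z').1| < e * expR (- psum lyap1 x l) ->
  Num.max `|(word_map (mkseq x n) z).1 - (word_map u z').1|
    `|(word_map (mkseq x n) z).2 - (word_map u z').2| < e * expR (- psum lyap2 x k) ->
  matches x k l u.
Proof.
have [e e0 he] := separation_const; exists e => // x n z u z' k l su Lz Lz' kl ln.
have usplit m : (m < n)%N ->
    exists2 y', L y' & word_map u z' =
      word_map (take m u) (T_map F (nth (x m) u m) y').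
  move=> mn; exists (word_map (drop m.+1 u) z'); first exact: attractor_word_map.
  by rewrite -word_map_rcons -word_map_cat -nth_drop_split ?su.
have xsplit m : (m < n)%N ->
    exists2 y, L y & word_map (mkseq x n) z =
      word_map (mkseq x m) (T_map F (x m) y).
  move=> mn; exists (word_map (mkseq (fun k => x (m.+1 + k)%N) (n - m.+1)) z).
    exact: attractor_word_map.
  by rewrite -word_map_rcons -word_map_cat -word_split.
have stk m : (m < n)%N -> size (take m u) = m.
  by move=> mn; rewrite size_takel// su ltnW.
move=> d1 d2.
have colm m : (m < l)%N -> column_of F (nth (x m) u m) = column_of F (x m).
  elim/ltn_ind: m => m IH ml; have mn := leq_trans ml ln.
  apply/eqP; apply: contraTT d1 => neq.
  have [y Ly ->] := xsplit m mn; have [y' Ly' ->] := usplit m mn.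
  have -> : (word_map (take m u) (T_map F (nth (x m) u m) y')).1 =
            (word_map (mkseq x m) (T_map F (nth (x m) u m) y')).1.
    apply: word_map_columns; apply: (@eq_from_nth _ (column_of F (x m))).
      by rewrite !size_map stk// size_iota.
    move=> j; rewrite size_map stk// => jm.
    rewrite (nth_map (x m)) ?stk// nth_take//.
    rewrite (nth_map (x m)) ?size_mkseq// nth_mkseq// -IH// ?(ltn_trans jm ml)//.
    by congr column_of; apply: set_nth_default; rewrite su (ltn_trans jm mn).
  rewrite word_map_dist1 normrM (gtr0_norm (expR_gt0 _)) -leNgt [e * _]mulrC.
  apply: ler_pM; rewrite ?expR_ge0 ?(ltW e0)//.
    by rewrite ler_expR lerN2 psum_lyap1_homo// ltnW.
  by rewrite eq_sym in neq; exact: (he _ _ _ _ Ly Ly').2 neq.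
split=> // m; elim/ltn_ind: m => m IH mk; have mn := leq_trans (leq_trans mk kl) ln.
apply/eqP; apply: contraTT d2 => neq.
have [y Ly ->] := xsplit m mn; have [y' Ly' ->] := usplit m mn.
have -> : take m u = mkseq x m.
  apply: (@eq_from_nth _ (x m)); first by rewrite stk ?size_mkseq.
  move=> j; rewrite stk// => jm.
  rewrite nth_take// nth_mkseq// -[RHS]IH// ?(ltn_trans jm mk)//.
  by apply: set_nth_default; rewrite su (ltn_trans jm mn).
rewrite word_map_dist1 word_map_dist2 !normrM !(gtr0_norm (expR_gt0 _)).
rewrite -leNgt [e * _]mulrC.
have := psum_lyap1_le_lyap2 x m; have := psum_lyap2_homo x (ltnW mk) => h1 h2.
have h3 : expR (- psum lyap2 x k) <= expR (- psum lyap2 x m) by rewrite ler_expR lerN2.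
have h4 : expR (- psum lyap2 x m) <= expR (- psum lyap1 x m) by rewrite ler_expR lerN2.
rewrite eq_sym in neq; move: ((he _ _ _ _ Ly Ly').1 neq).
have e'0 := @expR_gt0 R (- psum lyap2 x k).
rewrite !le_max => /orP[h|h]; apply/orP; [left|right].
  by apply: ler_pM; rewrite ?expR_ge0 ?(ltW e0)//; exact: le_trans h3 h4.
by apply: ler_pM; rewrite ?expR_ge0 ?(ltW e0).
Qed.

End geometry.

(** * Measure of balls *)

Lemma geometric_small (R : realType) (t M e : R) : 0 < t < 1 -> 0 < e ->
  exists N, forall n, (N <= n)%N -> t ^+ n * M <= e.
Proof.
move=> /andP[t0 t1] e0.
have /cvgrPdist_lt : (t ^+ n * M) @[n --> \oo] --> 0.
  rewrite -(mul0r M); apply: cvgM; last exact: cvg_cst.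
  by apply: cvg_expr; rewrite gtr0_norm.
move=> /(_ _ e0)[N _ hN]; exists N => n /hN /=; rewrite sub0r normrN.
by move=> /ltW; apply: le_trans; exact: ler_norm.
Qed.

Lemma pair_distl_le (R : realType) (x y : R * R) : `|x.1 - y.1| <= eucl_dist x y.
Proof. by rewrite /eucl_dist -sqrtr_sqr ler_wsqrtr// lerDl sqr_ge0. Qed.

Lemma pair_distr_le (R : realType) (x y : R * R) : `|x.2 - y.2| <= eucl_dist x y.
Proof. by rewrite /eucl_dist -sqrtr_sqr ler_wsqrtr// lerDr sqr_ge0. Qed.

Lemma eucl_dist_le (R : realType) (x y : R * R) :
  eucl_dist x y <= `|x.1 - y.1| + `|x.2 - y.2|.
Proof.
rewrite /eucl_dist -[leRHS]ger0_norm ?addr_ge0// -sqrtr_sqr ler_wsqrtr//.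
rewrite [leRHS]sqrrD !real_normK ?num_real// addrAC lerDl.
by rewrite mulrn_wge0// mulr_ge0.
Qed.

(** * Expectations over finite words with independent letters *)

Section word_expectation.
Variables (R : realType) (I : finType).
Implicit Types (w : I -> R) (f g : seq I -> R).

(** The expectation of f over words of n independent letters of law w. Recursion on the first letter
    mirrors the iteration of the self-affinity relation. *)
Fixpoint wexp w n f : R :=
  if n is n'.+1 then \sum_i w i * wexp w n' (fun u => f (i :: u)) else f [::].

Lemma ler_wexp w n f g : (forall i, 0 <= w i) ->
  (forall u, size u = n -> f u <= g u) -> wexp w n f <= wexp w n g.
Proof.
move=> w0; elim: n f g => [|n IH] f g fg /=; first exact: fg.
by apply: ler_sum => i _; apply: ler_wpM2l => //; apply: IH => u su; by apply: fg; rewrite /= su.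
Qed.

Lemma eq_wexp w n f g : f =1 g -> wexp w n f = wexp w n g.
Proof. by move=> /funext ->. Qed.

Lemma wexpZ w n (c : R) f : wexp w n (fun u => c * f u) = c * wexp w n f.
Proof.
elim: n f => //= n IH f; rewrite mulr_sumr; apply: eq_bigr => i _.
by rewrite IH mulrCA.
Qed.

Lemma wexp_cst w n (c : R) : \sum_i w i = 1 -> wexp w n (fun=> c) = c.
Proof. by move=> w1; elim: n => //= n IH; rewrite IH -mulr_suml w1 mul1r. Qed.

Lemma wexp_prod w n (g : nat -> I -> R) (x : nat -> I) :
  wexp w n (fun u => \prod_(m < n) g m (nth (x m) u m)) =
  \prod_(m < n) \sum_i w i * g m i.
Proof.
elim: n g x => [|n IH] g x /=; first by rewrite !big_ord0.
rewrite big_ord_recl mulr_suml; apply: eq_bigr => i _.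
rewrite -mulrA; congr (_ * _).
under eq_wexp do rewrite big_ord_recl /=.
by rewrite wexpZ (IH (fun m => g m.+1) (fun m => x m.+1)).
Qed.

End word_expectation.

Lemma sum_ord_if (R : realType) (C : nat -> R) k n : (k <= n)%N ->
  \sum_(m < n) (if (m < k)%N then C m else 0) = \sum_(m < k) C m.
Proof. by move=> kn; rewrite -big_mkcond/= -big_ord_widen. Qed.

(** * Weights of symbols, columns and approximate squares *)

Section column_weights.
Variables (R : realType) (I : finType) (F : diag_ifs R I).

Definition cost (q : I -> R) i := - ln (q i).
(** The column marginal pulled back to symbols, so that column costs are also sums along the
    coding. *)
Definition col_weight (q : I -> R) i := eta F q (column_of F i).

(* -log of the mass of the approximate square formed by the first k symbols of x
   and the columns of the symbols from k to l. *)
Definition square_cost (q : I -> R) x k l : R :=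
  psum (cost q) x k + (psum (cost (col_weight q)) x l - psum (cost (col_weight q)) x k).

Lemma col_weightE q i :
  col_weight q i = \sum_(j | column_of F j == column_of F i) q j.
Proof. by []. Qed.

Lemma col_weight_ge q i : (forall j, 0 <= q j) -> q i <= col_weight q i.
Proof. by move=> q0; rewrite col_weightE (bigD1 i)//= lerDl sumr_ge0. Qed.

(** The indicator of the approximate square, split into one factor per letter so that its
    expectation factorises. *)
Definition approx_square_factor (x : nat -> I) k l m i : R :=
  if (m < k)%N then (i == x m)%:R
  else if (m < l)%N then (column_of F i == column_of F (x m))%:R else 1.

Lemma approx_square_factorE (q : I -> R) x k l m : \sum_i q i = 1 ->
  \sum_i q i * approx_square_factor x k l m i =
  if (m < k)%N then q (x m) else if (m < l)%N then col_weight q (x m) else 1.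
Proof.
move=> q1; rewrite /approx_square_factor; case: ifP => _.
  rewrite (bigD1 (x m))//= eqxx mulr1 big1 ?addr0// => i /negbTE ->.
  by rewrite mulr0.
case: ifP => _; last by under eq_bigr do rewrite mulr1.
rewrite col_weightE [RHS]big_mkcond; apply: eq_bigr => i _.
by case: eqP => _; rewrite ?mulr1 ?mulr0.
Qed.

Lemma matches_factor x k l n u : (k <= l)%N -> (l <= n)%N ->
  matches F x k l u ->
  \prod_(m < n) approx_square_factor x k l m (nth (x m) u m) = 1.
Proof.
move=> kl ln [h1 h2]; apply: big1 => m _; rewrite /approx_square_factor.
case: ifP => mk; first by rewrite h1// eqxx.
by case: ifP => // ml; rewrite h2// eqxx.
Qed.

Lemma approx_square_factor_ge0 x k l m i : 0 <= approx_square_factor x k l m i.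
Proof. by rewrite /approx_square_factor; do 2?[case: ifP] => // *; rewrite ler0n. Qed.

Lemma not_matches_factor x k l n u : (k <= l)%N -> (l <= n)%N ->
  ~ matches F x k l u ->
  \prod_(m < n) approx_square_factor x k l m (nth (x m) u m) = 0.
Proof.
move=> kl ln nm; apply/eqP; apply: contra_notT nm => /prodf_neq0 h.
have hk m : (m < k)%N -> nth (x m) u m = x m.
  move=> mk; have mn := leq_trans mk (leq_trans kl ln).
  have := h (Ordinal mn) isT; rewrite /approx_square_factor /= mk.
  by case: (nth (x m) u m =P x m) => // _; rewrite /= mulr0n eqxx.
split=> // m ml; have mn := leq_trans ml ln.
have := h (Ordinal mn) isT; rewrite /approx_square_factor /= ml.
case: ifP => [/hk -> //|_].
by case: (column_of F _ =P _) => // _; rewrite /= mulr0n eqxx.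
Qed.

Lemma square_cost_prod (q : I -> R) (x : nat -> I) k l n :
  (forall i, 0 <= q i) -> (forall m, 0 < q (x m)) -> (k <= l)%N -> (l <= n)%N ->
  \prod_(m < n) (if (m < k)%N then q (x m)
    else if (m < l)%N then col_weight q (x m) else 1) =
  expR (- square_cost q x k l).
Proof.
move=> q0 qx0 kl ln; have kn := leq_trans kl ln.
have cw0 m : 0 < col_weight q (x m).
  by apply: lt_le_trans (qx0 m) (col_weight_ge _ _).
(* [B m] is the cost of the column and [A m] the extra cost of fixing the symbol inside it. *)
pose A m := cost q (x m) - cost (col_weight q) (x m).
pose B m := cost (col_weight q) (x m).
have -> : square_cost q x k l = \sum_(m < n)
   ((if (m < k)%N then A m else 0) + (if (m < l)%N then B m else 0)).
  rewrite big_split !sum_ord_if// /A/= sumrB /square_cost /psum /B; ring.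
rewrite -sumrN expR_sum; apply: eq_bigr => m _; rewrite /A /B /cost.
have [mk|mk] := boolP (m < k)%N.
  by rewrite (leq_trans mk kl) subrK opprK lnK ?posrE.
by case: ifP => ml; rewrite add0r ?opprK ?lnK ?posrE// oppr0 expR0.
Qed.

Lemma wexp_matches (q : I -> R) (x : nat -> I) k l n : (forall i, 0 < q i) -> \sum_i q i = 1 ->
  (k <= l)%N -> (l <= n)%N ->
  wexp q n (fun u => \prod_(m < n) approx_square_factor x k l m (nth (x m) u m)) =
  expR (- square_cost q x k l).
Proof.
move=> q0 q1 kl ln; rewrite wexp_prod -(@square_cost_prod _ _ _ _ n)//;
  last by move=> i; exact: ltW.
by apply: eq_bigr => m _; exact: approx_square_factorE.
Qed.

End column_weights.

Section measure_of_balls.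
Variables (R : realType) (I : finType) (F : diag_ifs R I) (L : set (R * R)).
Variables (p : I -> R) (mu : probability (plane R) R).
Hypothesis hGL : gatzouras_lalley F.
Hypothesis hL : is_attractor F L.
Hypothesis hsep : principal_separation F L.
Hypothesis hp : prob_vec R I p.
Hypothesis hp0 : forall i, 0 < p i.
Hypothesis hmu : is_self_affine F p mu.

Let m (A : set (R * R)) : R := fine (mu A).

Let mu_fin (A : set (plane R)) : measurable A -> mu A = (m A)%:E.
Proof. by move=> mA; rewrite fineK// fin_num_measure. Qed.

Let m_ge0 A : 0 <= m A. Proof. exact: fine_ge0. Qed.

Let m_le (A B : set (plane R)) : measurable A -> measurable B -> A `<=` B -> m A <= m B.
Proof.
by move=> mA mB AB; rewrite -lee_fin -!mu_fin//; apply: le_measure; rewrite ?inE.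
Qed.

Lemma measurable_T_map i : measurable_fun setT (T_map F i : plane R -> plane R).
Proof.
apply: measurable_fun_pair; apply: measurable_funD => //; apply: measurable_funM => //.
Qed.

Lemma measurable_word_map u : measurable_fun setT (word_map F u : plane R -> plane R).
Proof.
elim: u => [|i u IH]; first exact: measurable_id.
exact: (measurableT_comp (measurable_T_map i) IH).
Qed.

Let mpre u (A : set (plane R)) : measurable A ->
  measurable ((word_map F u : plane R -> plane R) @^-1` A).
Proof. by move=> mA; rewrite -[X in measurable X]setTI; exact: measurable_word_map. Qed.

Lemma self_affine_words n (A : set (plane R)) : measurable A ->
  m A = wexp p n (fun u => m (word_map F u @^-1` A)).
Proof.
elim: n A => [//|n IH] A mA /=.
have mT i : measurable ((T_map F i : plane R -> plane R) @^-1` A).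
  by rewrite -[X in measurable X]setTI; exact: measurable_T_map.
transitivity (\sum_i p i * m (T_map F i @^-1` A)).
  apply: EFin_inj; rewrite -mu_fin// hmu// -sumEFin; apply: eq_bigr => i _.
  by rewrite EFinM -mu_fin.
by apply: eq_bigr => i _; rewrite (IH _ (mT i)).
Qed.

(** The unit square with a margin M on every side. Each map multiplies the margin by at most its
    contraction ratio. *)
Let box (M : R) : set (R * R) := `[- M, 1 + M]%classic `*` `[- M, 1 + M]%classic.

Let mbox M : measurable (box M : set (plane R)).
Proof. by apply: measurableX; exact: measurable_itv. Qed.

Let boxP M z : box M z <-> (- M <= z.1 <= 1 + M) /\ (- M <= z.2 <= 1 + M).
Proof. by rewrite /box /= !in_itv. Qed.

Lemma contraction_ratio : exists2 t : R, 0 < t < 1 &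
  forall i, beta1 F i <= t /\ beta2 F i <= t.
Proof.
have [i _|e e0 he] := @finite_positive_bound R I xpredT (fun i => 1 - beta1 F i).
  by rewrite subr_gt0; have /andP[] := gl_beta1 hGL i.
exists (Num.max (1 - e) (1 / 2)).
  by rewrite lt_max gt_max; lra.
move=> i; have h : beta1 F i <= Num.max (1 - e) (1 / 2).
  by rewrite le_max; have := he i isT; rewrite lerBrDr -lerBrDl => ->.
split=> //; apply: le_trans h; exact/ltW/(gl_dominated hGL).
Qed.

Lemma T_map_translations i : [/\ 0 <= d1 F i, beta1 F i + d1 F i <= 1,
  0 <= d2 F i & beta2 F i + d2 F i <= 1].
Proof.
(* The inclusion of open intervals is tested near an endpoint: t is at most the alleged violation,
   so that multiplying it by b < 1 cannot compensate. *)
have key (b d : R) : 0 < b < 1 -> (forall t, 0 < t < 1 -> 0 < b * t + d < 1) ->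
    0 <= d /\ b + d <= 1.
  move=> /andP[b0 b1] h; split.
    rewrite leNgt; apply/negP => d0; pose t := Num.min (1 / 2) (- d).
    have t0 : 0 < t < 1 by rewrite lt_min gt_min; lra.
    have : t <= - d by rewrite ge_min lexx orbT.
    by have /andP[] := h t t0; nra.
  rewrite leNgt; apply/negP => d0; pose t := Num.min (1 / 2) (b + d - 1).
  have t0 : 0 < 1 - t < 1 by rewrite subr_gt0 ltrBlDr ltrDl lt_min gt_min; lra.
  have : t <= b + d - 1 by rewrite ge_min lexx orbT.
  by have /andP[] := h _ t0; nra.
have hsub (z : R * R) : 0 < z.1 < 1 -> 0 < z.2 < 1 ->
    0 < (T_map F i z).1 < 1 /\ 0 < (T_map F i z).2 < 1.
  move=> z1 z2.
  have [] : unit_sq R (T_map F i z).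
    apply: (gl_sub hGL (i := i)); exists z => //.
    by split; rewrite /unit_itv /= ?in_itv.
have [|? ?] := key _ (d1 F i) (gl_beta1 hGL i).
  by move=> t t01; have [] := hsub (t, t) t01 t01.
have [|? ?] := key _ (d2 F i) (gl_beta2 hGL i).
  by move=> t t01; have [] := hsub (t, t) t01 t01.
by split.
Qed.

Lemma word_map_box (t : R) M u z : 0 < t < 1 ->
  (forall i, beta1 F i <= t /\ beta2 F i <= t) -> 0 <= M ->
  box M z -> box (t ^+ size u * M) (word_map F u z).
Proof.
move=> /andP[t0 t1] ht M0 Mz; elim: u => [|i u IH] /=; first by rewrite expr0 mul1r.
have [d10 d11 d20 d21] := T_map_translations i.
have [b1 b2] := ht i; have b10 := beta1_gt0 hGL i; have b20 := beta2_gt0 hGL i.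
have : 0 <= t ^+ size u * M by rewrite mulr_ge0// exprn_ge0// ltW.
move: IH; rewrite exprS -mulrA; set M' := _ ^+ _ * M.
move/boxP => [/andP[h1 h2] /andP[h3 h4]] M'0; apply/boxP => /=.
by split; apply/andP; split; nra.
Qed.

Let box_large e : 0 < e -> exists n : nat, 1 - e <= m (box n%:R).
Proof.
move=> e0.
have mono : nondecreasing_seq (fun n => box n%:R : set (plane R)).
  move=> a b ab; apply/subsetPset => z /boxP[/andP[h1 h2] /andP[h3 h4]].
  have ab' : a%:R <= b%:R :> R by rewrite ler_nat.
  by apply/boxP; split; apply/andP; split; lra.
have UT : \bigcup_n (box n%:R) = [set: plane R].
  apply/seteqP; split=> // z _.
  exists (Num.truncn (`|z.1| + `|z.2|)).+1 => //.
  have := truncnS_gt (`|z.1| + `|z.2|); set k := _.+1%:R => hk.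
  have := ler_norm z.1; have := ler_norm (- z.1); have := ler_norm z.2.
  have := ler_norm (- z.2); rewrite !normrN.
  have := normr_ge0 z.1; have := normr_ge0 z.2.
  by move=> *; apply/boxP; split; apply/andP; split; lra.
have : (mu \o (fun n => box n%:R : set (plane R))) @ \oo --> (1%E : \bar R).
  rewrite -(@probability_setT _ _ _ mu) -UT; apply: nondecreasing_cvg_mu => //.
  by rewrite UT.
move=> /fine_cvgP[_] /cvgrPdist_le /(_ _ e0)[N _ hN]; exists N.
have := hN N (leqnn N); rewrite /= => h.
by rewrite lerBlDr -lerBlDl; exact: le_trans (ler_norm _) h.
Qed.

(** A set that contains L and is mapped into itself by every word. The positive margin lets every
    large box enter it after finitely many steps; its side is the 3 of the estimates below. *)
Let D := box 1.

(** Some large box has mass close to 1, and all words of a sufficient length N map it into D. Hence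
    the mass of D, an average of masses of preimages, is as close to 1. *)
Let m_D : m D = 1.
Proof.
apply/eqP; rewrite eq_le; apply/andP; split.
  rewrite -lee_fin -mu_fin; last exact: mbox.
  by apply: probability_le1; exact: mbox.
rewrite leNgt; apply/negP => mD1; pose e := (1 - m D) / 2.
have e0 : 0 < e by rewrite divr_gt0// subr_gt0.
have [n hn] := box_large e0.
have [t t01 ht] := contraction_ratio.
have [N hN] := @geometric_small R t n%:R 1 t01 ltr01.
have : 1 - e <= m D.
  rewrite (@self_affine_words N)//; last exact: mbox.
  rewrite -[leLHS](@wexp_cst _ _ p N); last by case: hp.
  apply: ler_wexp => [i|u su]; first exact: ltW.
  apply: le_trans hn _; apply: m_le; [exact: mbox|apply: mpre; exact: mbox|].
  move=> z /(word_map_box u t01 ht (ler0n _ n)) /boxP[/andP[h1 h2] /andP[h3 h4]].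
  have h := hN (size u); rewrite su leqnn in h; move: (h isT) h1 h2 h3 h4.
  by rewrite su => *; apply/boxP; split; apply/andP; split; lra.
by rewrite /e; lra.
Qed.

Let m_notD (A : set (plane R)) : measurable A -> A `&` D = set0 -> m A = 0.
Proof.
move=> mA AD; apply/eqP; rewrite eq_le m_ge0 andbT.
have -> : 0 = m (~` D).
  apply: EFin_inj; rewrite -mu_fin; last by apply: measurableC; exact: mbox.
  rewrite probability_setC; last exact: mbox.
  by rewrite mu_fin ?m_D ?subee//; exact: mbox.
apply: m_le => //; first by apply: measurableC; exact: mbox.
by move=> z Az Dz; have : (A `&` D) z by []; rewrite AD.
Qed.

Lemma attractor_box : L `<=` box 0.
Proof.
have [_ /compact_bounded bL _] := hL.
have /ex_strict_bound_gt0[M M0 hM] := bL.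
have LM : L `<=` box M.
  move=> z /hM /= /ltW; rewrite /Num.norm /= ge_max => /andP[].
  by rewrite !ler_norml => /andP[h1 h2] /andP[h3 h4]; apply/boxP;
    split; apply/andP; split; lra.
have [t t01 ht] := contraction_ratio.
move=> z Lz; have [x cx] := exists_coding hL Lz.
have key e : 0 < e -> box e z.
  move=> e0; have [N hN] := @geometric_small R t M e t01 e0.
  have [y Ly <-] := cx N.
  have /boxP := word_map_box (mkseq x N) t01 ht (ltW M0) (LM _ Ly).
  have := hN N (leqnn N); rewrite size_mkseq => h [/andP[h1 h2] /andP[h3 h4]].
  by apply/boxP; split; apply/andP; split; lra.
apply/boxP; split; apply/andP; split;
  apply/ler_addgt0Pr => e /key/boxP[/andP[h1 h2] /andP[h3 h4]]; lra.
Qed.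

Let LD : L `<=` D.
Proof.
move=> z /attractor_box/boxP[/andP[h1 h2] /andP[h3 h4]].
by apply/boxP; split; apply/andP; split; lra.
Qed.

Lemma attractor_diff z z' : L z -> L z' ->
  `|z.1 - z'.1| <= 1 /\ `|z.2 - z'.2| <= 1.
Proof.
move=> /attractor_box/boxP[/andP[h1 h2] /andP[h3 h4]].
move=> /attractor_box/boxP[/andP[h5 h6] /andP[h7 h8]].
by rewrite !ler_norml; split; apply/andP; split; lra.
Qed.

Lemma measurable_eucl_ball (z : R * R) (r : R) :
  measurable (eucl_ball z r : set (plane R)).
Proof.
have mf : measurable_fun setT
    (fun y : plane R => (z.1 - y.1) ^+ 2 + (z.2 - y.2) ^+ 2 : R).
  apply: measurable_funD; apply: measurable_funX; apply: measurable_funB => //.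
have ms := measurableT_comp (continuous_measurable_fun (@sqrt_continuous R)) mf.
have := ms measurableT `]-oo, r[%classic (measurable_itv _).
rewrite setTI; congr measurable; apply/seteqP; split=> y;
  by rewrite /eucl_ball /= in_itv.
Qed.

Lemma D_diff z z' : D z -> D z' -> `|z.1 - z'.1| <= 3 /\ `|z.2 - z'.2| <= 3.
Proof.
move=> /boxP[/andP[h1 h2] /andP[h3 h4]] /boxP[/andP[h5 h6] /andP[h7 h8]].
by rewrite !ler_norml; split; apply/andP; split; lra.
Qed.

Let word_D u z : D z -> D (word_map F u z).
Proof.
have [t t01 ht] := contraction_ratio.
move=> /(word_map_box u t01 ht ler01) /boxP[/andP[h1 h2] /andP[h3 h4]].
have : t ^+ size u * 1 <= 1.
  by rewrite mulr1 exprn_ile1//; case/andP: t01 => /ltW ? /ltW.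
by move=> h; apply/boxP; split; apply/andP; split; lra.
Qed.

(** If u matches x, its map sends all of D into the ball: the columns up to l control the first
    coordinate and the symbols up to k the second. The preimage of the ball then has mass 1, so the
    mass of the ball is at least the probability of matching. *)
Lemma ball_measure_ge z x k l r : coded F L z x -> (k <= l)%N ->
  3 * expR (- psum (lyap1 F) x l) < r / 2 -> 3 * expR (- psum (lyap2 F) x k) < r / 2 ->
  expR (- square_cost F p x k l) <= m (eucl_ball z r).
Proof.
move=> cx kl hl hk; have mB := measurable_eucl_ball z r.
rewrite (self_affine_words l mB) -(@wexp_matches _ _ _ _ _ _ _ l)//; last by case: hp.
apply: ler_wexp => [i|u su]; first exact: ltW.
have [mu_|nm] := pselect (matches F x k l u); last by rewrite not_matches_factor.
rewrite matches_factor// -m_D; apply: m_le; [exact: mbox|exact: mpre|move=> z' Dz' /=].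
have [mk mc] := mu_.
apply: le_lt_trans (eucl_dist_le _ _) _; rewrite [ltRHS]splitr.
have uk : u = mkseq x k ++ drop k u.
  rewrite -[LHS](cat_take_drop k); congr (_ ++ _).
  apply: (@eq_from_nth _ (x 0%N)); first by rewrite size_takel ?size_mkseq// su.
  move=> j; rewrite size_takel ?su// => jk.
  rewrite nth_take// nth_mkseq// -[RHS]mk//; apply: set_nth_default.
  by rewrite su (leq_trans jk).
have uc : map (column_of F) u = map (column_of F) (mkseq x l).
  apply: (@eq_from_nth _ (column_of F (x 0%N))); first by rewrite !size_map su size_iota.
  move=> j; rewrite size_map su => jl.
  rewrite (nth_map (x j)) ?su// (nth_map (x j)) ?size_mkseq// nth_mkseq//.
  exact: mc.
apply: ltrD.
  rewrite (word_map_columns _ uc); have [y Ly <-] := cx l.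
  rewrite word_map_dist1// normrM gtr0_norm ?expR_gt0//.
  apply: le_lt_trans hl; rewrite mulrC ler_wpM2r ?expR_ge0//.
  by have [] := D_diff (LD Ly) Dz'.
rewrite uk word_map_cat; have [y Ly <-] := cx k.
rewrite word_map_dist2// normrM gtr0_norm ?expR_gt0//.
apply: le_lt_trans hk; rewrite mulrC ler_wpM2r ?expR_ge0//.
by have [] := D_diff (LD Ly) (word_D (drop k u) Dz').
Qed.

Lemma word_map_diam (t : R) u z z' : (forall i, beta1 F i <= t /\ beta2 F i <= t) ->
  0 < t < 1 -> D z -> D z' ->
  `|(word_map F u z).1 - (word_map F u z').1| <= t ^+ size u * 3 /\
  `|(word_map F u z).2 - (word_map F u z').2| <= t ^+ size u * 3.
Proof.
move=> ht /andP[t0 t1] Dz Dz'; elim: u => [|i u [h1 h2]] /=.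
  by rewrite expr0 mul1r; exact: D_diff.
rewrite exprS -mulrA; have [b1 b2] := ht i.
have -> (b d a a' : R) : b * a + d - (b * a' + d) = b * (a - a') by ring.
have -> (b d a a' : R) : b * a + d - (b * a' + d) = b * (a - a') by ring.
have b10 := beta1_gt0 hGL i; have b20 := beta2_gt0 hGL i.
rewrite !normrM (gtr0_norm b10) (gtr0_norm b20).
by split; apply: ler_pM => //; exact: ltW.
Qed.

(** Conversely, take words so long that the image of D has size below r. If such an image meets the
    ball, separation forces the word to match x; the other words contribute mass 0. *)
Lemma ball_measure_le : exists2 e : R, 0 < e & forall z x k l r,
  coded F L z x -> (k <= l)%N -> 0 < r ->
  2 * r < e * expR (- psum (lyap1 F) x l) -> 2 * r < e * expR (- psum (lyap2 F) x k) ->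
  m (eucl_ball z r) <= expR (- square_cost F p x k l).
Proof.
have [e e0 he] := separation_matches hGL hL hsep; exists e => //.
move=> z x k l r cx kl r0 hl hk; have mB := measurable_eucl_ball z r.
have [t t01 ht] := contraction_ratio.
have [N hN] := @geometric_small R t 3 r t01 r0.
pose n := maxn N l; have ln : (l <= n)%N := leq_maxr _ _.
rewrite (self_affine_words n mB) -(@wexp_matches _ _ _ _ _ _ _ n)//; last by case: hp.
apply: ler_wexp => [i|u su]; first exact: ltW.
have [mu_|nm] := pselect (matches F x k l u).
  rewrite matches_factor// -m_D; rewrite -lee_fin -!mu_fin; [|exact: mbox|exact: mpre].
  rewrite [leRHS]mu_fin; last exact: mbox.
  by rewrite m_D; apply: probability_le1; exact: mpre.
rewrite not_matches_factor// m_notD//; first exact: mpre.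
apply/seteqP; split=> // z' [] /= Bz' Dz'; apply: nm.
(* Separation concerns points of L, so the point of D is traded for a point of L at a further cost
   r; hence 2 r. *)
have [[y0 Ly0] _ _] := hL; have [y Ly yz] := cx n.
have [d1 d2] := word_map_diam u ht t01 (LD Ly0) Dz'.
have := hN n (leq_maxl _ _); rewrite -su => tr; rewrite su in d1 d2 tr.
have h1 := le_lt_trans (pair_distl_le _ _) Bz'.
have h2 := le_lt_trans (pair_distr_le _ _) Bz'.
have g1 : `|z.1 - (word_map F u y0).1| < 2 * r.
  rewrite -[z.1](subrK (word_map F u z').1) -addrA.
  by apply: le_lt_trans (ler_normD _ _) _; rewrite [`|_.1 - _.1 : R|]distrC in d1; lra.
have g2 : `|z.2 - (word_map F u y0).2| < 2 * r.
  rewrite -[z.2](subrK (word_map F u z').2) -addrA.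
  by apply: le_lt_trans (ler_normD _ _) _; rewrite [`|_.2 - _.2 : R|]distrC in d2; lra.
apply: (he x n y u y0 k l su Ly Ly0 kl ln); rewrite yz; first exact: lt_trans hl.
rewrite gt_max; apply/andP; split; exact: lt_trans hk.
Qed.

Lemma ball_measure_log : exists2 M : R, 0 < M & forall z x k l rho,
  coded F L z x -> (k <= l)%N ->
  (psum (lyap1 F) x l <= rho - M -> psum (lyap2 F) x k <= rho - M ->
   fine (mu (eucl_ball z (expR (- rho)))) <= expR (- square_cost F p x k l)) /\
  (rho + M <= psum (lyap1 F) x l -> rho + M <= psum (lyap2 F) x k ->
   expR (- square_cost F p x k l) <= fine (mu (eucl_ball z (expR (- rho))))).
Proof.
(* This M makes expR M larger than both 6 and 2 / e, the constants of the lower and of the upper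
   mass bound. *)
have [e e0 he] := ball_measure_le; pose M : R := 6 + 2 / e.
have e2 : 0 < 2 / e by rewrite divr_gt0.
exists M; first by rewrite /M; lra.
have M6 : 6 < expR M by apply: lt_le_trans (expR_ge1Dx _); rewrite /M; lra.
have Me : 2 < e * expR M.
  rewrite -ltr_pdivrMl// mulrC; apply: lt_le_trans (expR_ge1Dx _); rewrite /M; lra.
move=> z x k l rho cx kl; split=> h1 h2.
  have rho0 := @expR_gt0 R (- rho).
  have key a : a <= rho - M -> 2 * expR (- rho) < e * expR (- a).
    move=> ha; apply: (@lt_le_trans _ _ (e * expR M * expR (- rho))).
      by rewrite ltr_pM2r.
    by rewrite -mulrA ler_pM2l// -expRD ler_expR; lra.
  by apply: he => //; exact: key.
have rho0 := @expR_gt0 R (- rho - M).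
have key a : rho + M <= a -> 3 * expR (- a) < expR (- rho) / 2.
  move=> ha; apply: (@le_lt_trans _ _ (3 * expR (- rho - M))).
    by rewrite ler_pM2l// ler_expR; lra.
  rewrite ltr_pdivlMr// mulrAC.
  have -> : expR (- rho) = expR M * expR (- rho - M) by rewrite -expRD; congr expR; ring.
  by rewrite ltr_pM2r// ; lra.
by apply: ball_measure_ge => //; exact: key.
Qed.

(** Places the support of mu inside L, so that points of the level set have codings. *)
Lemma ball_measure_off_attractor z : ~ L z -> exists2 r : R, 0 < r &
  fine (mu (eucl_ball z r)) = 0.
Proof.
have [_ cL _] := hL => nLz.
have : nbhs z (~` L).
  apply: open_nbhs_nbhs; split=> //; apply: closed_openC.
  by apply: compact_closed cL; exact: norm_hausdorff.
move=> /nbhs_ballP[r r0 hr]; exists (r / 2); first by rewrite divr_gt0.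
have [t t01 ht] := contraction_ratio.
have [N hN] := @geometric_small R t 3 (r / 2) t01 (divr_gt0 r0 (ltr0Sn R 1)).
have mB := measurable_eucl_ball z (r / 2).
rewrite -/(m _) (self_affine_words N mB) -(@wexp_cst _ _ p N 0); last by case: hp.
apply/eqP; rewrite eq_le; apply/andP; split;
  (apply: ler_wexp => [i|u su]; [exact: ltW|]); last exact: m_ge0.
rewrite m_notD//; first exact: mpre.
apply/seteqP; split=> // z' [] /= Bz' Dz'.
have [[y0 Ly0] _ _] := hL.
apply: (hr (word_map F u y0)); last exact: attractor_word_map.
have [d1 d2] := word_map_diam u ht t01 Dz' (LD Ly0).
have := hN N (leqnn _); rewrite -su => tr.
have h1 := le_lt_trans (pair_distl_le _ _) Bz'.
have h2 := le_lt_trans (pair_distr_le _ _) Bz'.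
split; rewrite /ball /=.
  rewrite -[z.1](subrK (word_map F u z').1) -addrA.
  apply: le_lt_trans (ler_normD _ _) _; rewrite [ltRHS]splitr.
  by apply: ltr_leD => //; exact: le_trans tr.
rewrite -[z.2](subrK (word_map F u z').2) -addrA.
by apply: le_lt_trans (ler_normD _ _) _; lra.
Qed.

End measure_of_balls.

(** * Hausdorff measure *)

Lemma nneseries_le_bound (R : realType) (f : nat -> \bar R) (B : \bar R) :
  (forall n, (0 <= f n)%E) -> (forall N, (\sum_(n < N) f n <= B)%E) ->
  (\sum_(0 <= n <oo) f n <= B)%E.
Proof.
move=> f0 fB; apply: lime_le; first exact: is_cvg_nneseries.
by apply: nearW => N; rewrite big_mkord.
Qed.

Section hausdorff.
Variable R : realType.
Implicit Types (s e : R) (A U : set (R * R)).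

Lemma diam_pow_ge0 s U : (0 <= diam_pow s U)%E.
Proof. by rewrite /diam_pow; case: ifP => // _; rewrite lee_fin powR_ge0. Qed.

Lemma diam_pow0 s : diam_pow s set0 = 0%E :> \bar R.
Proof. by rewrite /diam_pow eqxx. Qed.

Lemma eucl_diam_le e U : 0 <= e ->
  (forall z z', U z -> U z' -> eucl_dist z z' <= e) -> (eucl_diam U <= e%:E)%E.
Proof.
move=> e0 h; apply: ge_ereal_sup => _ [[z z'] [/= Uz Uz'] <-].
by rewrite lee_fin; exact: h.
Qed.

Lemma eucl_dist_le_diam U z z' d : (eucl_diam U <= d%:E)%E -> U z -> U z' ->
  eucl_dist z z' <= fine (eucl_diam U).
Proof.
move=> Ud Uz Uz'.
have h : ((eucl_dist z z')%:E <= eucl_diam U)%E.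
  by apply: ereal_sup_ubound; exists (z, z').
have fin : eucl_diam U \is a fin_num.
  rewrite fin_numE; apply/andP; split; apply/eqP => E; move: h Ud.
    by rewrite E leeNy_eq.
  by rewrite E leye_eq.
by rewrite -lee_fin fineK.
Qed.

Lemma diam_pow_le s e U : 0 <= s -> 0 <= e ->
  (forall z z', U z -> U z' -> eucl_dist z z' <= e) ->
  (diam_pow s U <= (e `^ s)%:E)%E.
Proof.
move=> s0 e0 h; rewrite /diam_pow; case: ifPn => [_|/set0P[z Uz]].
  by rewrite lee_fin powR_ge0.
have Ue := eucl_diam_le e0 h.
have := eucl_dist_le_diam Ue Uz Uz; rewrite /eucl_dist !subrr expr0n addr0 sqrtr0 => d0.
rewrite lee_fin ge0_ler_powR// ?nnegrE//.
move: Ue d0; case: (eucl_diam U) => [r| |] //=; by rewrite ?leye_eq.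
Qed.

Lemma hausdorff_premeasure_ge0 s e A : (0 <= hausdorff_premeasure s e A)%E.
Proof.
apply: le_ereal_inf_tmp => _ [U _ <-]; apply: nneseries_ge0 => n _ _.
exact: diam_pow_ge0.
Qed.

(** Allows a cover to be given in finite stages, one per level l, with a bound on the partial sums
    only. *)
Lemma hausdorff_premeasure_lists s e (B : R) A (S : nat -> seq (set (R * R))) :
  (forall z, A z -> exists n, exists2 U, U \in S n & U z) ->
  (forall n U, U \in S n -> (eucl_diam U <= e%:E)%E) ->
  (forall N, (\sum_(n < N) \sum_(U <- S n) diam_pow s U <= B%:E)%E) ->
  (hausdorff_premeasure s e A <= B%:E)%E.
Proof.
move=> AS Se SB.
(* The empty set in front of each stage costs nothing in the sum and gives [fl N] at least N
   entries, so the m-th entry of the enumeration is settled at stage m.+1. *)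
pose fl N := flatten [seq set0 :: S n | n <- iota 0 N].
have flS N : fl N.+1 = fl N ++ set0 :: S N.
  by rewrite /fl -addn1 iotaD map_cat flatten_cat /= cats0.
have fl_size N : (N <= size (fl N))%N.
  by elim: N => // N IH; rewrite flS size_cat /= addnS ltnS (leq_trans IH)// leq_addr.
have fl_nth M N j : (M <= N)%N -> (j < size (fl M))%N ->
    nth set0 (fl N) j = nth set0 (fl M) j.
  elim: N => [|N IH]; first by rewrite leqn0 => /eqP ->.
  rewrite leq_eqVlt => /predU1P[->//|]; rewrite ltnS => MN jM.
  rewrite flS nth_cat -IH// ; case: ifPn => //; rewrite -leqNgt => jN.
  suff : (size (fl M) <= size (fl N))%N by rewrite leqNgt (leq_ltn_trans jN jM).
  elim: N MN {IH jN} => [|N IH]; first by rewrite leqn0 => /eqP ->.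
  rewrite leq_eqVlt => /predU1P[->//|]; rewrite ltnS => /IH h.
  by rewrite flS size_cat (leq_trans h)// leq_addr.
pose V m := nth set0 (fl m.+1) m.
have VS m : V m = set0 \/ exists n, V m \in S n.
  have : V m \in fl m.+1 by apply: mem_nth; exact: fl_size.
  move=> /flattenP[_ /mapP[n _ ->]]; rewrite inE => /predU1P[->|h]; first by left.
  by right; exists n.
apply: ge_ereal_inf; exists (\sum_(0 <= k <oo) diam_pow s (V k))%E.
  exists V => //; split.
    move=> z /AS[n [U Un Uz]].
    have : U \in fl n.+1 by rewrite flS mem_cat inE Un !orbT.
    move=> /(nthP set0)[j jn UE]; exists j => //; rewrite /V.
    have [nj|/ltnW jn'] := leqP n.+1 j.+1.
      by rewrite (fl_nth n.+1 j.+1)// UE.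
    by rewrite -(fl_nth j.+1 n.+1)// ?UE//; exact: fl_size.
  move=> k; have [->|[n]] := VS k; last exact: Se.
  rewrite /eucl_diam setX0 image_set0 ereal_sup0.
  exact: leNye.
apply: nneseries_le_bound => [n|N]; first exact: diam_pow_ge0.
apply: le_trans (SB N).
have -> : (\sum_(n < N) \sum_(U <- S n) diam_pow s U =
           \sum_(U <- fl N) diam_pow s U)%E.
  have iotaE : iota 0 N = index_iota 0 N by rewrite /index_iota subn0.
  rewrite /fl big_flatten big_map iotaE big_mkord.
  by apply: eq_bigr => n _; rewrite big_cons diam_pow0 /= add0r.
rewrite [leRHS](big_nth set0) [leRHS](big_cat_nat (n := N))//=.
rewrite -[leLHS]adde0; apply: leeD; last first.
  by apply: sume_ge0 => n _; exact: diam_pow_ge0.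
by rewrite !big_mkord; apply: lee_sum => n _; rewrite /V (fl_nth n.+1 N).
Qed.

Lemma hausdorff_measure_eq0 s A :
  (forall d e, 0 < d -> 0 < e -> (hausdorff_premeasure s d A <= e%:E)%E) ->
  hausdorff_measure s A = 0%E.
Proof.
move=> h; apply/eqP; rewrite eq_le; apply/andP; split.
  apply: ge_ereal_sup => _ [d d0 <-]; apply/lee_addgt0Pr => e e0.
  by rewrite add0e; exact: h.
apply: le_trans (hausdorff_premeasure_ge0 s 1 A) _.
by apply: ereal_sup_ubound; exists 1 => //=.
Qed.

Lemma hausdorff_measure_eq0P s A : hausdorff_measure s A = 0%E ->
  forall d e, 0 < d -> 0 < e -> exists U : nat -> set (R * R),
   [/\ A `<=` \bigcup_k U k, forall k, (eucl_diam (U k) <= d%:E)%E &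
    (\sum_(0 <= k <oo) diam_pow s (U k) < e%:E)%E].
Proof.
move=> H0 d e d0 e0.
have : (hausdorff_premeasure s d A < e%:E)%E.
  apply: (@le_lt_trans _ _ 0%E); last by rewrite lte_fin.
  by rewrite -H0; apply: ereal_sup_ubound; exists d.
move=> /ereal_inf_lt[_ [U [AU Ud] <-] Ue].
by exists U.
Qed.

Lemma hausdorff_dim_le s A : 0 <= s ->
  (forall t, s < t -> hausdorff_measure t A = 0%E) -> (hausdorff_dim A <= s%:E)%E.
Proof.
move=> s0 h; rewrite /hausdorff_dim; case: ifP => _; first exact: leNye.
apply/lee_addgt0Pr => e e0; apply: ereal_inf_lbound; exists (s + e) => //=.
by split; [rewrite addr_ge0// ltW|apply: h; rewrite ltrDl].
Qed.

Lemma hausdorff_dim_ge s A : A !=set0 ->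
  (forall t, 0 <= t -> hausdorff_measure t A = 0%E -> s <= t) ->
  (s%:E <= hausdorff_dim A)%E.
Proof.
move=> /set0P A0 h; rewrite /hausdorff_dim (negbTE A0).
by apply: le_ereal_inf_tmp => _ [t [t0 Ht] <-]; rewrite lee_fin; exact: h.
Qed.

End hausdorff.

(** * Coverings by approximate squares *)

Section frequencies.
Variables (R : realType) (I : finType).
Implicit Types (x y : nat -> I).

Definition occurrences x n i : nat := \sum_(m < n) (x m == i).

Definition freq x n i : R := (occurrences x n i)%:R / n%:R.

Lemma occurrences_le x n i : (occurrences x n i <= n)%N.
Proof.
rewrite -[leqRHS]muln1 -[n in (_ <= n * 1)%N]card_ord -sum_nat_const.
by apply: leq_sum => m _; case: eqP.
Qed.

Lemma sum_occurrences x n : (\sum_i occurrences x n i = n)%N.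
Proof.
rewrite exchange_big /= -[RHS]muln1 -[in RHS](card_ord n) -sum_nat_const.
apply: eq_bigr => m _; rewrite (bigD1 (x m))//= eqxx big1// => i.
by rewrite eq_sym => /negbTE ->.
Qed.

Lemma freq_ge0 x n i : 0 <= freq x n i.
Proof. by rewrite divr_ge0. Qed.

Lemma sum_freq x n : (0 < n)%N -> \sum_i freq x n i = 1.
Proof.
move=> n0; rewrite -mulr_suml -natr_sum sum_occurrences divff//.
by rewrite pnatr_eq0 -lt0n.
Qed.

Lemma freq_prob x n : (0 < n)%N -> prob_vec R I (freq x n).
Proof. by move=> n0; split; [exact: freq_ge0|exact: sum_freq]. Qed.

Lemma freq_gt0 x n m : (m < n)%N -> 0 < freq x n (x m).
Proof.
move=> mn; rewrite divr_gt0// ltr0n; last exact: leq_ltn_trans mn.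
by rewrite /occurrences (bigD1 (Ordinal mn))//= eqxx.
Qed.

Lemma psum_freq f x n : psum f x n = n%:R * \sum_i freq x n i * f i.
Proof.
case: n => [|n]; first by rewrite psum0 mul0r.
transitivity (\sum_i (occurrences x n.+1 i)%:R * f i).
  rewrite /occurrences; under [RHS]eq_bigr do rewrite natr_sum mulr_suml.
  rewrite exchange_big; apply: eq_bigr => m _ /=.
  rewrite (bigD1 (x m))//= eqxx mul1r big1 ?addr0// => i.
  by rewrite eq_sym => /negbTE ->; rewrite mul0r.
rewrite mulr_sumr; apply: eq_bigr => i _; rewrite /freq mulrA [_%:R * (_ / _)]mulrC.
by rewrite divfK// pnatr_eq0.
Qed.

Lemma eq_freq x y n : (forall m, (m < n)%N -> x m = y m) -> freq x n = freq y n.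
Proof.
move=> xy; apply/funext => i; rewrite /freq /occurrences.
by congr (_%:R / _); apply: eq_bigr => m _; rewrite xy.
Qed.

End frequencies.

(** Half of the exponential rate absorbs the polynomial, by one term of the exponential series, and
    the other half leaves a geometric tail. The zero terms correspond to a cover that starts at
    level n0. *)
Lemma poly_expR_tail (R : realType) (K a e : R) (d : nat) : 0 <= K -> 0 < a -> 0 < e ->
  exists n0, forall N, \sum_(l < N)
    (if (l < n0)%N then 0 else K * l.+1%:R ^+ d * expR (- a * l%:R)) <= e.
Proof.
move=> K0 a0 e0; pose b := a / 2; have b0 : 0 < b by rewrite divr_gt0.
pose C := K * (d.+1`!%:R / b ^+ d.+1 * expR b).
have C0 : 0 <= C by rewrite !mulr_ge0 ?expR_ge0// invr_ge0 exprn_ge0// ltW.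
have term l : K * l.+1%:R ^+ d * expR (- a * l%:R) <= C * expR (- b) ^+ l.
  have z0 : 0 <= l.+1%:R * b by rewrite mulr_ge0// ltW.
  have bd0 : 0 < b ^+ d.+1 by rewrite exprn_gt0.
  have h : l.+1%:R ^+ d <= d.+1`!%:R / b ^+ d.+1 * expR (l.+1%:R * b).
    apply: (@le_trans _ _ (l.+1%:R ^+ d.+1)).
      by rewrite exprS ler_peMl// ?ler1n// exprn_ge0.
    rewrite mulrAC ler_pdivlMr// -exprMn.
    have := expR_ge1Dxn d z0; have f0 : 0 < d.+1`!%:R :> R by rewrite ltr0n fact_gt0.
    move=> h; rewrite [_`!%:R * _]mulrC -ler_pdivrMr//; apply: le_trans h.
    by rewrite lerDr.
  have -> : C * expR (- b) ^+ l = K * (d.+1`!%:R / b ^+ d.+1 * expR (l.+1%:R * b)) *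
      expR (- a * l%:R).
    rewrite /C -expRM_natl -!mulrA -!expRD; congr (_ * (_ * (_ * expR _))).
    by rewrite -natr1 /b; field.
  by rewrite ler_wpM2r ?expR_ge0// ler_wpM2l.
pose t := expR (- b); have t0 : 0 < t := expR_gt0 _.
have t1 : t < 1 by rewrite expR_lt1 oppr_lt0.
have t01 : 0 < t < 1 by rewrite t0.
have [n0 hn0] := geometric_small (C / (1 - t)) t01 e0; exists n0 => N.
apply: le_trans (hn0 n0 (leqnn _)).
have t1' : 0 < 1 - t by rewrite subr_gt0.
(* An exact identity for the truncated tail plus its remainder; [maxn] also covers the values of N
   below n0. *)
have geo : \sum_(l < N) (if (l < n0)%N then 0 else C * t ^+ l) +
    C * t ^+ (maxn n0 N) / (1 - t) = C * t ^+ n0 / (1 - t).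
  elim: N => [|N IH]; first by rewrite big_ord0 add0r maxn0.
  rewrite big_ord_recr /= -addrA -IH; congr (_ + _).
  case: ltnP => Nn0.
    by rewrite add0r (maxn_idPl Nn0).
  rewrite (maxn_idPr (leqW Nn0)) exprS; field.
  by rewrite gt_eqF.
rewrite mulrCA mulrA -geo.
apply: (@le_trans _ _ (\sum_(l < N) (if (l < n0)%N then 0 else C * t ^+ l))).
  by apply: ler_sum => l _; case: ifP.
by rewrite lerDl divr_ge0 ?(ltW t1')// mulr_ge0// exprn_ge0// ltW.
Qed.

(** * Counting words by their empirical weights *)

Section type_counting.
Variables (R : realType) (I : finType) (F : diag_ifs R I).
Implicit Types (x y : nat -> I).

(** One representative per column: an approximate square is then encoded by a single word, with
    representatives in the positions from k to l. *)
Definition canonical_symbol i := repr (column_of F i).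

Lemma column_of_canonical i : column_of F (canonical_symbol i) = column_of F i.
Proof. by rewrite /column_of /canonical_symbol reprK. Qed.

Lemma canonical_symbolK i : canonical_symbol (canonical_symbol i) = canonical_symbol i.
Proof. by rewrite /canonical_symbol column_of_canonical. Qed.

Lemma sum_col_weight_canonical (q : I -> R) :
  \sum_i (canonical_symbol i == i)%:R * col_weight F q i = \sum_i q i.
Proof.
under eq_bigr do rewrite col_weightE big_mkcond mulr_sumr.
rewrite exchange_big; apply: eq_bigr => j _ /=.
rewrite (bigD1 (canonical_symbol j))//= canonical_symbolK eqxx mul1r.
rewrite column_of_canonical eqxx big1 ?addr0// => i ij.
case: eqP => [ci|_]; last by rewrite mul0r.
case: eqP => [ji|_]; last by rewrite mulr0.
by move: ij; rewrite /canonical_symbol ji -/(canonical_symbol i) ci eqxx.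
Qed.

(* The mass of the approximate square (k, l) of x under its own empirical
   weights, set to zero unless the symbols after k represent their columns. *)
Definition type_weight k l x : R := \prod_(m < l)
  (if (m < k)%N then freq R x k (x m)
   else (canonical_symbol (x m) == x m)%:R * col_weight F (freq R x l) (x m)).

(** Finite words are counted, but frequencies and costs are defined along sequences; the filler i0
    only occupies positions from l on. *)
Definition ext_word i0 l (u : {ffun 'I_l -> I}) : nat -> I :=
  fun m => if insub m is Some j then u j else i0.

Lemma ext_wordE i0 l (u : {ffun 'I_l -> I}) (m : 'I_l) : ext_word i0 u m = u m.
Proof. by rewrite /ext_word valK. Qed.

Lemma col_weight_ge0 (q : I -> R) i : (forall j, 0 <= q j) -> 0 <= col_weight F q i.
Proof. by move=> q0; rewrite col_weightE sumr_ge0. Qed.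

Lemma type_weight_ge0 k l x : 0 <= type_weight k l x.
Proof.
apply: prodr_ge0 => m _; case: ifP => _; first exact: freq_ge0.
by rewrite mulr_ge0// col_weight_ge0//; exact: freq_ge0.
Qed.

(* Each summand is one term of a Bernoulli-type total mass 1, and there are at
   most (l + 1)^(2 #|I|) types. *)
Lemma sum_type_weight i0 k l : (k <= l)%N ->
  \sum_(u : {ffun 'I_l -> I}) type_weight k l (ext_word i0 u) <=
  (l.+1%:R) ^+ (2 * #|I|).
Proof.
move=> kl; pose T := {ffun I -> 'I_l.+1}.
pose vec (t : T) n i : R := (t i)%:R / n%:R.
pose G (t : T * T) m i := if (m < k)%N then vec t.1 k i
  else (canonical_symbol i == i)%:R * col_weight F (vec t.2 l) i.
pose valid (t : T * T) := (\sum_i t.1 i == k)%N && (\sum_i t.2 i == l)%N.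
have G0 t m i : 0 <= G t m i.
  rewrite /G; case: ifP => _; first by rewrite divr_ge0.
  by rewrite mulr_ge0// col_weight_ge0// => j; rewrite divr_ge0.
have G1 t (m : 'I_l) : valid t -> \sum_i G t m i = 1.
  move=> /andP[/eqP t1 /eqP t2]; rewrite /G.
  have vec1 (t' : T) n : (0 < n)%N -> (\sum_i t' i = n)%N -> \sum_i vec t' n i = 1.
    move=> n0 tn; rewrite -mulr_suml -natr_sum tn divff//.
    by rewrite pnatr_eq0 -lt0n.
  case: (ltnP m k) => mk; first by rewrite vec1// (leq_ltn_trans _ mk).
  by rewrite sum_col_weight_canonical vec1// (leq_ltn_trans _ (ltn_ord m)).
pose ty x : T * T := ([ffun i => inord (occurrences x k i)],
                      [ffun i => inord (occurrences x l i)]).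
have tyk x : vec (ty x).1 k = freq R x k.
  apply/funext => i; rewrite /vec ffunE inordK// ltnS.
  by rewrite (leq_trans (occurrences_le _ _ _)).
have tyl x : vec (ty x).2 l = freq R x l.
  by apply/funext => i; rewrite /vec ffunE inordK// ltnS occurrences_le.
have tyv x : valid (ty x).
  rewrite /valid; apply/andP; split; apply/eqP.
    rewrite -[RHS](sum_occurrences x); apply: eq_bigr => i _.
    by rewrite ffunE inordK// ltnS (leq_trans (occurrences_le _ _ _)).
  rewrite -[RHS](sum_occurrences x); apply: eq_bigr => i _.
  by rewrite ffunE inordK// ltnS occurrences_le.
apply: (@le_trans _ _ (\sum_(u : {ffun 'I_l -> I}) \sum_(t : T * T | valid t)
    \prod_(m < l) G t m (u m))).
  apply: ler_sum => u _; rewrite (bigD1 (ty (ext_word i0 u)))//=.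
  rewrite -[leLHS]addr0; apply: lerD; last first.
    by apply: sumr_ge0 => t _; apply: prodr_ge0.
  rewrite le_eqVlt; apply/orP; left; apply/eqP; apply: eq_bigr => m _.
  by rewrite /G tyk tyl ext_wordE.
rewrite exchange_big /=.
under eq_bigr => t vt.
  rewrite -(bigA_distr_bigA (fun (m : 'I_l) i => G t m i)).
  under eq_bigr do rewrite G1//.
  rewrite big1_eq.
  over.
rewrite sumr_const -natrX ler_nat.
apply: leq_trans (max_card _) _.
by rewrite card_prod card_ffun card_ord mul2n -addnn expnD.
Qed.

(** [square_cost] with empirical weights: symbol frequencies up to k and column frequencies up to
    l. *)
Definition type_cost x k l : R :=
  psum (cost (freq R x k)) x k +
  (psum (cost (col_weight F (freq R x l))) x l -
   psum (cost (col_weight F (freq R x l))) x k).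

Lemma type_weight_cost x k l : (k <= l)%N ->
  (forall m, (k <= m < l)%N -> canonical_symbol (x m) = x m) ->
  type_weight k l x = expR (- type_cost x k l).
Proof.
move=> kl hc.
pose A m := cost (freq R x k) (x m) - cost (col_weight F (freq R x l)) (x m).
pose B m := cost (col_weight F (freq R x l)) (x m).
have -> : type_cost x k l = \sum_(m < l)
   ((if (m < k)%N then A m else 0) + (if (m < l)%N then B m else 0)).
  rewrite big_split !sum_ord_if// /A/= sumrB /type_cost /psum /B; ring.
rewrite -sumrN expR_sum; apply: eq_bigr => m _; rewrite /A /B /cost ltn_ord.
case: ltnP => mk; first by rewrite subrK opprK lnK// posrE freq_gt0.
rewrite add0r opprK hc ?mk ?ltn_ord// eqxx mul1r lnK// posrE.
apply: lt_le_trans (freq_gt0 R x (ltn_ord m)) _; apply: col_weight_ge.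
exact: freq_ge0.
Qed.

Lemma col_weight_freqE x n i :
  col_weight F (freq R x n) i = (\sum_(m < n) (column_of F (x m) == column_of F i))%:R / n%:R.
Proof.
rewrite col_weightE /freq -mulr_suml -natr_sum; congr (_%:R / _).
rewrite exchange_big; apply: eq_bigr => m _ /=; rewrite big_mkcond.
rewrite (bigD1 (x m))//= eqxx big1 ?addn0; first by case: ifP.
by move=> j; rewrite eq_sym => /negbTE ->; case: ifP.
Qed.

Lemma col_weight_freq_eq x y n :
  (forall m, (m < n)%N -> column_of F (x m) = column_of F (y m)) ->
  col_weight F (freq R x n) = col_weight F (freq R y n).
Proof.
move=> xy; apply/funext => i; rewrite !col_weight_freqE; congr (_%:R / _).
by apply: eq_bigr => m _; rewrite xy.
Qed.

End type_counting.

(** * Hausdorff measure of limsup sets of approximate squares *)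

Section limsup_cover.
Variables (R : realType) (I : finType) (F : diag_ifs R I) (L : set (R * R)).
Hypothesis hGL : gatzouras_lalley F.
Hypothesis hL : is_attractor F L.

Lemma lyap1_column i j : column_of F i = column_of F j -> lyap1 F i = lyap1 F j.
Proof. by move=> ij; rewrite /lyap1 -!beta_col_col ij. Qed.

Definition approx_square k l (x : nat -> I) : set (R * R) :=
  [set z | exists y, [/\ coded F L z y, forall m, (m < k)%N -> y m = x m &
    forall m, (m < l)%N -> column_of F (y m) = column_of F (x m)]].

Lemma approx_square_dist k l x z z' : approx_square k l x z ->
  approx_square k l x z' ->
  eucl_dist z z' <= expR (- psum (lyap1 F) x l) + expR (- psum (lyap2 F) x k).
Proof.
move=> [y [cy yk yl]] [y' [cy' y'k y'l]].
apply: le_trans (eucl_dist_le _ _) _; apply: lerD.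
  have [w Lw <-] := cy l; have [w' Lw' <-] := cy' l.
  rewrite (word_map_columns w' (v := mkseq y l)); last first.
    rewrite /mkseq -!map_comp; apply/eq_in_map => m; rewrite mem_iota add0n => /andP[_ ml] /=.
    by rewrite y'l// yl.
  rewrite word_map_dist1// normrM gtr0_norm ?expR_gt0//.
  have [d1 _] := attractor_diff hGL hL Lw Lw'.
  have -> : psum (lyap1 F) y l = psum (lyap1 F) x l.
    by apply: eq_bigr => m _; apply/lyap1_column/yl.
  by rewrite -[leRHS]mulr1 ler_wpM2l ?expR_ge0.
have [w Lw <-] := cy k; have [w' Lw' <-] := cy' k.
have -> : mkseq y' k = mkseq y k.
  by apply/eq_in_map => m; rewrite mem_iota add0n => /andP[_ mk]; rewrite y'k// yk.
rewrite word_map_dist2// normrM gtr0_norm ?expR_gt0//.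
have [_ d2] := attractor_diff hGL hL Lw Lw'.
have -> : psum (lyap2 F) y k = psum (lyap2 F) x k by apply: eq_bigr => m _; rewrite yk.
by rewrite -[leRHS]mulr1 ler_wpM2l ?expR_ge0.
Qed.

(** The condition with M makes a square no taller than a constant times its width expR (- a), where
    a is its [psum lyap1]. Its weight is at least expR (- (s * a)), so its diameter to the power t
    is at most a constant times expR (- ((t - s) * a)) times the weight. Weights sum to a polynomial
    in l and a grows linearly, so the tails of the cover are summable. *)
Lemma hausdorff_measure_limsup (s t M : R) (A : set (R * R)) : 0 <= t -> s < t ->
  (forall z, A z -> exists2 x, coded F L z x & forall n0, exists k l,
    [/\ (n0 <= l)%N, (k <= l)%N, psum (lyap1 F) x l - M <= psum (lyap2 F) x k &
        type_cost F x k l <= s * psum (lyap1 F) x l]) ->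
  hausdorff_measure t A = 0%E.
Proof.
move=> t0 st hA; have [i0 _] : exists i : I, True.
  by have := gl_card hGL; case: (pickP I) => [i|/eq_card0 ->]//; exists i.
have [c c0 hc] := @finite_positive_bound R I xpredT (lyap1 F) (fun i _ => lyap1_gt0 hGL i).
have {}hc i : c <= lyap1 F i by exact: hc.
pose C : R := 1 + expR M; have C0 : 0 < C by rewrite addr_gt0// expR_gt0.
apply: hausdorff_measure_eq0 => d e d0 e0.
have tsc : 0 < (t - s) * c by rewrite mulr_gt0// subr_gt0.
(* The exponent is that of the number of types, plus one for the choice of k among l.+1 values. *)
have [n0 hn0] := @poly_expR_tail R (C `^ t) ((t - s) * c) e (2 * #|I|).+1
  (powR_ge0 _ _) tsc e0.
have [n1 hn1] : exists n1, forall l, (n1 <= l)%N -> C * expR (- (c * l%:R)) <= d.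
  have [|n1 hn1] := @geometric_small R (expR (- c)) C d _ d0.
    by rewrite expR_gt0 expR_lt1 oppr_lt0.
  exists n1 => l /hn1; rewrite -expRM_natr mulNr.
  by rewrite [_ * C]mulrC.
pose good l k (u : {ffun 'I_l -> I}) :=
  (psum (lyap1 F) (ext_word i0 u) l - M <= psum (lyap2 F) (ext_word i0 u) k) &&
  (expR (- (s * psum (lyap1 F) (ext_word i0 u) l)) <= type_weight F k l (ext_word i0 u)).
pose S l := if (l < maxn n0 n1)%N then [::] else
  [seq approx_square k l (ext_word i0 u) | k <- iota 0 l.+1,
     u <- [seq u <- enum {: {ffun 'I_l -> I}} | good l k u]].
have dist_le k l (u : {ffun 'I_l -> I}) z z' : good l k u ->
    approx_square k l (ext_word i0 u) z -> approx_square k l (ext_word i0 u) z' ->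
    eucl_dist z z' <= C * expR (- psum (lyap1 F) (ext_word i0 u) l).
  move=> /andP[g _] Qz Qz'; apply: le_trans (approx_square_dist Qz Qz') _.
  by rewrite /C mulrDl mul1r lerD2l -expRD ler_expR; lra.
have ca_ge (x : nat -> I) l : c * l%:R <= psum (lyap1 F) x l.
  by rewrite mulrC; exact: psum_ge.
apply: (@hausdorff_premeasure_lists R t d e A S).
- move=> z /hA[x cx /(_ (maxn n0 n1))[k [l [nl kl g1 g2]]]]; exists l.
  (* Beyond k the code of z is replaced by representatives: the square and its cost are unchanged,
     and the weight of the word does not vanish. *)
  pose y m := if (m < k)%N then x m else canonical_symbol F (x m).
  pose u : {ffun 'I_l -> I} := [ffun m : 'I_l => y m].
  have uy m : (m < l)%N -> ext_word i0 u m = y m.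
    by move=> ml; rewrite -[m]/(nat_of_ord (Ordinal ml)) ext_wordE ffunE.
  have uk m : (m < k)%N -> ext_word i0 u m = x m.
    by move=> mk; rewrite uy ?(leq_trans mk)// /y mk.
  have ul m : (m < l)%N -> column_of F (ext_word i0 u m) = column_of F (x m).
    by move=> ml; rewrite uy// /y; case: ifP => // _; rewrite column_of_canonical.
  exists (approx_square k l (ext_word i0 u)); last first.
    by exists x; split=> // m mk; [rewrite uk|rewrite ul].
  rewrite /S ifN -?leqNgt//.
  apply/allpairsPdep; exists k, u; split=> //.
    by rewrite mem_iota add0n ltnS kl.
  rewrite mem_filter mem_enum andbT /good.
  have -> : psum (lyap1 F) (ext_word i0 u) l = psum (lyap1 F) x l.
    by apply: eq_bigr => m _; apply/lyap1_column/ul.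
  have -> : psum (lyap2 F) (ext_word i0 u) k = psum (lyap2 F) x k.
    by apply: eq_bigr => m _; rewrite uk.
  rewrite g1 /= type_weight_cost//; last first.
    move=> m /andP[km ml]; rewrite uy// /y ltnNge km /=.
    exact: canonical_symbolK.
  rewrite ler_expR lerN2 /type_cost.
  rewrite (eq_freq R uk) (col_weight_freq_eq ul).
  suff [-> [-> ->]] : psum (cost (freq R x k)) (ext_word i0 u) k = psum (cost (freq R x k)) x k /\
    psum (cost (col_weight F (freq R x l))) (ext_word i0 u) l =
      psum (cost (col_weight F (freq R x l))) x l /\
    psum (cost (col_weight F (freq R x l))) (ext_word i0 u) k =
      psum (cost (col_weight F (freq R x l))) x k by [].
  split; first by apply: eq_bigr => m _; rewrite uk.
  split; last by apply: eq_bigr => m _; rewrite uk.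
  by apply: eq_bigr => m _; rewrite /cost /col_weight ul.
- move=> l U; rewrite /S; case: ifPn => //; rewrite -leqNgt geq_max => /andP[_ nl].
  move=> /allpairsPdep[k [u [_ + ->]]]; rewrite mem_filter => /andP[g _].
  apply: eucl_diam_le; first exact: ltW.
  move=> z z' Qz Qz'; apply: le_trans (dist_le _ _ _ _ _ g Qz Qz') _.
  apply: le_trans (hn1 l nl); rewrite ler_wpM2l ?(ltW C0)// ler_expR lerN2.
  exact: ca_ge.
- move=> N; apply: (@le_trans _ _ (\sum_(l < N)
    (if (l < n0)%N then 0
     else C `^ t * l.+1%:R ^+ (2 * #|I|).+1 * expR (- ((t - s) * c) * l%:R))%:E)%E); last first.
    by rewrite sumEFin lee_fin; exact: hn0.
  apply: lee_sum => l _; rewrite /S; case: ifPn.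
    move=> _; rewrite big_nil lee_fin; case: ifP => // _.
    by rewrite !mulr_ge0 ?expR_ge0 ?powR_ge0// exprn_ge0.
  rewrite -leqNgt geq_max => /andP[nl _].
  rewrite [X in (_ <= X%:E)%E]ifN -?leqNgt// big_allpairs_dep.
  pose E := C `^ t * expR (- ((t - s) * c) * l%:R).
  have E0 : 0 <= E by rewrite mulr_ge0 ?powR_ge0 ?expR_ge0.
  have term k (u : {ffun 'I_l -> I}) : good l k u ->
      (diam_pow t (approx_square k l (ext_word i0 u)) <=
       (E * type_weight F k l (ext_word i0 u))%:E)%E.
    move=> g; have := g => /andP[_ g2]; set a := psum (lyap1 F) (ext_word i0 u) l in g2.
    have Ca0 : 0 <= C * expR (- a) by rewrite mulr_ge0 ?expR_ge0 ?ltW.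
    apply: le_trans (diam_pow_le t0 Ca0 _) _; first by move=> z z'; exact: dist_le.
    rewrite lee_fin powRM ?expR_ge0 ?(ltW C0)// /E -mulrA ler_wpM2l ?powR_ge0//.
    apply: (@le_trans _ _ (expR (- ((t - s) * c) * l%:R) * expR (- (s * a)))); last first.
      by rewrite ler_wpM2l ?expR_ge0.
    rewrite -expRM -expRD ler_expR.
    have := ca_ge (ext_word i0 u) l; rewrite -/a => h.
    have : (t - s) * (c * l%:R) <= (t - s) * a.
      by rewrite ler_wpM2l// subr_ge0 ltW.
    by lra.
  have -> : C `^ t * l.+1%:R ^+ (2 * #|I|).+1 * expR (- ((t - s) * c) * l%:R) =
     \sum_(k <- iota 0 l.+1) E * l.+1%:R ^+ (2 * #|I|).
    by rewrite big_const_seq count_predT size_iota iter_addr_0 exprS -mulr_natl /E; ring.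
  rewrite -sumEFin big_seq [leRHS]big_seq; apply: lee_sum => k.
  rewrite mem_iota add0n ltnS => /andP[_ kl].
  rewrite big_filter big_enum_cond /=.
  apply: (@le_trans _ _ (\sum_(u : {ffun 'I_l -> I})
     (E * type_weight F k l (ext_word i0 u))%:E)%E).
    rewrite big_mkcond; apply: lee_sum => u _; case: ifP => [|_]; first exact: term.
    by rewrite lee_fin mulr_ge0// type_weight_ge0.
  rewrite sumEFin lee_fin -mulr_sumr ler_wpM2l//.
  exact: sum_type_weight.
Qed.

End limsup_cover.

(** * Entropy and compactness of the simplex *)

Section entropy_facts.
Variable R : realType.

Lemma ln_inv (x : R) : ln (1 / x) = - ln x.
Proof.
rewrite div1r; have [x0|x0] := ltP 0 x; first by rewrite lnV.
by rewrite !ln0 ?oppr0// invr_le0.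
Qed.

Definition xlnx (x : R) : R := x * - ln x.

Lemma continuous_xlnx : continuous xlnx.
Proof.
move=> x; have [x0|x0|->] := ltgtP x 0.
- apply: (near_cst_continuous 0); near=> y.
  by rewrite /xlnx ln0 ?oppr0 ?mulr0// ltW//; near: y; exact: lt_nbhsl.
- apply: (@continuousM _ _ (fun x => x) (fun x => - ln x)); first exact: cvg_id.
  by apply: continuousN; exact: continuous_ln.
have x0 : xlnx 0 = 0 by rewrite /xlnx mul0r.
apply/cvgrPdist_lt => e e0; rewrite x0; near=> y.
rewrite sub0r normrN /xlnx; have [y0|y0] := ltP 0 y; last first.
  by rewrite ln0// oppr0 mulr0 normr0.
have y1 : y < 1 by near: y; apply: lt_nbhsl; exact: ltr01.
have ye : y < (e / 2) ^+ 2.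
  by near: y; apply: lt_nbhsl; rewrite exprn_gt0// divr_gt0.
(* With y = r ^+ 2, the quantity - y ln y is 2 r ^+ 2 (- ln r) < 2 r, because - ln r < r^-1. *)
set r := Num.sqrt y; have r0 : 0 < r by rewrite sqrtr_gt0.
have yr : y = r ^+ 2 by rewrite sqr_sqrtr// ltW.
have ln0 : 0 <= - ln y by rewrite oppr_ge0 ln_le0// ltW.
rewrite ger0_norm ?mulr_ge0 ?(ltW y0)//.
have re : r < e / 2.
  by rewrite -(@ltr_pXn2r _ 2)// ?nnegrE -?yr// ltW// divr_gt0.
have lnr : - ln r < r^-1.
  by rewrite -lnV ?posrE//; apply: ln_sublinear; rewrite invr_gt0.
rewrite [in ln y]yr lnXn// yr expr2 -mulNrn mulr2n.
have : r * (r * - ln r) < r * 1.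
  rewrite ltr_pM2l//; apply: (@lt_le_trans _ _ (r * r^-1)); first by rewrite ltr_pM2l.
  by rewrite divff// gt_eqF.
rewrite mulr1 => h.
have -> : r * r * (- ln r + - ln r) = 2 * (r * (r * - ln r)) by ring.
by rewrite mulrC -ltr_pdivlMr//; exact: lt_trans h re.
Unshelve. all: by end_near.
Qed.

Lemma gibbs (K : finType) (v q : K -> R) : prob_vec R K v ->
  (forall i, 0 <= q i) -> \sum_i q i <= 1 -> (forall i, 0 < v i -> 0 < q i) ->
  \sum_i v i * - ln (v i) <= \sum_i v i * - ln (q i).
Proof.
move=> [v0 v1] q0 q1 vq; rewrite -subr_ge0 -sumrB.
apply: (@le_trans _ _ (\sum_i (v i - q i))).
  by rewrite sumrB v1 subr_ge0.
apply: ler_sum => i _; have := v0 i; rewrite le_eqVlt => /predU1P[<-|vi].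
  by rewrite !mul0r subrr sub0r oppr_le0.
have qi := vq i vi.
have : ln (q i / v i) <= q i / v i - 1.
  rewrite -[X in ln X](subrKC 1); apply: le_ln1Dx.
  by rewrite ltrBrDl subrr divr_gt0.
rewrite ln_div ?posrE// => h; rewrite -mulrBr opprK addrC.
have : v i * (ln (q i) - ln (v i)) <= v i * (q i / v i - 1) by rewrite ler_pM2l.
have -> : v i * (q i / v i - 1) = q i - v i by field; rewrite gt_eqF.
lra.
Qed.

Lemma cross_entropyE (K : finType) (w q : K -> R) : (forall i, 0 <= w i) ->
  cross_entropy w q = \sum_i w i * - ln (q i).
Proof.
move=> w0; rewrite /cross_entropy big_mkcond; apply: eq_bigr => i _.
rewrite ln_inv; have := w0 i; rewrite le_eqVlt => /predU1P[<-|->] //.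
by rewrite ltxx mul0r.
Qed.

Lemma entropyE (K : finType) (w : K -> R) : (forall i, 0 <= w i) ->
  entropy w = \sum_i xlnx (w i).
Proof. exact: cross_entropyE. Qed.

Lemma entropy_ge0 (K : finType) (w : K -> R) : prob_vec R K w -> 0 <= entropy w.
Proof.
move=> [w0 w1]; rewrite entropyE//; apply: sumr_ge0 => i _.
rewrite mulr_ge0// oppr_ge0 ln_le0// -w1 (bigD1 i)//= lerDl.
exact: sumr_ge0.
Qed.

End entropy_facts.

(** * Column marginals and their entropies *)

Section column_sums.
Variables (R : realType) (I : finType) (F : diag_ifs R I).
Implicit Types w q : I -> R.

Lemma sum_eta w (f : column F -> R) :
  \sum_l eta F w l * f l = \sum_i w i * f (column_of F i).
Proof.
rewrite [RHS](partition_big (column_of F) xpredT)//=; apply: eq_bigr => l _.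
by rewrite /eta mulr_suml; apply: eq_bigr => i /eqP <-.
Qed.

Lemma eta_ge0 w l : (forall i, 0 <= w i) -> 0 <= eta F w l.
Proof. by move=> w0; apply: sumr_ge0. Qed.

Lemma eta_prob w : prob_vec R I w -> prob_vec R (column F) (eta F w).
Proof.
move=> [w0 w1]; split=> [l|]; first exact: eta_ge0.
have := sum_eta w (fun=> 1); under eq_bigr do rewrite mulr1.
by under [X in _ = X -> _]eq_bigr do rewrite mulr1; rewrite w1.
Qed.

Lemma sum_cost_col_weight w q :
  \sum_i w i * cost (col_weight F q) i = \sum_l eta F w l * - ln (eta F q l).
Proof. by rewrite (sum_eta w (fun l => - ln (eta F q l))). Qed.

Lemma entropy_eta_le w : prob_vec R I w -> entropy (eta F w) <= entropy w.
Proof.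
move=> [w0 w1]; rewrite /entropy [leLHS]cross_entropyE => [|l]; last exact: eta_ge0.
rewrite -sum_cost_col_weight cross_entropyE//; apply: ler_sum => i _.
have := w0 i; rewrite le_eqVlt => /predU1P[<-|wi]; first by rewrite !mul0r.
rewrite ler_wpM2l// lerN2 ler_ln ?posrE//; first exact: col_weight_ge.
by apply: lt_le_trans wi _; exact: col_weight_ge.
Qed.

Lemma chi1_eta w : chi1 (eta F w) = \sum_i w i * lyap1 F i.
Proof.
by rewrite /chi1 sum_eta; apply: eq_bigr => i _; rewrite ln_inv beta_col_col.
Qed.

Lemma chi2E w : chi2 F w = \sum_i w i * lyap2 F i.
Proof. by apply: eq_bigr => i _; rewrite ln_inv. Qed.

(* v_dim and u_dim with the column frequencies v, read off at a finer scale,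
   decoupled from those of the symbol frequencies w. *)
Definition pair_dim w (v : column F -> R) :=
  entropy v / chi1 v + (entropy w - entropy (eta F w)) / chi2 F w.

Definition pair_loc (p : I -> R) w (v : column F -> R) :=
  cross_entropy v (eta F p) / chi1 v +
  (cross_entropy w p - cross_entropy (eta F w) (eta F p)) / chi2 F w.

End column_sums.

Section continuity_at_a_point.
Variables (R : realType) (T : topologicalType) (f g : T -> R) (x : T).
Hypotheses (cf : {for x, continuous f}) (cg : {for x, continuous g}).

Lemma continuous_at_add : {for x, continuous (fun y => f y + g y)}.
Proof. exact: continuousD. Qed.

Lemma continuous_at_sub : {for x, continuous (fun y => f y - g y)}.
Proof. exact: continuousB. Qed.

Lemma continuous_at_mul : {for x, continuous (fun y => f y * g y)}.
Proof. exact: continuousM. Qed.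

Lemma continuous_at_div : g x != 0 -> {for x, continuous (fun y => f y / g y)}.
Proof. by move=> gx; apply: continuousM => //; exact: continuousV. Qed.

Lemma continuous_at_norm : {for x, continuous (fun y => `|f y|)}.
Proof. by apply: continuous_comp => //; exact: norm_continuous. Qed.

End continuity_at_a_point.

(** * Compactness of the simplex and the constrained maximum *)

Section simplex_compactness.
Variable R : realType.
Import ArrowAsProduct.

Lemma continuous_sumr (T : topologicalType) (K : finType) (P : pred K)
    (f : K -> T -> R) (x : T) : (forall i, P i -> {for x, continuous (f i)}) ->
  {for x, continuous (fun x => \sum_(i | P i) f i x)}.
Proof.
move=> cf; suff h r : (\sum_(i <- r | P i) f i y) @[y --> x] -->
  \sum_(i <- r | P i) f i x by exact: h.
elim: r => [|i r IH].
  by rewrite big_nil; under eq_fun do rewrite big_nil; exact: cvg_cst.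
rewrite big_cons; under eq_fun do rewrite big_cons; case: (boolP (P i)) => // Pi.
by apply: cvgD => //; exact: cf.
Qed.

Lemma continuous_coord (K : finType) (i : K) : continuous (fun w : K -> R => w i).
Proof. exact: (@proj_continuous K (fun=> R)). Qed.

Lemma continuous_linear_form (K : finType) (f : K -> R) :
  continuous (fun w : K -> R => \sum_i w i * f i).
Proof.
move=> w; apply: continuous_sumr => i _.
apply: (@continuous_at_mul R _ (fun w => w i) (fun=> f i)).
  exact: (@continuous_coord K i w).
exact: cst_continuous.
Qed.

Lemma continuous_entropy_sum (K : finType) :
  continuous (fun w : K -> R => \sum_i xlnx (w i)).
Proof.
move=> w; apply: continuous_sumr => i _.
apply: (@continuous_comp _ _ _ (fun w : K -> R => w i) (@xlnx R)).
  exact: continuous_coord.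
exact: continuous_xlnx.
Qed.

Lemma compact_simplex (K : finType) : compact (prob_vec R K).
Proof.
have cube : compact [set w : K -> R | forall i, `[0, 1]%classic (w i)].
  exact: (@tychonoff K (fun=> R) (fun=> `[0, 1]%classic) (fun=> @segment_compact R 0 1)).
have sum1 (w : K -> R) : \sum_i w i * 1 = \sum_i w i.
  by apply: eq_bigr => i _; rewrite mulr1.
pose A : set (K -> R) := [set w : K -> R | forall i, `[0, 1]%classic (w i)].
pose B : set (K -> R) := [set w : K -> R | \sum_i w i * 1 = 1].
have -> : prob_vec R K = A `&` B.
  rewrite eqEsubset; split=> w.
    move=> [w0 w1]; split; last by rewrite /B /mkset sum1.
    by move=> i; rewrite /mkset in_itv /= w0 -w1 (bigD1 i)//= lerDl sumr_ge0.
  move=> [h1 h2]; split=> [i|]; last by rewrite -h2 sum1.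
  by have := h1 i; rewrite /mkset in_itv => /andP[].
apply: compact_closedI; first exact: cube.
have /continuous_closedP/(_ [set x | x = 1]) := @continuous_linear_form K (fun=> 1).
by apply; exact: closed_eq.
Qed.

Variables (I : finType) (F : diag_ifs R I) (p : I -> R) (alpha : R).
Hypothesis hGL : gatzouras_lalley F.

Lemma chi1_gt0 (v : column F -> R) : prob_vec R (column F) v -> 0 < chi1 v.
Proof.
move=> [v0 v1].
have [c c0 hc] := @finite_positive_bound R I xpredT (lyap1 F) (fun i _ => lyap1_gt0 hGL i).
apply: (@lt_le_trans _ _ c) => //; rewrite -[leLHS]mul1r -v1 mulr_suml.
by apply: ler_sum => l _; rewrite ler_wpM2l// ln_inv; exact: hc.
Qed.

Lemma chi2_gt0 (w : I -> R) : prob_vec R I w -> 0 < chi2 F w.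
Proof.
move=> [w0 w1].
have [c c0 hc] := @finite_positive_bound R I xpredT (lyap2 F) (fun i _ => lyap2_gt0 hGL i).
apply: (@lt_le_trans _ _ c) => //; rewrite -[leLHS]mul1r -w1 mulr_suml.
by apply: ler_sum => l _; rewrite ler_wpM2l// ln_inv; exact: hc.
Qed.

Lemma v_dim_ge0 (w : I -> R) : prob_vec R I w -> 0 <= v_dim F w.
Proof.
move=> hw; have hv := eta_prob F hw; apply: addr_ge0.
  by rewrite divr_ge0 ?entropy_ge0// ltW// chi1_gt0.
by rewrite divr_ge0// ?(ltW (chi2_gt0 hw))// subr_ge0 entropy_eta_le.
Qed.

Let ent_sum (K : finType) (w : K -> R) := \sum_i xlnx (w i).

Let continuous_eta l : continuous (fun w : I -> R => eta F w l).
Proof. by move=> w; apply: continuous_sumr => i _; exact: continuous_coord. Qed.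

Let continuous_ent_eta : continuous (fun w : I -> R => ent_sum (eta F w)).
Proof.
move=> w; apply: continuous_sumr => l _.
apply: (@continuous_comp _ _ _ (fun w : I -> R => eta F w l) (@xlnx R)).
  exact: continuous_eta.
exact: continuous_xlnx.
Qed.

Let continuous_fst_comp (T U : topologicalType) (f : T -> R) : continuous f ->
  continuous (fun z : T * U => f z.1).
Proof.
move=> cf z; apply: (@continuous_comp _ _ _ fst f); last exact: cf.
exact: cvg_fst.
Qed.

Let continuous_snd_comp (T U : topologicalType) (f : U -> R) : continuous f ->
  continuous (fun z : T * U => f z.2).
Proof.
move=> cf z; apply: (@continuous_comp _ _ _ snd f); last exact: cf.
exact: cvg_snd.
Qed.

Let ent_part (w : I -> R) := ent_sum w - ent_sum (eta F w).
Let loc_form (w : I -> R) :=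
  \sum_i w i * - ln (p i) - \sum_i w i * cost (col_weight F p) i.
Let col_form (v : column F -> R) := \sum_l v l * - ln (eta F p l).

Let continuous_ent_part : continuous ent_part.
Proof.
move=> w; apply: continuous_at_sub; last exact: continuous_ent_eta.
exact: continuous_entropy_sum.
Qed.

Let continuous_loc_form : continuous loc_form.
Proof. by move=> w; apply: continuous_at_sub; exact: continuous_linear_form. Qed.

Let continuous_chi1 : continuous (@chi1 R I F).
Proof. exact: continuous_linear_form. Qed.

Let continuous_chi2 : continuous (chi2 F).
Proof. exact: continuous_linear_form. Qed.

Let pair_dimE w v : prob_vec R I w -> prob_vec R (column F) v ->
  pair_dim w v = ent_sum v / chi1 v + ent_part w / chi2 F w.
Proof.
move=> [w0 w1] [v0 v1]; rewrite /pair_dim !entropyE// => l.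
exact: eta_ge0.
Qed.

Let pair_locE w v : prob_vec R I w -> prob_vec R (column F) v ->
  pair_loc p w v = col_form v / chi1 v + loc_form w / chi2 F w.
Proof.
move=> [w0 w1] [v0 v1]; rewrite /pair_loc !cross_entropyE//; last first.
  by move=> l; exact: eta_ge0.
by rewrite /loc_form sum_cost_col_weight.
Qed.

Let PP : set ((I -> R) * (column F -> R)) := prob_vec R I `*` prob_vec R (column F).

Let continuous_pair (f : (column F -> R) -> R) (g : (I -> R) -> R) z : PP z ->
  continuous f -> continuous g -> {for z, continuous
    (fun z => f z.2 / chi1 z.2 + g z.1 / chi2 F z.1)}.
Proof.
move=> [hw hv] cf cg; apply: continuous_at_add; apply: continuous_at_div.
- exact: (continuous_snd_comp cf).
- exact: (continuous_snd_comp continuous_chi1).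
- by rewrite gt_eqF// chi1_gt0.
- exact: (continuous_fst_comp cg).
- exact: (continuous_fst_comp continuous_chi2).
- by rewrite gt_eqF// chi2_gt0.
Qed.

(** Stability of the strict bound v(w) < s when both constraints, eta w = v and u(w) = alpha, hold
    only up to d. By compactness a continuous positive measure of the total defect has a positive
    minimum. *)
Lemma pair_dim_near (s : R) :
  (forall w, prob_vec R I w -> u_dim F p w = alpha -> v_dim F w < s) ->
  exists2 d : R, 0 < d & forall (w : I -> R) (v : column F -> R),
    prob_vec R I w -> prob_vec R (column F) v ->
    (forall l, `|eta F w l - v l| <= d) -> `|pair_loc p w v - alpha| <= d ->
    pair_dim w v < s.
Proof.
move=> hs.
pose dm (z : (I -> R) * (column F -> R)) :=
  ent_sum z.2 / chi1 z.2 + ent_part z.1 / chi2 F z.1.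
pose lc (z : (I -> R) * (column F -> R)) :=
  col_form z.2 / chi1 z.2 + loc_form z.1 / chi2 F z.1.
(* The last summand is 0 exactly when dm z >= s. So f vanishes only at an exact counterexample to
   the hypothesis. *)
pose f z := `|lc z - alpha| + \sum_l `|eta F z.1 l - z.2 l| +
  (s - dm z + `|s - dm z|).
have cf z : PP z -> {for z, continuous f}.
  move=> Pz.
  have cdm : {for z, continuous (fun z => s - dm z)}.
    apply: (@continuous_at_sub R _ (fun=> s) dm); first exact: cst_continuous.
    exact: (continuous_pair Pz (@continuous_entropy_sum _) continuous_ent_part).
  have clc : {for z, continuous (fun z => lc z - alpha)}.
    apply: (@continuous_at_sub R _ lc (fun=> alpha)); last exact: cst_continuous.
    exact: (continuous_pair Pz (@continuous_linear_form _ _) continuous_loc_form).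
  have ce l : {for z, continuous (fun z : (I -> R) * (column F -> R) => eta F z.1 l - z.2 l)}.
    apply: (@continuous_at_sub R _ (fun z : (I -> R) * (column F -> R) => eta F z.1 l)
      (fun z => z.2 l)).
      exact: (continuous_fst_comp (@continuous_eta l)).
    exact: (continuous_snd_comp (@continuous_coord _ l)).
  apply: (@continuous_at_add R _ (fun z => `|lc z - alpha| + \sum_l `|eta F z.1 l - z.2 l|)
    (fun z => s - dm z + `|s - dm z|)); last first.
    exact: (continuous_at_add cdm (continuous_at_norm cdm)).
  apply: (continuous_at_add (continuous_at_norm clc)).
  by apply: continuous_sumr => l _; exact: (continuous_at_norm (ce l)).
have dm0 (z : (I -> R) * (column F -> R)) : 0 <= s - dm z + `|s - dm z|.
  by have := ler_norm (- (s - dm z)); rewrite normrN -subr_ge0 opprK addrC.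
have sm0 (z : (I -> R) * (column F -> R)) : 0 <= \sum_l `|eta F z.1 l - z.2 l|.
  by apply: sumr_ge0.
have f0 z : PP z -> 0 < f z.
  move=> [hw hv]; have a0 := addr_ge0 (normr_ge0 (lc z - alpha)) (sm0 z).
  rewrite lt_neqAle (addr_ge0 a0 (dm0 z)) andbT eq_sym; apply/negP.
  rewrite /f (paddr_eq0 a0 (dm0 z)) (paddr_eq0 (normr_ge0 _) (sm0 z)).
  move=> /andP[/andP[h1 h2] h3].
  have ev : eta F z.1 = z.2.
    apply/funext => l; apply/eqP; rewrite -subr_eq0 -normr_eq0.
    by move: h2; rewrite psumr_eq0// => /allP/(_ l); rewrite mem_index_enum; exact.
  have ha : u_dim F p z.1 = alpha.
    have : pair_loc p z.1 z.2 = alpha.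
      by rewrite pair_locE//; apply/eqP; rewrite -subr_eq0 -normr_eq0.
    by rewrite -ev.
  have := hs _ hw ha; have -> : v_dim F z.1 = dm z by rewrite /dm -pair_dimE// -ev.
  rewrite -subr_gt0 => lt0; move: h3; rewrite gtr0_norm// gt_eqF// addr_gt0//.
have cPP : compact PP by apply: compact_setX; exact: compact_simplex.
have [e e0 he] := compact_positive_bound cPP cf f0.
(* One defect in the local dimension and one per column, each at most d, add up to e / 2. *)
pose d := e / (2 * (1 + #|{: column F}|%:R)).
have d0 : 0 < d by rewrite divr_gt0// mulr_gt0// ltr_wpDr.
exists d => // w v hw hv h1 h2; rewrite ltNge; apply/negP => h3.
have := he (w, v) (conj hw hv); rewrite /f /dm /lc /= -pair_dimE// -pair_locE//.
have -> : s - pair_dim w v + `|s - pair_dim w v| = 0.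
  by rewrite ler0_norm ?subr_le0// subrr.
apply/negP; rewrite -ltNge addr0.
apply: (@le_lt_trans _ _ (d + \sum_(l : column F) d)).
  by apply: lerD => //; apply: ler_sum.
rewrite sumr_const -mulr_natr -[X in X + _]mulr1 -mulrDr /d.
set n := 1 + _; have n0 : 0 < n by rewrite ltr_wpDr.
have -> : e / (2 * n) * n = e / 2 by field; rewrite gt_eqF.
by rewrite ltr_pdivrMr// ltr_pMr// ltr1n.
Qed.

Lemma v_dim_max w0 : prob_vec R I w0 -> u_dim F p w0 = alpha ->
  exists w, [/\ prob_vec R I w, u_dim F p w = alpha & forall w',
    prob_vec R I w' -> u_dim F p w' = alpha -> v_dim F w' <= v_dim F w].
Proof.
move=> hw0 uw0.
(* The constraint with denominators cleared: h is continuous on the whole space, so its zero set is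
   closed. *)
pose h (w : I -> R) := (\sum_i w i * cost (col_weight F p) i) * chi2 F w +
  loc_form w * (\sum_i w i * lyap1 F i) - alpha * ((\sum_i w i * lyap1 F i) * chi2 F w).
have ch : continuous h.
  move=> w; pose cl f := @continuous_linear_form I f w.
  have c1 := continuous_at_mul (cl (cost (col_weight F p))) (@continuous_chi2 w).
  have c2 := continuous_at_mul (@continuous_loc_form w) (cl (lyap1 F)).
  have c3 := continuous_at_mul (cl (lyap1 F)) (@continuous_chi2 w).
  have c0 : {for w, continuous (fun=> alpha)} by exact: cst_continuous.
  have c4 := continuous_at_mul c0 c3.
  exact: (continuous_at_sub (continuous_at_add c1 c2) c4).
have uh w : prob_vec R I w -> (h w = 0) <-> u_dim F p w = alpha.
  move=> hw; have hv := eta_prob F hw.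
  have c1 := chi1_gt0 hv; have c2 := chi2_gt0 hw.
  have -> : u_dim F p w = pair_loc p w (eta F w) by [].
  rewrite pair_locE// /h /col_form -sum_cost_col_weight -chi1_eta.
  set x := \sum_i _; set y := loc_form w.
  have -> : x / chi1 (eta F w) + y / chi2 F w =
      (x * chi2 F w + y * chi1 (eta F w)) / (chi1 (eta F w) * chi2 F w).
    by field; rewrite !gt_eqF.
  have c12 : chi1 (eta F w) * chi2 F w != 0 by rewrite mulf_neq0// gt_eqF.
  split=> [/eqP|<-].
    by rewrite subr_eq0 => /eqP ->; rewrite mulfK.
  by rewrite divfK// subrr.
pose A := prob_vec R I `&` [set w | h w = 0].
have cA : compact A.
  apply: compact_closedI; first exact: compact_simplex.
  have /continuous_closedP/(_ [set x | x = 0]) := ch.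
  by apply; exact: closed_eq.
have A0 : A !=set0 by exists w0; split=> //; apply/(uh _ hw0).
pose g (w : I -> R) := ent_sum (eta F w) / (\sum_i w i * lyap1 F i) + ent_part w / chi2 F w.
have gE w : prob_vec R I w -> g w = v_dim F w.
  move=> hw; have -> : v_dim F w = pair_dim w (eta F w) by [].
  by rewrite pair_dimE//; [rewrite /g chi1_eta|exact: eta_prob].
have cg w : prob_vec R I w -> {for w, continuous g}.
  move=> hw.
  have c1 : \sum_i w i * lyap1 F i != 0.
    by rewrite -chi1_eta gt_eqF// chi1_gt0//; exact: eta_prob.
  have c2 : chi2 F w != 0 by rewrite gt_eqF// chi2_gt0.
  exact: (continuous_at_add
    (continuous_at_div (@continuous_ent_eta w) (@continuous_linear_form _ _ w) c1)
    (continuous_at_div (@continuous_ent_part w) (@continuous_chi2 w) c2)).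
have cgA : {within A, continuous g}.
  by apply: continuous_in_subspaceT => w /set_mem[hw _]; exact: cg.
have [w /set_mem[hw hw'] wmax] := compact_EVT_max A0 cA cgA.
exists w; split=> //; first exact/(uh _ hw).
move=> w' hw1 uw1; rewrite -!gE//; apply: wmax; apply/mem_set; split=> //.
exact/(uh _ hw1).
Qed.

End simplex_compactness.

(** * The upper bound *)

(* Here two columns are needed: the column frequencies then reduce to a single
   slowly varying sequence v, and if v (lf k) - v k kept one sign and stayed away
   from 0, then v would be unbounded along k, lf k, lf (lf k), ... *)
Lemma drift_recurrence (R : realType) (v : nat -> R) (lf : nat -> nat) :
  (forall n, 0 <= v n <= 1) -> (forall k, (k <= lf k)%N) ->
  (forall e, 0 < e -> exists K, forall k, (K <= k)%N ->
     `|(v (lf k.+1) - v k.+1) - (v (lf k) - v k)| <= e) ->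
  forall e, 0 < e -> forall K, exists2 k, (K <= k)%N & `|v (lf k) - v k| <= e.
Proof.
move=> v01 klf slow e e0 K; apply: contrapT => nex.
have far k : (K <= k)%N -> e < `|v (lf k) - v k|.
  by move=> Kk; rewrite ltNge; apply/negP => h; apply: nex; exists k.
have [K1 hK1] := slow e e0; pose K2 := maxn K K1.
have K2K k : (K2 <= k)%N -> (K <= k)%N by apply: leq_trans; exact: leq_maxl.
have K2K1 k : (K2 <= k)%N -> (K1 <= k)%N by apply: leq_trans; exact: leq_maxr.
have iterK2 j : (K2 <= iter j lf K2)%N.
  by elim: j => //= j IH; apply: leq_trans (klf _).
(* After N steps of size e the frequency would leave the unit interval. *)
pose N := (Num.truncn e^-1).+1.
have Ne : 1 < N%:R * e by rewrite -ltr_pdivrMr// div1r truncnS_gt.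
have [h|h] := leP 0 (v (lf K2) - v K2).
  (* The drift changes by at most e from k to k.+1, so it cannot jump from above e to below - e: it
     keeps its sign. *)
  have pos k : (K2 <= k)%N -> e < v (lf k) - v k.
    elim: k => [|k IH]; last rewrite leq_eqVlt => /predU1P[<-|].
    - rewrite leqn0 => /eqP E; have := far 0%N; rewrite -E ger0_norm//.
      by apply; exact: leq_maxl.
    - by have := far K2 (leq_maxl _ _); rewrite ger0_norm.
    rewrite ltnS => K2k; have := IH K2k; have := hK1 k (K2K1 _ K2k).
    have := far k.+1 (K2K _ (leqW K2k)); rewrite ler_norml lter_normr => /orP[//|].
    by move=> ? /andP[? ?] ?; lra.
  have grow j : v K2 + j%:R * e <= v (iter j lf K2).
    elim: j => [|j IH]; first by rewrite mul0r addr0.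
    by have := pos _ (iterK2 j); rewrite /= -natr1 mulrDl mul1r; lra.
  have := grow N; have /andP[? _] := v01 K2; have /andP[_ ?] := v01 (iter N lf K2).
  by lra.
have neg k : (K2 <= k)%N -> v (lf k) - v k < - e.
  elim: k => [|k IH]; last rewrite leq_eqVlt => /predU1P[<-|].
  - rewrite leqn0 => /eqP E; have := far 0%N; rewrite -E ltr0_norm// => f.
    by rewrite ltrNr f// leq_maxl.
  - by have := far K2 (leq_maxl _ _); rewrite ltr0_norm// ltrNr.
  rewrite ltnS => K2k; have := IH K2k; have := hK1 k (K2K1 _ K2k).
  have := far k.+1 (K2K _ (leqW K2k)); rewrite ler_norml lter_normr => /orP[|h1].
    by move=> ? /andP[? ?] ?; lra.
  by move=> _ _; rewrite ltrNr.
have grow j : v (iter j lf K2) <= v K2 - j%:R * e.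
  elim: j => [|j IH]; first by rewrite mul0r subr0.
  by have := neg _ (iterK2 j); rewrite /= -natr1 mulrDl mul1r; lra.
have := grow N; have /andP[_ ?] := v01 K2; have /andP[? _] := v01 (iter N lf K2).
by lra.
Qed.

Lemma local_dim_log (R : realType) (mu : set (R * R) -> \bar R) z alpha :
  has_local_dim mu z alpha <-> forall e : R, 0 < e -> exists2 rho0 : R, 0 < rho0 &
    forall rho, rho0 <= rho ->
    `|ln (fine (mu (eucl_ball z (expR (- rho))))) + alpha * rho| <= e * rho.
Proof.
split=> [/cvgrPdist_le h e e0|h].
  have [d /= d0 hd] := h e e0; exists (1 + `|ln d|) => [|rho hrho].
    by rewrite ltr_wpDr.
  have rho0 : 0 < rho by apply: lt_le_trans hrho; rewrite ltr_wpDr.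
  have rd : expR (- rho) < d.
    rewrite -[ltRHS]lnK ?posrE// ltr_expR; have := ler_norm (- ln d); rewrite normrN.
    by lra.
  have := hd (expR (- rho)); rewrite /= sub0r normrN gtr0_norm ?expR_gt0//.
  move=> /(_ rd isT); rewrite expRK invrN mulrN opprK => hh.
  have -> : ln (fine (mu (eucl_ball z (expR (- rho))))) + alpha * rho =
     rho * (alpha + ln (fine (mu (eucl_ball z (expR (- rho))))) / rho).
    by field; rewrite gt_eqF.
  by rewrite normrM gtr0_norm// [e * _]mulrC ler_pM2l.
apply/cvgrPdist_le => e e0; have [rho0 rho00 hr] := h e e0.
exists (expR (- rho0)) => [|r /=]; first exact: expR_gt0.
rewrite sub0r normrN => + r0; rewrite gtr0_norm// => rr.
have hln : rho0 <= - ln r by rewrite lerNr -ler_expR lnK ?posrE// ltW.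
have ln0 : 0 < - ln r by exact: lt_le_trans hln.
have := hr _ hln; rewrite opprK lnK ?posrE//.
set m := ln _ => hm.
have -> : alpha - m / ln r = (m + alpha * - ln r) / - ln r.
  by field; rewrite -oppr_eq0 gt_eqF.
by rewrite normrM normfV (gtr0_norm ln0) ler_pdivrMr.
Qed.

Section upper_bound.
Variables (R : realType) (I : finType) (F : diag_ifs R I) (L : set (R * R)).
Variables (p : I -> R) (mu : probability (plane R) R) (alpha : R).
Hypothesis hGL : gatzouras_lalley F.
Hypothesis hL : is_attractor F L.
Hypothesis hsep : principal_separation F L.
Hypothesis hcol : #|{: column F}| = 2%N.
Hypothesis hp : prob_vec R I p.
Hypothesis hp0 : forall i, 0 < p i.
Hypothesis hmu : is_self_affine F p mu.

(** Either column frequency is 1 minus the other, so the scalar recurrence controls the whole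
    vector. *)
Lemma eta_dist_two_columns l0 (w : I -> R) (v : column F -> R) (e : R) :
  prob_vec R I w -> prob_vec R (column F) v ->
  `|eta F w l0 - v l0| <= e -> forall l, `|eta F w l - v l| <= e.
Proof.
move=> /(eta_prob F)[_ w1] [_ v1] he l; have [->//|ll0] := eqVneq l l0.
have other f : \sum_(j : column F) f j = 1 -> f l = 1 - f l0 :> R.
  rewrite (bigD1 l0)//= (bigD1 l)//= big1 => [<-|j /andP[j0 jl]].
    by rewrite addr0 addrC addrK.
  have : (2 < #|{: column F}|)%N.
    rewrite -[ltnLHS]/(size [:: l0; l]) ltnNge; apply/negP => h.
    have : (#|[:: j; l; l0]| <= #|{: column F}|)%N by exact: max_card.
    have /card_uniqP -> : uniq [:: j; l; l0] by rewrite /= !inE negb_or jl j0 ll0.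
    by rewrite hcol.
  by rewrite hcol.
rewrite (other _ w1) (other _ v1).
have -> : 1 - eta F w l0 - (1 - v l0) = - (eta F w l0 - v l0) by ring.
by rewrite normrN.
Qed.

(** The cost subtracted on the first k symbols uses the column frequencies at l; by Gibbs it is at
    least k times the column entropy at k. What remains is k (H(w) - H(eta w)), a nonnegative
    multiple of [psum lyap2] at k, and this is at most the same multiple of [psum lyap1] at l. *)
Lemma type_cost_le x k l : (0 < k)%N -> (k <= l)%N ->
  psum (lyap2 F) x k <= psum (lyap1 F) x l ->
  type_cost F x k l <= pair_dim (freq R x k) (eta F (freq R x l)) * psum (lyap1 F) x l.
Proof.
move=> k0 kl hkl; have l0 := leq_trans k0 kl.
have hw := freq_prob R x k0; have hw' := freq_prob R x l0.
have hv := eta_prob F hw; have hv' := eta_prob F hw'.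
set w := freq R x k in hw hv *; set w' := freq R x l in hw' hv' *.
have c1 := chi1_gt0 hGL hv'; have c2 := chi2_gt0 hGL hw.
have kR : 0 < k%:R :> R by rewrite ltr0n.
have lR : 0 < l%:R :> R by rewrite ltr0n.
have A : psum (lyap2 F) x k = k%:R * chi2 F w by rewrite chi2E psum_freq.
have B : psum (lyap1 F) x l = l%:R * chi1 (eta F w') by rewrite chi1_eta psum_freq.
have B0 : 0 < psum (lyap1 F) x l by rewrite B mulr_gt0.
have A0 : 0 < psum (lyap2 F) x k by rewrite A mulr_gt0.
have Hw : psum (cost w) x k = k%:R * entropy w.
  by rewrite psum_freq /entropy cross_entropyE//; case: hw.
have Hv' : psum (cost (col_weight F w')) x l = l%:R * entropy (eta F w').
  by rewrite psum_freq sum_cost_col_weight /entropy cross_entropyE//; case: hv'.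
have Hv : k%:R * entropy (eta F w) <= psum (cost (col_weight F w')) x k.
  rewrite psum_freq -/w sum_cost_col_weight ler_pM2l// /entropy cross_entropyE; last by case: hv.
  apply: gibbs => //; [by case: hv'|by case: hv' => _ ->|].
  move=> c; rewrite {1}/eta => cpos.
  have [i /eqP ci wi] : exists2 i, column_of F i == c & 0 < w i.
    apply: contrapT => nex; move: cpos; rewrite big1 ?ltxx// => i ci.
    apply/eqP; rewrite eq_le; apply/andP; split; last by case: hw.
    by rewrite leNgt; apply/negP => wi; apply: nex; exists i.
  have w'i : 0 < w' i.
    rewrite /w' /freq divr_gt0// ltr0n.
    have : (0 < occurrences x k i)%N.
      by move: wi; rewrite /w /freq pmulr_lgt0 ?invr_gt0// ltr0n.
    move=> o; apply: leq_trans o _; rewrite /occurrences.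
    rewrite (big_ord_widen l (fun m => (x m == i) : nat) kl) big_mkcond /=.
    by apply: leq_sum => m _; case: ifP.
  rewrite -ci; apply: lt_le_trans w'i _.
  by rewrite -[leRHS]/(col_weight F w' i); apply: col_weight_ge; case: hw'.
have H2 : 0 <= (entropy w - entropy (eta F w)) / chi2 F w.
  by rewrite divr_ge0 ?(ltW c2)// subr_ge0 entropy_eta_le.
have e1 : entropy (eta F w') / chi1 (eta F w') * psum (lyap1 F) x l = l%:R * entropy (eta F w').
  by rewrite B; field; rewrite gt_eqF.
have e2 : (entropy w - entropy (eta F w)) / chi2 F w * psum (lyap2 F) x k =
    k%:R * entropy w - k%:R * entropy (eta F w).
  by rewrite A; field; rewrite gt_eqF.
rewrite /type_cost -/w -/w' Hw Hv' /pair_dim mulrDl e1.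
have := ler_wpM2l H2 hkl; rewrite e2; lra.
Qed.

Lemma eta_gt0 l : 0 < eta F p l.
Proof.
rewrite -[l]reprK; apply: lt_le_trans (hp0 (repr l)) _.
by apply: (@col_weight_ge _ _ F p (repr l)) => j; exact: ltW.
Qed.

Lemma square_cost_eq x k l : (0 < k)%N -> (k <= l)%N ->
  square_cost F p x k l =
  (cross_entropy (freq R x k) p - cross_entropy (eta F (freq R x k)) (eta F p)) /
     chi2 F (freq R x k) * psum (lyap2 F) x k +
  cross_entropy (eta F (freq R x l)) (eta F p) / chi1 (eta F (freq R x l)) * psum (lyap1 F) x l.
Proof.
move=> k0 kl; have l0 := leq_trans k0 kl.
have hw := freq_prob R x k0; have hw' := freq_prob R x l0.
have hv := eta_prob F hw; have hv' := eta_prob F hw'.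
have c1 := chi1_gt0 hGL hv'; have c2 := chi2_gt0 hGL hw.
rewrite /square_cost !cross_entropyE; [|by case: hv'|by case: hv|by case: hw].
rewrite -!sum_cost_col_weight (psum_freq (cost p)) !(psum_freq (cost (col_weight F p))).
rewrite (psum_freq (lyap2 F)) (psum_freq (lyap1 F)) -chi1_eta -chi2E.
by field; rewrite !gt_eqF.
Qed.

Lemma level_set_coded z : (msupp mu z /\ has_local_dim mu z alpha) ->
  exists x, coded F L z x.
Proof.
move=> [hz _]; apply: exists_coding => //; apply: contrapT => nLz.
have [r r0 hr] := ball_measure_off_attractor hGL hL hp hp0 hmu nLz.
have := hz r r0; have mB : measurable (eucl_ball z r : set (plane R)).
  exact: measurable_eucl_ball.
by rewrite -(@fineK _ (mu (eucl_ball z r))) ?fin_num_measure// hr ltxx.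
Qed.

(** For each k take l = lf k at the same logarithmic scale up to Ma. Recurrence yields arbitrarily
    large k with close column frequencies; the mass bounds then bring [pair_loc] near alpha, and
    [pair_dim_near] concludes. *)
Lemma level_set_good_scales (s : R) :
  (forall w, prob_vec R I w -> u_dim F p w = alpha -> v_dim F w < s) ->
  forall z, msupp mu z /\ has_local_dim mu z alpha ->
  exists2 x, coded F L z x & forall n0, exists k l,
    [/\ (n0 <= k)%N, (0 < k)%N, (k <= l)%N,
      psum (lyap2 F) x k <= psum (lyap1 F) x l <= psum (lyap2 F) x k + \sum_i `|lyap1 F i| &
      pair_dim (freq R x k) (eta F (freq R x l)) < s].
Proof.
move=> hs z hz; have [x cx] := level_set_coded hz; exists x => // n0.
have [d d0 hd] := pair_dim_near hGL hs.
have [c c0 /all_and2[hc hcb]] := lyap_bound hGL.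
set Ma := \sum_i `|lyap1 F i|; pose Mb := \sum_i `|lyap2 F i|.
have hMa i : lyap1 F i <= Ma by exact: le_sum_norm.
have hMb i : lyap2 F i <= Mb by exact: le_sum_norm.
have [M M0 hM] := ball_measure_log hGL hL hsep hp hp0 hmu.
have /choice[lf lfP] : forall k, exists l,
    psum (lyap2 F) x k < psum (lyap1 F) x l <= psum (lyap2 F) x k + Ma.
  move=> k; have rho0 : 0 <= psum (lyap2 F) x k.
    by apply: sumr_ge0 => m _; exact/ltW/lyap2_gt0.
  have [n /andP[n1 n2]] := psum_crossing x c0 hc rho0; exists n.+1; rewrite n2 /=.
  by rewrite psumS lerD.
have klf k : (k < lf k)%N.
  rewrite ltnNge; apply/negP => /(psum_lyap1_homo hGL x) h; have /andP[h1 _] := lfP k.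
  by have := psum_lyap1_le_lyap2 hGL x k; lra.
(* One more symbol moves the scale by at most Mb, and each position passed by lf is worth at least
   c. *)
have step k : `|(lf k.+1)%:R - (lf k)%:R| * c <= Mb + Ma :> R.
  have pc m n : (m <= n)%N -> (n%:R - m%:R) * c <= psum (lyap1 F) x n - psum (lyap1 F) x m.
    move=> /subnKC <-; elim: (n - m)%N => [|j IH]; first by rewrite addn0 !subrr mul0r.
    by rewrite addnS -natr1 psumS; have := hc (x (m + j)%N); lra.
  have /andP[h1 h2] := lfP k; have /andP[h3 h4] := lfP k.+1.
  have hb := hMb (x k); have hb0 := lyap2_gt0 hGL (x k).
  rewrite psumS in h3 h4.
  have [h|/ltnW h] := leqP (lf k) (lf k.+1).
    by rewrite ger0_norm ?subr_ge0 ?ler_nat//; have := pc _ _ h; lra.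
  rewrite distrC ger0_norm ?subr_ge0 ?ler_nat//; have := pc _ _ h; lra.
pose l0 := column_of F (x 0%N).
pose v n := eta F (freq R x n) l0.
have v01 n : 0 <= v n <= 1.
  (* At n = 0 the division by 0 gives frequency 0, still in the unit interval. *)
  case: n => [|n].
    by rewrite /v /eta big1 ?lexx ?ler01// => i _; rewrite /freq invr0 mulr0.
  have [h0 h1] := eta_prob F (freq_prob R x (ltn0Sn n)).
  by rewrite /v h0 -h1 (bigD1 l0)//= lerDl sumr_ge0.
have vdist m n : (0 < m)%N -> (0 < n)%N -> `|v n - v m| * n%:R <= 2 * `|n%:R - m%:R|.
  move=> m0 n0'; pose N k : R := \sum_(j < k) (column_of F (x j) == l0)%:R.
  have vE k : v k = N k / k%:R.
    by rewrite /v -[eta _ _ _]/(col_weight F _ _) col_weight_freqE /N natr_sum.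
  have Nd a b : (a <= b)%N -> 0 <= N b - N a <= b%:R - a%:R.
    move=> /subnKC <-; elim: (b - a)%N => [|j /andP[IH1 IH2]].
      by rewrite addn0 !subrr lexx.
    have NS : N (a + j).+1 = N (a + j)%N + (column_of F (x (a + j)%N) == l0)%:R.
      by rewrite /N big_ord_recr.
    have b1 : (column_of F (x (a + j)%N) == l0)%:R <= 1 :> R by rewrite lern1 leq_b1.
    have b0 : 0 <= (column_of F (x (a + j)%N) == l0)%:R :> R by [].
    by rewrite addnS NS -natr1; apply/andP; split; lra.
  have Nd' a b : `|N b - N a| <= `|b%:R - a%:R|.
    have [/Nd/andP[h1 h2]|/ltnW/Nd/andP[h1 h2]] := leqP a b.
      by rewrite !ger0_norm//; exact: le_trans h2.
    by rewrite [leLHS]distrC [leRHS]distrC !ger0_norm//; exact: le_trans h2.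
  have mR : 0 < m%:R :> R by rewrite ltr0n.
  have nR : 0 < n%:R :> R by rewrite ltr0n.
  have -> : `|v n - v m| * n%:R = `|(N n - N m) + v m * (m%:R - n%:R)|.
    rewrite -[X in _ * X](gtr0_norm nR) -normrM; congr `|_|.
    by rewrite !vE; field; rewrite !gt_eqF.
  apply: le_trans (ler_normD _ _) _; rewrite mulrDl !mul1r; apply: lerD => //.
  rewrite normrM distrC; have /andP[vm0 vm1] := v01 m.
  by rewrite (ger0_norm vm0) ler_piMl.
have klf' k : (k <= lf k)%N by exact/ltnW/klf.
have slow e : 0 < e -> exists K, forall k, (K <= k)%N ->
    `|(v (lf k.+1) - v k.+1) - (v (lf k) - v k)| <= e.
  move=> e0; pose D : R := 2 * ((Mb + Ma) / c) + 2.
  exists (Num.truncn (D / e)).+1 => k hk.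
  have k0 : (0 < k)%N by exact: leq_ltn_trans hk.
  have kR : 0 < k%:R :> R by rewrite ltr0n.
  have hkD : D <= e * k%:R.
    rewrite mulrC -ler_pdivrMr//; apply: ltW; apply: lt_le_trans (truncnS_gt _) _.
    by rewrite ler_nat.
  have d1 := vdist k.+1 k (ltn0Sn _) k0.
  have d2 := vdist (lf k.+1) (lf k) (leq_ltn_trans (leq0n _) (klf _))
    (leq_ltn_trans (leq0n _) (klf _)).
  have d3 : `|(lf k.+1)%:R - (lf k)%:R| <= (Mb + Ma) / c :> R by rewrite ler_pdivlMr.
  have d4 : `|v (lf k) - v (lf k.+1)| * k%:R <= `|v (lf k) - v (lf k.+1)| * (lf k)%:R.
    by rewrite ler_wpM2l// ler_nat.
  rewrite -[k.+1%:R]natr1 opprD addrA subrr sub0r normrN normr1 in d1.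
  rewrite [`|(lf k)%:R - _|]distrC in d2.
  rewrite -(ler_pM2r kR).
  apply: le_trans hkD.
  apply: (@le_trans _ _ ((`|v (lf k) - v (lf k.+1)| + `|v k - v k.+1|) * k%:R)).
    rewrite ler_wpM2r// ?(ltW kR)//.
    have -> : v (lf k.+1) - v k.+1 - (v (lf k) - v k) =
      - (v (lf k) - v (lf k.+1)) + (v k - v k.+1) by ring.
    by apply: le_trans (ler_normD _ _) _; rewrite normrN.
  by rewrite /D mulrDl; lra.
have rec := drift_recurrence v01 klf' slow d0.
pose a2 := (\sum_i `|cost (col_weight F p) i|) / c.
(* All errors that do not grow with k. The choice of K makes A at least 2 |C| / d, so that they fit
   in d / 2 * A; the relative error e takes the other half. *)
pose C := `|alpha| * (Ma + M) + (Ma + M) + a2 * Ma + M.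
pose e := Num.min 1 (d / 2).
have e1 : e <= 1 by rewrite ge_min lexx.
have ed : e <= d / 2 by rewrite ge_min lexx orbT.
have e0 : 0 < e by rewrite lt_min ltr01 divr_gt0.
have [rho0 rho00 hrho] := (local_dim_log mu z alpha).1 hz.2 e e0.
pose K := (maxn n0 (maxn 1 (Num.truncn ((rho0 + M + 2 * `|C| / d) / c)).+1)).
have [k Kk hk] := rec K.
have k0 : (0 < k)%N by apply: leq_trans Kk; rewrite !leq_max orbT.
have hkl := klf' k; have l0' := leq_trans k0 hkl; set l := lf k in hkl hk l0' *.
have /andP[B1 B2] := lfP k; rewrite -/l in B1 B2.
set A := psum (lyap2 F) x k in B1 B2 *; set B := psum (lyap1 F) x l in B1 B2 *.
have Abig : rho0 + M + 2 * `|C| / d <= A.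
  apply: le_trans (psum_ge x k hcb); rewrite -ler_pdivrMr//.
  apply: ltW; apply: lt_le_trans (truncnS_gt _) _; rewrite ler_nat.
  by apply: leq_trans Kk; rewrite !leq_max leqnn !orbT.
have hw := freq_prob R x k0; have hw' := freq_prob R x l0'; have hv' := eta_prob F hw'.
exists k, l; split=> //.
- by apply: leq_trans Kk; rewrite leq_max leqnn.
- by rewrite B2 ltW.
apply: hd => //.
  by apply: (@eta_dist_two_columns l0) => //; rewrite distrC.
have Ma0 : 0 <= Ma by apply: sumr_ge0.
set pl := pair_loc _ _ _.
have Cd0 : 0 <= 2 * `|C| / d by rewrite divr_ge0 ?mulr_ge0// ltW.
(* The cost normalises its two parts by A and by B; replacing B by A costs at most a2 * Ma. *)
have hsq : exists q : R, [/\ 0 <= q, q <= a2 & square_cost F p x k l = pl * A + q * (B - A)].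
  exists (cross_entropy (eta F (freq R x l)) (eta F p) / chi1 (eta F (freq R x l))).
  have c1 := chi1_gt0 hGL hv'.
  have [v0 _] := hv'; have [w0 w1] := hw'.
  have ctp i : 0 <= cost (col_weight F p) i.
    rewrite oppr_ge0 ln_le0//; have [_ <-] := eta_prob F hp.
    rewrite /col_weight (bigD1 (column_of F i))//= lerDl sumr_ge0// => j _.
    exact/ltW/eta_gt0.
  have n0' : 0 <= cross_entropy (eta F (freq R x l)) (eta F p).
    rewrite cross_entropyE// -sum_cost_col_weight sumr_ge0// => i _.
    by rewrite mulr_ge0.
  split.
  - by rewrite divr_ge0// ltW.
  - apply: ler_pM => //; first by rewrite invr_ge0 ltW.
      rewrite cross_entropyE// -sum_cost_col_weight.
      by apply: ler_sum => i _; rewrite ger0_norm// ler_piMl// -w1 (bigD1 i)//= lerDl sumr_ge0.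
    rewrite lef_pV2 ?posrE// chi1_eta -[leLHS]mul1r -w1 mulr_suml.
    by apply: ler_sum => i _; rewrite ler_wpM2l.
  - by rewrite square_cost_eq// -/A -/B /pl /pair_loc; ring.
have [q [q0 qa sqE]] := hsq; set sq := square_cost _ _ _ _ _ in sqE.
(* B + M is the least rho allowed in the upper mass bound, and A - M below is the largest allowed in
   the lower one. *)
have up : sq <= (alpha + e) * (B + M).
  have [h _] := hM z x k l (B + M) cx hkl.
  have {}h : fine (mu (eucl_ball z (expR (- (B + M))))) <= expR (- sq).
    by apply: h; rewrite addrK// ltW.
  have := hrho (B + M); set m := fine _ in h *.
  have m0 : 0 < m.
    have mB := measurable_eucl_ball z (expR (- (B + M))).
    by rewrite -lte_fin fineK ?fin_num_measure//; apply: hz.1; exact: expR_gt0.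
  have hln : ln m <= - sq by rewrite -[leRHS]expRK ler_ln ?posrE// expR_gt0.
  have hr : rho0 <= B + M by lra.
  by move=> /(_ hr); rewrite ler_norml => /andP[h1 h2]; lra.
have lo : (alpha - e) * (A - M) <= sq.
  have [_ h] := hM z x k l (A - M) cx hkl.
  have {}h : expR (- sq) <= fine (mu (eucl_ball z (expR (- (A - M))))).
    by apply: h; rewrite subrK; [exact: ltW|exact: lexx].
  have := hrho (A - M); set m := fine _ in h *.
  have m0 : 0 < m by exact: lt_le_trans (expR_gt0 _) h.
  have hln : - sq <= ln m by rewrite -[leLHS]expRK ler_ln ?posrE// expR_gt0.
  have hr : rho0 <= A - M by lra.
  by move=> /(_ hr); rewrite ler_norml => /andP[h1 h2]; lra.
have A0 : 0 < A by lra.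
have qB : 0 <= q * (B - A) <= a2 * Ma.
  by rewrite mulr_ge0 ?subr_ge0 ?(ltW B1)//= ler_pM ?subr_ge0 ?(ltW B1)//; lra.
have CA : `|C| <= d / 2 * A.
  have : 2 * `|C| / d <= A by lra.
  by rewrite ler_pdivrMr// => ?; lra.
have aB : alpha * (B + M - A) <= `|alpha| * (Ma + M).
  apply: (@le_trans _ _ (`|alpha| * (B + M - A))).
    by rewrite ler_wpM2r ?ler_norm//; lra.
  by rewrite ler_wpM2l//; lra.
have aM : alpha * M <= `|alpha| * (Ma + M).
  apply: (@le_trans _ _ (`|alpha| * M)); first by rewrite ler_wpM2r ?ler_norm// ltW.
  by rewrite ler_wpM2l//; lra.
have CN := ler_norm C.
have eA : e * A <= d / 2 * A by rewrite ler_pM2r.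
have eB : e * (B + M - A) <= Ma + M.
  by rewrite -[leRHS]mul1r; apply: ler_pM => //; rewrite ?(ltW e0)//; lra.
have eM : 0 <= e * M by rewrite mulr_ge0// ltW.
have CE : C = `|alpha| * (Ma + M) + (Ma + M) + a2 * Ma + M by [].
have a2M : 0 <= a2 * Ma by case/andP: qB => *; lra.
have nE : `|pl - alpha| * A = `|pl * A - alpha * A|.
  by rewrite -mulrBl normrM (gtr0_norm A0).
rewrite -(ler_pM2r A0) nE.
have /andP[qB1 qB2] := qB.
by rewrite ler_norml; apply/andP; split; lra.
Qed.

(** With no admissible w the good scales exist even for s = 0, but [pair_dim] is never negative. *)
Lemma level_set_empty :
  (forall w, prob_vec R I w -> u_dim F p w <> alpha) ->
  [set z | msupp mu z /\ has_local_dim mu z alpha] = set0.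
Proof.
move=> h; apply/seteqP; split=> // z hz.
have [|x cx hx] := @level_set_good_scales 0 _ z hz; first by move=> w /h.
have [k [l [_ k0 kl _]]] := hx 0%N.
have hw := freq_prob R x k0; have hw' := freq_prob R x (leq_trans k0 kl).
have hv' := eta_prob F hw'.
apply/negP; rewrite -leNgt addr_ge0//.
  by rewrite divr_ge0 ?entropy_ge0// ltW// chi1_gt0.
by rewrite divr_ge0 ?(ltW (chi2_gt0 hGL hw))// subr_ge0 entropy_eta_le.
Qed.

Lemma spectrum_le (s : R) : 0 <= s ->
  (forall w, prob_vec R I w -> u_dim F p w = alpha -> v_dim F w <= s) ->
  (multifractal_spectrum mu alpha <= s%:E)%E.
Proof.
move=> s0 hs; apply: hausdorff_dim_le => // t st.
pose s' := (s + t) / 2.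
apply: (@hausdorff_measure_limsup _ _ F L hGL hL s' t (\sum_i `|lyap1 F i|)).
- by apply: le_trans s0 _; exact: ltW.
- by rewrite /s'; lra.
move=> z hz.
have [|x cx hx] := @level_set_good_scales s' _ z hz.
  by move=> w hw uw; apply: le_lt_trans (hs w hw uw) _; rewrite /s'; lra.
exists x => // n0; have [k [l [nk k0 kl /andP[h1 h2] h3]]] := hx n0.
exists k, l; split=> //; first exact: leq_trans kl.
  by rewrite lerBlDr.
apply: le_trans (type_cost_le k0 kl h1) _; rewrite ler_wpM2r ?(ltW h3)//.
by apply: le_trans h1; apply: sumr_ge0 => m _; exact/ltW/lyap2_gt0.
Qed.

End upper_bound.

(** * The lower bound *)

Lemma half_powers_sum (R : realType) (c : R) N : 0 <= c ->
  \sum_(n < N) c / 2 ^+ n.+1 <= c.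
Proof.
move=> c0; have -> : \sum_(n < N) c / 2 ^+ n.+1 = c - c / 2 ^+ N.
  elim: N => [|N IH]; first by rewrite big_ord0 expr0 divr1 subrr.
  rewrite big_ord_recr /= IH exprS; field.
  by rewrite expf_neq0.
by rewrite gerBl divr_ge0// exprn_ge0.
Qed.

(** Turns a product of factors 1 + y into an exponential with quadratic loss, through ln (1 + y) >=
    y / (1 + y) >= y - 2 y ^+ 2. *)
Lemma expR_le_1Dx (R : realType) (y : R) : - (1 / 2) <= y -> expR (y - 2 * y ^+ 2) <= 1 + y.
Proof.
move=> y2; have y1 : 0 < 1 + y by lra.
apply: (@le_trans _ _ (expR (y / (1 + y)))).
  rewrite ler_expR ler_pdivlMr// mulrDr mulr1 -subr_ge0.
  have -> : y - (y - 2 * y ^+ 2 + (y - 2 * y ^+ 2) * y) = y ^+ 2 * (1 + 2 * y) by ring.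
  by rewrite mulr_ge0 ?sqr_ge0//; lra.
rewrite -[leLHS]opprK -[y / _]opprK expRN opprK -[leRHS]invrK lef_pV2 ?posrE ?invr_gt0 ?expR_gt0//.
apply: le_trans (expR_ge1Dx _).
by rewrite le_eqVlt; apply/orP; left; apply/eqP; field; rewrite gt_eqF.
Qed.

(** * Sequences with prescribed frequencies *)

Section regular_sequences.
Variables (R : realType) (I : finType) (w : I -> R).
Hypothesis hw : prob_vec R I w.

Let centred j (i : I) : R := (i == j)%:R - w j.

(** A law of large numbers with its error K fixed in advance: estimates are then uniform over all
    regular sequences and precede the choice of a cover. *)
Definition regular (K : nat -> R) (x : nat -> I) := (forall m, 0 < w (x m)) /\
  forall q n j, `|psum (fun i => (i == j)%:R - w j) x n| <= K q + n%:R / q.+1%:R.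

Let w_le1 j : w j <= 1.
Proof. by case: hw => w0 <-; rewrite (bigD1 j)//= lerDl sumr_ge0. Qed.

(** Deviations are enforced by exponential martingales, one for each symbol, sign and precision,
    added to the given ones. K is chosen before c and h, so a cover may depend on it. *)
Lemma regular_avoidance : exists K, forall (c : nat -> R) (h : nat -> nat -> I -> R),
  (forall k, 0 <= c k) -> (forall k m i, 0 <= h k m i) ->
  (forall k m, \sum_i w i * h k m i = 1) ->
  (\sum_(0 <= k <oo) (c k)%:E <= (1 / 2)%:E)%E ->
  exists x, regular K x /\ forall k n, c k * \prod_(m < n) h k m (x m) < 1.
Proof.
have [w0 w1] := hw; pose N : R := 1 + #|{: I * bool}|%:R.
have N0 : 0 < N by rewrite ltr_wpDr.
(* Fewer than N families, each of total at most kap, use at most 1 / 4 of the budget beside the 1 /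
   2 granted to c. *)
pose kap := (4 * N)^-1; have kap0 : 0 < kap by rewrite invr_gt0 mulr_gt0.
(* The loss 2 t q ^+ 2 per letter, divided by t q, is exactly the slope 1 / q.+1. *)
pose t (q : nat) : R := (2 * q.+1%:R)^-1.
have t0 q : 0 < t q by rewrite invr_gt0 mulr_gt0.
have th q : t q <= 1 / 2.
  rewrite /t invfM mul1r ler_piMr// ?invr_ge0// invf_le1//.
  by rewrite ler1n.
pose cq q := kap / 2 ^+ q.+1; have cq0 q : 0 < cq q by rewrite divr_gt0// exprn_gt0.
pose sg (b : bool) : R := if b then 1 else -1.
pose g (jb : I * bool) i := sg jb.2 * centred jb.1 i.
have g1 jb i : `|g jb i| <= 1.
  rewrite /g normrM; have -> : `|sg jb.2| = 1 by case: (jb.2); rewrite /sg ?normrN normr1.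
  rewrite mul1r /centred; have := w_le1 jb.1; have := w0 jb.1.
  have b1 : (i == jb.1)%:R <= 1 :> R by rewrite lern1 leq_b1.
  have b0 : 0 <= (i == jb.1)%:R :> R by [].
  by move=> ? ?; rewrite ler_norml; apply/andP; split; lra.
have gmean jb : \sum_i w i * g jb i = 0.
  rewrite /g; under eq_bigr do rewrite mulrCA.
  rewrite -mulr_sumr; apply/eqP; rewrite mulf_eq0; apply/orP; right; apply/eqP.
  rewrite /centred; under eq_bigr do rewrite mulrBr.
  rewrite sumrB -mulr_suml w1 mul1r (bigD1 jb.1)//= eqxx mulr1 big1 ?addr0 ?subrr//.
  by move=> i /negbTE ->; rewrite mulr0.
exists (fun q => - ln (cq q) / t q) => c h c0 h0 h1 cs.
pose c' (j : option (I * bool)) k := if j is Some _ then cq k else c k.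
pose h' (j : option (I * bool)) k m i := if j is Some jb then 1 + t k * g jb i else h k m i.
have tg q jb i : - (1 / 2) <= t q * g jb i <= 1 / 2.
  rewrite -ler_norml normrM (gtr0_norm (t0 q)) -[leRHS]mulr1.
  by apply: ler_pM => //; exact: ltW.
have [||||x [x0 hx]] := @martingale_avoidance R I (option (I * bool)) w c' h' hw.
- by move=> [jb|] k //; exact: ltW.
- by move=> [jb|] k m i //=; have /andP[] := tg k jb i; lra.
- move=> [jb|] k m //=; under eq_bigr do rewrite mulrDr mulr1 mulrCA.
  by rewrite big_split/= w1 -mulr_sumr gmean mulr0 addr0.
- rewrite (bigD1 None)//=; apply: (@le_lt_trans _ _ ((1 / 2)%:E + (1 / 4)%:E)%E).
    apply: leeD => //; apply: (@le_trans _ _ (\sum_(j : option (I * bool) | j != None) kap%:E)%E).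
      apply: lee_sum => -[jb|] //= _.
      apply: nneseries_le_bound => [n|M]; first by rewrite lee_fin ltW.
      by rewrite sumEFin lee_fin; exact/half_powers_sum/ltW.
    rewrite sumEFin lee_fin sumr_const -[kap *+ _]mulr_natr /kap.
    rewrite ler_pdivrMl ?mulr_gt0//.
    have -> : 4 * N * (1 / 4) = #|{: option (I * bool)}|%:R.
      by rewrite card_option -natr1 /N; field.
    by rewrite ler_nat; exact: max_card.
  by rewrite -EFinD lte_fin; lra.
exists x; split=> [|k n]; last exact: (hx None).
split=> // q n j.
have dev b : psum (g (j, b)) x n <= - ln (cq q) / t q + n%:R / q.+1%:R.
  have := hx (Some (j, b)) q n; rewrite /= => hlt.
  have : cq q * expR (t q * psum (g (j, b)) x n - 2 * t q ^+ 2 * n%:R) < 1.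
    apply: le_lt_trans hlt; rewrite ler_pM2l//.
    have -> : t q * psum (g (j, b)) x n - 2 * t q ^+ 2 * n%:R =
        \sum_(m < n) (t q * g (j, b) (x m) - 2 * t q ^+ 2).
      by rewrite sumrB sumr_const card_ord -mulr_sumr mulr_natr.
    rewrite expR_sum; apply: ler_prod => m _; rewrite expR_ge0/=.
    have /andP[tg1 tg2] := tg q (j, b) (x m).
    apply: le_trans (expR_le_1Dx tg1); rewrite ler_expR lerD2l lerN2 ler_pM2l//.
    rewrite exprMn ler_piMr ?sqr_ge0// -[leRHS](expr1n _ 2)
      -(real_normK (num_real (g (j, b) (x m)))).
    by rewrite lerXn2r ?nnegrE.
  rewrite mulrC -ltr_pdivlMr// div1r => hh.
  have : t q * psum (g (j, b)) x n - 2 * t q ^+ 2 * n%:R < - ln (cq q).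
    by rewrite -ltr_expR -lnV ?posrE// lnK ?posrE ?invr_gt0.
  move=> h3; rewrite -(ler_pM2l (t0 q)) mulrDr [t q * (_ / t q)]mulrC divfK ?gt_eqF//.
  have -> : t q * (n%:R / q.+1%:R) = 2 * t q ^+ 2 * n%:R.
    by rewrite /t; field; rewrite addrC natr1 pnatr_eq0.
  by lra.
rewrite ler_norml; apply/andP; split; last first.
  have := dev true; rewrite /g /sg /=; congr (_ <= _).
  by apply: eq_bigr => m _; rewrite mul1r.
rewrite lerNl; have := dev false; rewrite /g /sg /=; congr (_ <= _).
by rewrite /psum -sumrN; apply: eq_bigr => m _; rewrite mulN1r.
Qed.

Lemma regular_psum K (f : I -> R) e : 0 < e -> exists2 C : R, 0 <= C &
  forall x n, regular K x -> `|psum f x n - n%:R * \sum_i w i * f i| <= C + e * n%:R.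
Proof.
move=> e0; pose S := \sum_j `|f j|; have S0 : 0 <= S by apply: sumr_ge0.
pose q := Num.truncn (S / e); exists (S * `|K q|) => [|x n [_ hx]].
  by rewrite mulr_ge0.
have -> : psum f x n - n%:R * (\sum_i w i * f i) =
    \sum_j f j * psum (fun i => (i == j)%:R - w j) x n.
  have -> : psum f x n = \sum_j f j * psum (fun i => (i == j)%:R) x n.
    rewrite /psum; under [RHS]eq_bigr do rewrite mulr_sumr.
    rewrite exchange_big; apply: eq_bigr => m _ /=.
    rewrite (bigD1 (x m))//= eqxx mulr1 big1 ?addr0// => j.
    by rewrite eq_sym => /negbTE ->; rewrite mulr0.
  rewrite mulr_sumr -sumrB; apply: eq_bigr => j _.
  by rewrite (psumD (fun i => (i == j)%:R) (fun=> - w j)) psum_const; ring.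
apply: le_trans (ler_norm_sum _ _ _) _.
apply: (@le_trans _ _ (\sum_j `|f j| * (`|K q| + n%:R / q.+1%:R))).
  apply: ler_sum => j _; rewrite normrM ler_wpM2l//.
  by apply: le_trans (hx q n j) _; rewrite lerD2r ler_norm.
rewrite -mulr_suml mulrDr lerD2l mulrCA mulrC ler_wpM2r//.
rewrite ler_pdivrMr// mulrC -ler_pdivrMr//.
by apply/ltW; rewrite truncnS_gt.
Qed.

End regular_sequences.

Section lower_bound.
Variables (R : realType) (I : finType) (F : diag_ifs R I) (w : I -> R) (K : nat -> R).
Hypothesis hGL : gatzouras_lalley F.
Hypothesis hw : prob_vec R I w.

Lemma regular_square_cost (q : I -> R) M e : 0 < e -> exists2 C : R, 0 <= C &
  forall x k l rho, regular w K x -> 0 <= rho ->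
    `|psum (lyap2 F) x k - rho| <= M -> `|psum (lyap1 F) x l - rho| <= M ->
    `|square_cost F q x k l - u_dim F q w * rho| <= C + e * rho.
Proof.
move=> e0; have hv := eta_prob F hw; have [w0 w1] := hw.
have c1 := chi1_gt0 hGL hv; have c2 := chi2_gt0 hGL hw.
have [c c0 /all_and2[hc hcb]] := lyap_bound hGL.
pose f i := cost q i - cost (col_weight F q) i; pose f' := cost (col_weight F q).
pose m1 := (\sum_i w i * f i) / chi2 F w.
pose m2 := (\sum_i w i * f' i) / chi1 (eta F w).
have uE : u_dim F q w = m2 + m1.
  rewrite /u_dim !cross_entropyE//; last by case: hv.
  rewrite -!sum_cost_col_weight /m1 /m2 /f; congr (_ + _ / _).
  by rewrite -sumrB; apply: eq_bigr => i _; rewrite mulrBr.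
(* Subtracting multiples of the exponents makes the means vanish: k and l then enter the main term
   only through sums known to be close to rho. *)
pose g i := f i - m1 * lyap2 F i; pose g' i := f' i - m2 * lyap1 F i.
have g0 : \sum_i w i * g i = 0.
  rewrite /g; under eq_bigr do rewrite mulrBr mulrCA.
  by rewrite sumrB -mulr_sumr -chi2E /m1 divfK ?subrr// gt_eqF.
have g0' : \sum_i w i * g' i = 0.
  rewrite /g'; under eq_bigr do rewrite mulrBr mulrCA.
  by rewrite sumrB -mulr_sumr -chi1_eta /m2 divfK ?subrr// gt_eqF.
pose e' := e * c / 2; have e'0 : 0 < e' by rewrite divr_gt0// mulr_gt0.
have [C1 C10 hC1] := @regular_psum R I w K g e' e'0.
have [C2 C20 hC2] := @regular_psum R I w K g' e' e'0.
exists (C1 + C2 + (`|m1| + `|m2| + e) * `|M|).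
  by rewrite !addr_ge0// mulr_ge0// !addr_ge0// ltW.
move=> x k l rho hx rho0 hk hl.
have hM := ler_norm M.
have := hC1 x k hx; rewrite g0 mulr0 subr0 => h1.
have := hC2 x l hx; rewrite g0' mulr0 subr0 => h2.
have pg : psum g x k = psum (cost q) x k - psum f' x k - m1 * psum (lyap2 F) x k.
  by rewrite /psum mulr_sumr -!sumrB.
have pg' : psum g' x l = psum f' x l - m2 * psum (lyap1 F) x l.
  by rewrite /psum mulr_sumr -!sumrB.
have kb : e' * k%:R <= e / 2 * (rho + `|M|).
  have -> : e' * k%:R = e / 2 * (k%:R * c) by rewrite /e'; field.
  rewrite ler_pM2l ?divr_gt0//; have := psum_ge x k hcb.
  move: hk; rewrite ler_norml => /andP[_ ?]; lra.
have lb : e' * l%:R <= e / 2 * (rho + `|M|).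
  have -> : e' * l%:R = e / 2 * (l%:R * c) by rewrite /e'; field.
  rewrite ler_pM2l ?divr_gt0//; have := psum_ge x l hc.
  move: hl; rewrite ler_norml => /andP[_ ?]; lra.
have -> : square_cost F q x k l - u_dim F q w * rho = (psum g x k + psum g' x l) +
    (m1 * (psum (lyap2 F) x k - rho) + m2 * (psum (lyap1 F) x l - rho)).
  by rewrite pg pg' /square_cost uE -/f'; ring.
have n1 : `|m1 * (psum (lyap2 F) x k - rho)| <= `|m1| * `|M|.
  by rewrite normrM ler_wpM2l//; exact: le_trans hM.
have n2 : `|m2 * (psum (lyap1 F) x l - rho)| <= `|m2| * `|M|.
  by rewrite normrM ler_wpM2l//; exact: le_trans hM.
apply: le_trans (ler_normD _ _) _.
have := ler_normD (psum g x k) (psum g' x l).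
have := ler_normD (m1 * (psum (lyap2 F) x k - rho)) (m2 * (psum (lyap1 F) x l - rho)).
lra.
Qed.

Lemma adapted_scales x rho : 0 <= rho -> exists k l,
  [/\ (k <= l)%N, psum (lyap2 F) x k <= rho < psum (lyap2 F) x k.+1 &
      psum (lyap1 F) x l <= rho < psum (lyap1 F) x l.+1].
Proof.
move=> rho0.
have [c c0 /all_and2[hc hcb]] := lyap_bound hGL.
have [k hk] := psum_crossing x c0 hcb rho0.
have [l hl] := psum_crossing x c0 hc rho0; exists k, l; split=> //.
rewrite leqNgt; apply/negP => /(psum_lyap1_homo hGL x) h.
have := psum_lyap1_le_lyap2 hGL x k; move: hk hl => /andP[? _] /andP[_ ?]; lra.
Qed.

End lower_bound.

(** * Local dimension and covers of the set of regular points *)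

Section lower_bound_dimension.
Variables (R : realType) (I : finType) (F : diag_ifs R I) (L : set (R * R)).
Variables (p : I -> R) (mu : probability (plane R) R).
Hypothesis hGL : gatzouras_lalley F.
Hypothesis hL : is_attractor F L.
Hypothesis hsep : principal_separation F L.
Hypothesis hp : prob_vec R I p.
Hypothesis hp0 : forall i, 0 < p i.
Hypothesis hmu : is_self_affine F p mu.
Variables (w : I -> R) (K : nat -> R).
Hypothesis hw : prob_vec R I w.

Lemma coded_msupp z x : coded F L z x -> msupp mu z.
Proof.
move=> cx r r0; have [M M0 hM] := ball_measure_log hGL hL hsep hp hp0 hmu.
have [c c0 /all_and2[hc hcb]] := lyap_bound hGL.
pose rho := - ln r; pose n := (Num.truncn ((rho + M) / c)).+1.
have nc : rho + M <= n%:R * c by rewrite -ler_pdivrMr// ltW// truncnS_gt.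
have [_ h] := hM z x n n rho cx (leqnn n).
have {}h : expR (- square_cost F p x n n) <= fine (mu (eucl_ball z r)).
  have -> : r = expR (- rho) by rewrite opprK lnK.
  by apply: h; apply: le_trans nc _; exact: psum_ge.
have mB := measurable_eucl_ball z r.
rewrite -[X in (_ < X)%E]fineK ?fin_num_measure// lte_fin.
by apply: lt_le_trans h; exact: expR_gt0.
Qed.

Lemma regular_local_dim z x : coded F L z x -> regular w K x ->
  has_local_dim mu z (u_dim F p w).
Proof.
move=> cx hx; apply/local_dim_log => e e0.
have [M M0 hM] := ball_measure_log hGL hL hsep hp hp0 hmu.
pose Ma := \sum_i `|lyap1 F i|; pose Mb := \sum_i `|lyap2 F i|.
have Ma0 : 0 <= Ma by apply: sumr_ge0.
have Mb0 : 0 <= Mb by apply: sumr_ge0.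
have hMa i : lyap1 F i <= Ma by exact: le_sum_norm.
have hMb i : lyap2 F i <= Mb by exact: le_sum_norm.
have e20 : 0 < e / 2 by rewrite divr_gt0.
have [C C0 hC] := @regular_square_cost R I F w K hGL hw p (M + Ma + Mb) _ e20.
exists (1 + M + C / (e / 2)).
  by rewrite ltr_wpDr ?divr_ge0 ?(ltW e20)//; lra.
move=> rho hrho.
have Ce0 : 0 <= C / (e / 2) by rewrite divr_ge0// ltW.
have Ce : C <= e / 2 * rho by rewrite mulrC -ler_pdivrMr//; lra.
have rM : 0 <= rho - M by lra.
have rM' : 0 <= rho + M by lra.
have rho0 : 0 <= rho by lra.
set m := fine _; set u := u_dim F p w.
have [k [l [kl /andP[k1 k2] /andP[l1 l2]]]] := adapted_scales hGL x rM.
have up : ln m <= - (u * rho - C - e / 2 * rho).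
  have [h _] := hM z x k l rho cx kl; have {}h := h l1 k1.
  rewrite psumS in k2; rewrite psumS in l2.
  have hk := hMb (x k); have hl := hMa (x l).
  have := hC x k l rho hx rho0.
  rewrite !ler_norml => /(_ _ _)/andP[||h1 h2].
  - by apply/andP; split; lra.
  - by apply/andP; split; lra.
  have m0 : 0 < m.
    rewrite /m -lte_fin fineK; last by rewrite fin_num_measure//; exact: measurable_eucl_ball.
    by apply: (coded_msupp cx); exact: expR_gt0.
  have : ln m <= - square_cost F p x k l by rewrite -[leRHS]expRK ler_ln ?posrE// expR_gt0.
  by rewrite -/u in h1; lra.
(* The lower mass bound needs indices past rho + M, hence the successors of k' and l' below. *)
have [k' [l' [kl' /andP[k1' k2'] /andP[l1' l2']]]] := adapted_scales hGL x rM'.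
have lo : - (u * rho + C + e / 2 * rho) <= ln m.
  have [_ h] := hM z x k'.+1 l'.+1 rho cx kl'; have {}h := h (ltW l2') (ltW k2').
  rewrite -/m in h.
  have := hC x k'.+1 l'.+1 rho hx rho0.
  have hk := hMb (x k'); have hl := hMa (x l').
  rewrite !psumS in k2' l2' *.
  rewrite !ler_norml => /(_ _ _)/andP[||h1 h2].
  - by apply/andP; split; lra.
  - by apply/andP; split; lra.
  have : - square_cost F p x k'.+1 l'.+1 <= ln m.
    rewrite -[leLHS]expRK ler_ln ?posrE// ?expR_gt0//.
    by apply: lt_le_trans h; exact: expR_gt0.
  by rewrite -/u in h2; lra.
by rewrite ler_norml; apply/andP; split; lra.
Qed.

(** Points within expR (- rho) share an approximate square of that scale, with D uniform in the
    coding. A covering set thus has all its coded points in the square of any one of them. *)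
Lemma regular_code_agree : exists2 D : R, 0 <= D & forall rho, D <= rho ->
  forall x, exists k l, [/\ (k <= l)%N, `|psum (lyap2 F) x k - rho| <= D,
    `|psum (lyap1 F) x l - rho| <= D & forall z z' x', coded F L z x -> coded F L z' x' ->
    eucl_dist z z' <= expR (- rho) -> matches F x k l (mkseq x' l)].
Proof.
have [e e0 he] := separation_matches hGL hL hsep.
pose Ma := \sum_i `|lyap1 F i|; pose Mb := \sum_i `|lyap2 F i|.
have Ma0 : 0 <= Ma by apply: sumr_ge0.
have Mb0 : 0 <= Mb by apply: sumr_ge0.
have hMa i : lyap1 F i <= Ma by exact: le_sum_norm.
have hMb i : lyap2 F i <= Mb by exact: le_sum_norm.
exists (Ma + Mb + `|ln e| + 1); first by rewrite !addr_ge0.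
move=> rho hrho x; have := ler_norm (ln e); have := ler_norm (- ln e).
rewrite normrN => ln1 ln2; have lnn := normr_ge0 (ln e).
(* The term ln e absorbs the separation constant and - 1 makes the comparison strict. *)
have rho0 : 0 <= rho + ln e - 1 by lra.
have [k [l [kl /andP[k1 k2] /andP[l1 l2]]]] := adapted_scales hGL x rho0.
have hk := hMb (x k); have hl := hMa (x l).
rewrite psumS in k2; rewrite psumS in l2.
exists k, l; split=> //.
- by rewrite ler_norml; apply/andP; split; lra.
- by rewrite ler_norml; apply/andP; split; lra.
move=> z z' x' cx cx' dz.
have [y Ly zy] := cx l; have [y' Ly' zy'] := cx' l.
have small a : a <= rho + ln e - 1 -> expR (- rho) < e * expR (- a).
  move=> ha; rewrite -[e in ltRHS]lnK ?posrE// -expRD ltr_expR; lra.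
apply: (he x l y (mkseq x' l) y' k l) => //; rewrite ?size_mkseq// zy zy'.
  by apply: le_lt_trans (small _ l1); exact: le_trans (pair_distl_le _ _) dz.
rewrite gt_max; apply/andP; split; apply: le_lt_trans (small _ k1).
  exact: le_trans (pair_distl_le _ _) dz.
exact: le_trans (pair_distr_le _ _) dz.
Qed.

(* The conditional mass of an approximate square, as a martingale for the
   Bernoulli measure with weights w. *)
Let mart x k l m i : R := approx_square_factor F x k l m i /
  (if (m < k)%N then w (x m) else if (m < l)%N then col_weight F w (x m) else 1).

Let mart_den x k l m : (forall m, 0 < w (x m)) ->
  0 < (if (m < k)%N then w (x m) else if (m < l)%N then col_weight F w (x m) else 1).
Proof.
move=> wx; have [w0 _] := hw; case: ifP => // _; case: ifP => // _.
by apply: lt_le_trans (wx m) (col_weight_ge _ _ _).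
Qed.

Let mart_ge0 x k l m i : (forall m, 0 < w (x m)) -> 0 <= mart x k l m i.
Proof.
by move=> wx; rewrite divr_ge0 ?approx_square_factor_ge0// ltW// mart_den.
Qed.

Let mart_mean x k l m : (forall m, 0 < w (x m)) -> \sum_i w i * mart x k l m i = 1.
Proof.
move=> wx; rewrite /mart; under eq_bigr do rewrite mulrA.
rewrite -mulr_suml approx_square_factorE; last by case: hw.
by rewrite divff// gt_eqF// mart_den.
Qed.

Let mart_matches x x' k l : (forall m, 0 < w (x m)) -> (k <= l)%N ->
  matches F x k l (mkseq x' l) ->
  expR (- square_cost F w x k l) * \prod_(m < l) mart x k l m (x' m) = 1.
Proof.
move=> wx kl hm; have [w0 _] := hw.
rewrite -(square_cost_prod F w0 wx kl (leqnn l)) -big_split /=.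
rewrite -[RHS](matches_factor kl (leqnn l) hm); apply: eq_bigr => m _.
by rewrite /mart mulrC divfK ?gt_eqF// ?mart_den// nth_mkseq.
Qed.

(** A cover with small sum of t-th powers gives approximate squares of small total w-mass. A regular
    sequence avoiding all of them codes a point of E outside the cover, a contradiction. *)
Lemma regular_hausdorff (E : set (R * R)) (t : R) :
  (forall (c : nat -> R) (h : nat -> nat -> I -> R),
    (forall k, 0 <= c k) -> (forall k m i, 0 <= h k m i) ->
    (forall k m, \sum_i w i * h k m i = 1) ->
    (\sum_(0 <= k <oo) (c k)%:E <= (1 / 2)%:E)%E ->
    exists x, regular w K x /\ forall k n, c k * \prod_(m < n) h k m (x m) < 1) ->
  (forall z x, coded F L z x -> regular w K x -> E z) ->
  0 <= t -> hausdorff_measure t E = 0%E -> v_dim F w <= t.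
Proof.
move=> avoid hE t0 HE; rewrite leNgt; apply/negP => tv.
(* The midpoint is positive even for t = 0, as the power s^-1 in [tau] requires. *)
pose s := (t + v_dim F w) / 2.
have ts : t < s by rewrite /s; lra.
have sv : s < v_dim F w by rewrite /s; lra.
have s0 : 0 < s by exact: le_lt_trans ts.
have [D D0 hD] := regular_code_agree.
pose e := v_dim F w - s; have e0 : 0 < e by rewrite subr_gt0.
have e20 : 0 < e / 2 by rewrite divr_gt0.
have [C C0 hC] := @regular_square_cost R I F w K hGL hw w D _ e20.
(* Beyond rho0 the constant C is at most e / 2 * rho, so the cost of a square is at least (v_dim F w
   - e) * rho = s * rho. *)
pose rho0 := D + C / (e / 2).
have Ce0 : 0 <= C / (e / 2) by rewrite divr_ge0// ltW.
have rho00 : 0 <= rho0 by rewrite addr_ge0.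
pose d := expR (- rho0); have d0 : 0 < d by exact: expR_gt0.
have d1 : d <= 1 by rewrite expR_le1 oppr_le0.
have [U [EU Ud Usum]] := hausdorff_measure_eq0P HE d0 (divr_gt0 ltr01 (ltr0Sn R 3)).
(* A positive floor for the diameters, since a set of diameter 0 defines no scale. The s-th powers
   of the floors sum to at most 1 / 4. *)
pose tau n := Num.min d ((1 / 4 / 2 ^+ n.+1) `^ s^-1).
have tau0 n : 0 < tau n.
  by rewrite lt_min d0 powR_gt0// divr_gt0// exprn_gt0.
pose r n := Num.max (fine (eucl_diam (U n))) (tau n).
have r0 n : 0 < r n by rewrite lt_max tau0 orbT.
have taus n : tau n `^ s <= 1 / 4 / 2 ^+ n.+1.
  have h4 : 0 <= 1 / 4 / 2 ^+ n.+1 :> R by rewrite divr_ge0// exprn_ge0.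
  apply: (@le_trans _ _ (((1 / 4 / 2 ^+ n.+1) `^ s^-1) `^ s)).
    by rewrite ge0_ler_powR ?nnegrE ?(ltW s0) ?(ltW (tau0 n)) ?powR_ge0// ge_min lexx orbT.
  by rewrite -powRrM mulVf ?gt_eqF// powRr1.
have diam_bound n z : U n z -> 0 <= fine (eucl_diam (U n)) <= d.
  move=> Uz; have := eucl_dist_le_diam (Ud n) Uz Uz.
  rewrite /eucl_dist !subrr expr0n addr0 sqrtr0 => -> /=.
  by move: (Ud n); case: (eucl_diam (U n)) => [a| |] //=; rewrite ?leye_eq ?(ltW d0).
have rs n z : U n z -> ((r n `^ s)%:E <= diam_pow t (U n) + (1 / 4 / 2 ^+ n.+1)%:E)%E.
  move=> Uz; have /andP[a0 ad] := diam_bound n z Uz; set a := fine _ in a0 ad.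
  have -> : diam_pow t (U n) = (a `^ t)%:E.
    by rewrite /diam_pow; case: eqP => // UE; move: Uz; rewrite UE.
  rewrite -EFinD lee_fin /r -/a; case: (leP a (tau n)) => _.
    by apply: le_trans (taus n) _; rewrite lerDr powR_ge0.
  apply: (@le_trans _ _ (a `^ t)).
    move: a0; rewrite le_eqVlt => /predU1P[<-|a0].
      by rewrite powR0 ?gt_eqF// powR_ge0.
    by apply: ger_powR; [rewrite a0 (le_trans ad)|exact: ltW].
  by rewrite lerDl divr_ge0// exprn_ge0.
pose good n z x := [/\ U n z, coded F L z x & regular w K x].
have i0 : I.
  have [_ w1] := hw; case: (pickP I) => [i _|I0]; first exact: i.
  by exfalso; move: w1; rewrite big_pred0// => /eqP; rewrite eq_sym oner_eq0.
have /choice[zx zxP] : forall n, exists zx : (R * R) * (nat -> I),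
    (exists z x, good n z x) -> good n zx.1 zx.2.
  move=> n; have [[z [x h]]|h] := pselect (exists z x, good n z x).
    by exists (z, x).
  by exists ((0, 0), fun=> i0) => /h.
have rho_ge n z : U n z -> rho0 <= - ln (r n).
  move=> Uz; rewrite lerNr -ler_expR lnK ?posrE//.
  by have /andP[_ h] := diam_bound n z Uz; rewrite ge_max h ge_min lexx.
have /choice[kl klP] : forall n, exists kl : nat * nat, (exists z x, good n z x) ->
    let x := (zx n).2 in let rho := - ln (r n) in
    [/\ (kl.1 <= kl.2)%N, `|psum (lyap2 F) x kl.1 - rho| <= D,
      `|psum (lyap1 F) x kl.2 - rho| <= D & forall z z' x', coded F L z x -> coded F L z' x' ->
      eucl_dist z z' <= expR (- rho) -> matches F x kl.1 kl.2 (mkseq x' kl.2)].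
  move=> n; have [gn|ng] := pselect (exists z x, good n z x); last by exists (0, 0)%N.
  have [Uz _ _] := zxP n gn.
  have [|k [l h]] := hD (- ln (r n)) _ (zx n).2.
    by apply: le_trans (rho_ge n _ Uz); rewrite lerDl.
  by exists (k, l).
(* The w-mass of the square attached to U n. Sets without a coded regular point receive weight 0. *)
pose c n := if `[< exists z x, good n z x >]
  then expR (- square_cost F w (zx n).2 (kl n).1 (kl n).2) else 0.
pose h n m i := if `[< exists z x, good n z x >]
  then mart (zx n).2 (kl n).1 (kl n).2 m i else 1.
have c_le n : ((c n)%:E <= diam_pow t (U n) + (1 / 4 / 2 ^+ n.+1)%:E)%E.
  rewrite /c; case: asboolP => [gn|_]; last first.
    by rewrite adde_ge0 ?diam_pow_ge0// lee_fin divr_ge0// exprn_ge0.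
  have [Uz cx hx] := zxP n gn; have [kl1 hk hl _] := klP n gn.
  apply: le_trans (rs n _ Uz).
  rewrite lee_fin -[r n]lnK ?posrE// -expRM ler_expR lerNl.
  have hr := rho_ge n _ Uz; set rho := - ln (r n) in hr hk hl.
  have rho1 : 0 <= rho by exact: le_trans hr.
  have := hC _ _ _ _ hx rho1 hk hl; rewrite ler_norml -[u_dim F w w]/(v_dim F w) => /andP[hlo _].
  have CC : C <= e / 2 * rho.
    by rewrite mulrC -ler_pdivrMr//; apply: le_trans hr; rewrite /rho0 lerDr.
  have ee : e / 2 * rho + e / 2 * rho = v_dim F w * rho - s * rho by rewrite /e; field.
  have -> : - (ln (r n) * s) = s * rho by rewrite /rho; ring.
  lra.
have [||||x [hx hxc]] := avoid c h.
- by move=> n; rewrite /c; case: ifP => // _; exact: expR_ge0.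
- move=> n m i; rewrite /h; case: asboolP => // gn.
  by have [_ _ [wx _]] := zxP n gn; exact: mart_ge0.
- move=> n m; rewrite /h; case: asboolP => gn; last first.
    by under eq_bigr do rewrite mulr1; case: hw.
  by have [_ _ [wx _]] := zxP n gn; exact: mart_mean.
- apply: (@le_trans _ _ (\sum_(0 <= n <oo) (diam_pow t (U n) + (1 / 4 / 2 ^+ n.+1)%:E))%E).
    apply: lee_nneseries => n _; last exact: c_le.
    by rewrite lee_fin /c; case: ifP => // _; exact: expR_ge0.
  rewrite nneseriesD; last 2 first.
    by move=> n _ _; exact: diam_pow_ge0.
    by move=> n _ _; rewrite lee_fin divr_ge0// exprn_ge0.
  have -> : (1 / 2)%:E = ((1 / 4)%:E + (1 / 4)%:E)%E :> \bar R.
    by rewrite -EFinD; congr (_%:E); field.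
  apply: leeD; first exact: ltW.
  apply: nneseries_le_bound => [n|N]; first by rewrite lee_fin divr_ge0// exprn_ge0.
  by rewrite sumEFin lee_fin; apply: half_powers_sum; rewrite divr_ge0.
have [z cz] := exists_coded hL x.
have [n _ Uz] := EU z (hE z x cz hx).
have gn : exists z x, good n z x by exists z, x; split.
have [Uzn cxn [wxn _]] := zxP n gn; have [kl1 _ _ agree] := klP n gn.
(* Since z and the chosen point lie in the same U n, x matches the square of that point; the n-th
   martingale equals 1 at time (kl n).2. *)
have := hxc n (kl n).2; rewrite /c /h; case: asboolP => // _.
rewrite mart_matches ?ltxx//; apply: (agree (zx n).1 z) => //.
rewrite opprK lnK ?posrE//; apply: le_trans (eucl_dist_le_diam (Ud n) Uzn Uz) _.
by rewrite le_max lexx.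
Qed.

End lower_bound_dimension.

Lemma spectrum_ge (R : realType) (I : finType) (F : diag_ifs R I)
    (L : set (R * R)) (p : I -> R) (mu : probability (plane R) R) (w : I -> R) :
  gatzouras_lalley F -> is_attractor F L -> principal_separation F L ->
  prob_vec R I p -> (forall i, 0 < p i) -> is_self_affine F p mu ->
  prob_vec R I w ->
  ((v_dim F w)%:E <= multifractal_spectrum mu (u_dim F p w))%E.
Proof.
move=> hGL hL hsep hp hp0 hmu hw; have [K avoid] := regular_avoidance hw.
have hE z x : coded F L z x -> regular w K x ->
    [set z | msupp mu z /\ has_local_dim mu z (u_dim F p w)] z.
  move=> cx hx; split; first exact: (coded_msupp hGL hL hsep hp hp0 hmu cx).
  exact: (regular_local_dim hGL hL hsep hp hp0 hmu hw cx hx).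
apply: hausdorff_dim_ge => [|t t0 Ht].
  (* With zero weights avoidance still yields a regular sequence, so the level set is nonempty. *)
  have [||||x [hx _]] := avoid (fun=> 0) (fun _ _ _ => 1).
  - by [].
  - by [].
  - by move=> k m; under eq_bigr do rewrite mulr1; case: hw.
  - by rewrite eseries0// lee_fin divr_ge0.
  by have [z cz] := exists_coded hL x; exists z; exact: hE cz hx.
exact: (regular_hausdorff hGL hL hsep hw avoid hE t0 Ht).
Qed.

(** * The fibred spectrum *)

Section fibred_duality.
Variables (R : realType) (I : finType) (F : diag_ifs R I).
Variables (p : I -> R) (v : column F -> R).
Hypothesis hGL : gatzouras_lalley F.
Hypothesis hp0 : forall i, 0 < p i.
Hypothesis hv : prob_vec R (column F) v.

Let energy q s i := expR (q * ln (p i) + s * lyap2 F i).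
Let partition_sum q s l := \sum_(j | column_of F j == l) energy q s j.

Let partition_sumE q s l :
  \sum_(j | column_of F j == l) p j `^ q * beta2 F j `^ (- s) = partition_sum q s l.
Proof.
apply: eq_bigr => j _; rewrite /powR !gt_eqF ?hp0 ?beta2_gt0// -expRD.
by congr expR; rewrite /lyap2; ring.
Qed.

Let partition_sum_gt0 q s l : 0 < partition_sum q s l.
Proof.
rewrite /partition_sum (bigD1 (repr l))/=; last by rewrite /column_of reprK.
by rewrite ltr_wpDr ?expR_gt0// sumr_ge0// => j _; exact: expR_ge0.
Qed.

Let pressure q s := \sum_l v l * ln (partition_sum q s l).

Let continuous_pressure q : continuous (pressure q).
Proof.
move=> s; rewrite /pressure; apply: continuous_sumr => l _.
have c1 : {for s, continuous (fun=> v l)} by exact: cst_continuous.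
apply: (continuous_at_mul c1).
apply: (@continuous_comp _ _ _ (fun s => partition_sum q s l) (@ln R)); last first.
  exact: continuous_ln.
apply: continuous_sumr => j _.
have c2 : {for s, continuous (fun=> q * ln (p j))} by exact: cst_continuous.
have c3 : {for s, continuous (fun=> lyap2 F j)} by exact: cst_continuous.
have c4 : {for s, continuous (fun s : R => s)} by exact: cvg_id.
exact: (continuous_comp (continuous_at_add c2 (continuous_at_mul c4 c3))
  (@continuous_expR R _)).
Qed.

(** The pressure is continuous and grows in s at rate at least c, so the required value is bracketed
    within N of 0; [xget] then returns a solution. *)
Lemma T_fib_solution q : pressure q (T_fib p v q) = - (q * cross_entropy v (eta F p)).
Proof.
pose E s := - (\sum_(l : column F)
  v l * ln (\sum_(j | column_of F j == l) p j `^ q * beta2 F j `^ (- s)))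
    = q * cross_entropy v (eta F p).
have EP s : E s <-> pressure q s = - (q * cross_entropy v (eta F p)).
  rewrite /E /pressure; under eq_bigr do rewrite partition_sumE.
  by split=> [<-|->]; rewrite opprK.
suff [s hs] : exists s, pressure q s = - (q * cross_entropy v (eta F p)).
  by apply/EP; rewrite /T_fib; apply: (xgetPex 0 (P := [set s | E s])); exists s; exact/EP.
set y := - _.
have [c c0 hc] := @finite_positive_bound R I xpredT (lyap2 F) (fun i _ => lyap2_gt0 hGL i).
have [v0 v1] := hv.
have shift s t : s <= t -> pressure q s + c * (t - s) <= pressure q t.
  move=> st; have -> : pressure q s + c * (t - s) =
      \sum_l v l * (ln (partition_sum q s l) + c * (t - s)).
    by under [RHS]eq_bigr do rewrite mulrDr; rewrite big_split/= -mulr_suml v1 mul1r.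
  apply: ler_sum => l _; rewrite ler_wpM2l//.
  rewrite -[c * _]expRK -lnM ?posrE ?expR_gt0//.
  rewrite ler_ln ?posrE ?mulr_gt0 ?expR_gt0// /partition_sum mulr_suml.
  apply: ler_sum => j _; rewrite -expRD ler_expR -addrA lerD2l.
  have := hc j isT; have : 0 <= t - s by rewrite subr_ge0.
  by move=> h1 h2; have := ler_wpM2r h1 h2; lra.
pose N := `|y - pressure q 0| / c.
have N0 : 0 <= N by rewrite divr_ge0// ltW.
have cN : c * N = `|y - pressure q 0| by rewrite /N; field; rewrite gt_eqF.
have a1 : y <= pressure q N.
  apply: le_trans (shift 0 N N0); rewrite subr0 cN -lerBlDl; exact: ler_norm.
have a2 : pressure q (- N) <= y.
  have NN : - N <= 0 by rewrite oppr_le0.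
  have := shift _ _ NN; rewrite sub0r opprK cN.
  by have := ler_norm (- (y - pressure q 0)); rewrite normrN; lra.
have NN : - N <= N by lra.
have cw : {within `[(- N), N], continuous (pressure q)}.
  by apply: continuous_subspaceT; exact: continuous_pressure.
have [|s _ hs] := IVT NN cw (v := y); last by exists s.
by rewrite ge_min a2 le_max a1 orbT.
Qed.

Let T := T_fib p v.

(* The maximiser in the Gibbs variational principle over the fibre eta w = v. *)
Let gibbs_vec q i := v (column_of F i) * energy q (T q) i /
  partition_sum q (T q) (column_of F i).

Lemma eta_gibbs_vec q : eta F (gibbs_vec q) = v.
Proof.
apply/funext => l; rewrite /eta /gibbs_vec.
rewrite (eq_bigr (fun i => v l / partition_sum q (T q) l * energy q (T q) i)).
  by rewrite -mulr_sumr divfK// gt_eqF.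
by move=> i /eqP ->; rewrite mulrAC.
Qed.

Lemma gibbs_vec_prob q : prob_vec R I (gibbs_vec q).
Proof.
have [v0 v1] := hv; split=> [i|].
  by rewrite divr_ge0 ?mulr_ge0 ?expR_ge0// ltW.
have := @sum_eta R I F (gibbs_vec q) (fun=> 1).
under [X in _ = X -> _]eq_bigr do rewrite mulr1; move=> <-.
by rewrite eta_gibbs_vec; under eq_bigr do rewrite mulr1.
Qed.

Let fib_cost (w : I -> R) := cross_entropy w p - cross_entropy v (eta F p).

(** On the fibre the partition sums enter only through the pressure, which the equation of T q
    evaluates. Taking w = gibbs_vec q gives equality, and the Gibbs inequality gives the bound for
    the other w. *)
Let gibbs_vec_cost q (w : I -> R) : (forall i, 0 <= w i) -> eta F w = v ->
  \sum_i w i * - ln (gibbs_vec q i) = entropy v + q * fib_cost w - T q * chi2 F w.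
Proof.
move=> w0 wv; have [v0 v1] := hv.
have -> : \sum_i w i * - ln (gibbs_vec q i) = \sum_i w i * (- ln (v (column_of F i)) +
    ln (partition_sum q (T q) (column_of F i)) - q * ln (p i) - T q * lyap2 F i).
  apply: eq_bigr => i _; have := w0 i; rewrite le_eqVlt => /predU1P[<-|wi].
    by rewrite !mul0r.
  have vi : 0 < v (column_of F i).
    by rewrite -wv; apply: lt_le_trans wi (col_weight_ge _ _ _).
  congr (_ * _); rewrite /gibbs_vec ln_div ?posrE ?mulr_gt0 ?expR_gt0//.
  by rewrite lnM ?posrE ?expR_gt0// expRK; ring.
under eq_bigr do rewrite !mulrBr mulrDr.
rewrite !sumrB big_split /=.
have -> : \sum_i w i * - ln (v (column_of F i)) = entropy v.
  by rewrite /entropy cross_entropyE// -(@sum_eta R I F w (fun l => - ln (v l))) wv.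
have -> : \sum_i w i * ln (partition_sum q (T q) (column_of F i)) =
    - (q * cross_entropy v (eta F p)).
  rewrite -T_fib_solution /pressure.
  by rewrite -(@sum_eta R I F w (fun l => ln (partition_sum q (T q) l))) wv.
rewrite /fib_cost [in RHS](cross_entropyE p w0) chi2E.
have -> : \sum_i w i * - ln (p i) = - \sum_i w i * ln (p i).
  by rewrite -sumrN; apply: eq_bigr => i _; rewrite mulrN.
have -> : \sum_i w i * (q * ln (p i)) = q * \sum_i w i * ln (p i).
  by rewrite mulr_sumr; apply: eq_bigr => i _; rewrite mulrCA.
have -> : \sum_i w i * (T q * lyap2 F i) = T q * \sum_i w i * lyap2 F i.
  by rewrite mulr_sumr; apply: eq_bigr => i _; rewrite mulrCA.
ring.
Qed.

Lemma T_fib_attained q :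
  entropy (gibbs_vec q) - entropy v = q * fib_cost (gibbs_vec q) - T q * chi2 F (gibbs_vec q).
Proof.
have [g0 _] := gibbs_vec_prob q; have := gibbs_vec_cost q g0 (eta_gibbs_vec q).
by rewrite /entropy (cross_entropyE _ g0) => ->; ring.
Qed.

Lemma T_fib_bound q (w : I -> R) : prob_vec R I w -> eta F w = v ->
  entropy w - entropy v <= q * fib_cost w - T q * chi2 F w.
Proof.
move=> hw wv; have [w0 _] := hw; have [g0 g1] := gibbs_vec_prob q; have [v0 _] := hv.
rewrite lerBlDl addrA -gibbs_vec_cost// /entropy cross_entropyE//.
apply: gibbs => //; first by rewrite g1.
move=> i wi; rewrite /gibbs_vec divr_gt0 ?mulr_gt0 ?expR_gt0//.
by rewrite -wv; apply: lt_le_trans wi (col_weight_ge _ _ _).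
Qed.

Let rate_bound : exists2 B : R, 0 < B & forall w, prob_vec R I w ->
  `|fib_cost w| <= B * chi2 F w.
Proof.
have [c c0 hc] := @finite_positive_bound R I xpredT (lyap2 F) (fun i _ => lyap2_gt0 hGL i).
pose B := 1 + (\sum_i `|ln (p i)| + `|cross_entropy v (eta F p)|).
have B0 : 0 < B by rewrite ltr_wpDr// addr_ge0// sumr_ge0.
exists (B / c) => [|w [w0 w1]]; first by rewrite divr_gt0.
have -> : B / c * chi2 F w = B * (chi2 F w / c) by rewrite mulrAC mulrA.
apply: (@le_trans _ _ B); last first.
  rewrite -[leLHS]mulr1 ler_pM2l// ler_pdivlMr// mul1r chi2E -[leLHS]mul1r -w1 mulr_suml.
  by apply: ler_sum => i _; rewrite ler_wpM2l// hc.
apply: le_trans (ler_normB _ _) _; rewrite /B addrA lerD2r cross_entropyE//.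
apply: le_trans (ler_norm_sum _ _ _) _.
rewrite -[leLHS]add0r; apply: lerD => //; apply: ler_sum => i _.
rewrite normrM normrN (ger0_norm (w0 i)) ler_piMl// -w1 (bigD1 i)//= lerDl.
exact: sumr_ge0.
Qed.

(** T is a minimum of affine functions of q, one per w in the fibre, whose slopes fib_cost / chi2
    are bounded by B; so it is B-Lipschitz. *)
Lemma T_fib_continuous : continuous T.
Proof.
have [B B0 hB] := rate_bound.
have half q q' : T q' - T q <= B * `|q' - q|.
  have hw := gibbs_vec_prob q; set w := gibbs_vec q in hw.
  have c2 := chi2_gt0 hGL hw.
  have h1 := T_fib_attained q; have h2 := T_fib_bound q' hw (eta_gibbs_vec q).
  rewrite -/w in h1; rewrite -(ler_pM2r c2).
  have h3 : (q' - q) * fib_cost w <= `|q' - q| * (B * chi2 F w).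
    apply: le_trans (ler_norm _) _; rewrite normrM ler_wpM2l//; exact: hB.
  lra.
move=> q; apply/cvgrPdist_le => e e0; near=> q'.
have qq' : `|q - q'| <= e / B.
  by near: q'; apply: cvgr_dist_le; [exact: cvg_id|rewrite divr_gt0].
apply: (@le_trans _ _ (B * `|q - q'|)); last by rewrite mulrC -ler_pdivlMr.
rewrite ler_norml lerNl opprB half andbT.
by apply: le_trans (half q q') _; rewrite distrC.
Unshelve. all: by end_near. Qed.

Let gibbs_vec_continuous i : continuous (fun q => gibbs_vec q i).
Proof.
move=> q; have cT := @T_fib_continuous q.
have cE j : {for q, continuous (fun q => energy q (T q) j)}.
  have c2 : {for q, continuous (fun=> ln (p j))} by exact: cst_continuous.
  have c3 : {for q, continuous (fun=> lyap2 F j)} by exact: cst_continuous.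
  have c4 : {for q, continuous (fun q : R => q)} by exact: cvg_id.
  exact: (continuous_comp (continuous_at_add (continuous_at_mul c4 c2)
    (continuous_at_mul cT c3)) (@continuous_expR R _)).
have c1 : {for q, continuous (fun=> v (column_of F i))} by exact: cst_continuous.
apply: (continuous_at_div (continuous_at_mul c1 (cE i))); last by rewrite gt_eqF.
by apply: continuous_sumr => j _; exact: cE.
Qed.

Variable rho : R.

Lemma T_fib_conj_ge (w : I -> R) : prob_vec R I w -> eta F w = v ->
  fib_cost w = rho * chi2 F w ->
  (((entropy w - entropy v) / chi2 F w)%:E <= T_fib_conj p v rho)%E.
Proof.
move=> hw wv wr; have c2 := chi2_gt0 hGL hw.
apply: le_ereal_inf_tmp => _ [q _ <-]; rewrite lee_fin ler_pdivrMr//.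
by have := T_fib_bound q hw wv; rewrite wr -/T; lra.
Qed.

Let slope (w : I -> R) := rho * chi2 F w - fib_cost w.

(** Up to the factor chi2, the derivative in q of q * rho - T q: a zero is a critical point of the
    conjugate. *)
Let gap q : R := slope (gibbs_vec q).

Let gap_continuous : continuous gap.
Proof.
have -> : gap = (fun q => \sum_i gibbs_vec q i * (rho * lyap2 F i + ln (p i)) +
    cross_entropy v (eta F p)).
  apply/funext => q; have [g0 _] := gibbs_vec_prob q.
  rewrite /gap /slope /fib_cost chi2E cross_entropyE// opprB addrCA addrC mulr_sumr -sumrB.
  by congr (_ + _); apply: eq_bigr => i _; ring.
move=> q.
have c0 : {for q, continuous (fun=> cross_entropy v (eta F p))} by exact: cst_continuous.
apply: (@continuous_at_add _ _
  (fun q => \sum_i gibbs_vec q i * (rho * lyap2 F i + ln (p i)))) => //.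
apply: continuous_sumr => i _.
have c1 : {for q, continuous (fun=> rho * lyap2 F i + ln (p i))} by exact: cst_continuous.
by apply: (continuous_at_mul _ c1); exact: gibbs_vec_continuous.
Qed.

Import ArrowAsProduct.

(* The vanishing of the slope at some gibbs_vec q gives w. If the slope has one sign
   for all q, let q tend to an infinity: the slope then tends to 0, and w is found
   by compactness. *)
Lemma T_fib_conj_attained (m : R) : (forall q, m <= q * rho - T q) ->
  exists w, [/\ prob_vec R I w, eta F w = v, fib_cost w = rho * chi2 F w &
    m <= (entropy w - entropy v) / chi2 F w].
Proof.
move=> hm; apply: contrapT => nex.
have hq q : m * chi2 F (gibbs_vec q) <= q * gap q + (entropy (gibbs_vec q) - entropy v).
  have c2 := chi2_gt0 hGL (gibbs_vec_prob q).
  have := ler_wpM2r (ltW c2) (hm q); rewrite T_fib_attained /gap /slope; lra.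
have gap0 q : gap q != 0.
  apply/eqP => g0; apply: nex; exists (gibbs_vec q).
  have c2 := chi2_gt0 hGL (gibbs_vec_prob q).
  split; [exact: gibbs_vec_prob|exact: eta_gibbs_vec| |].
    by move/eqP: g0; rewrite /gap /slope subr_eq0 => /eqP.
  by rewrite ler_pdivlMr//; have := hq q; rewrite g0 mulr0 add0r.
pose B (w : I -> R) := m * chi2 F w - (\sum_i xlnx (w i) - entropy v).
pose A (w : I -> R) := rho * chi2 F w - (\sum_i w i * - ln (p i) - cross_entropy v (eta F p)).
(* The total defect of a candidate w, positive on the simplex if no candidate exists. At gibbs_vec q
   with q * gap q <= 0 only |gap q| is left of it. *)
pose f (w : I -> R) := `|A w| + \sum_l `|eta F w l - v l| + (B w + `|B w|).
have cchi w : {for w, continuous (chi2 F)} by exact: continuous_linear_form.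
have cc (w : I -> R) (a : R) : {for w, continuous (fun=> a)} by exact: cst_continuous.
have cA w : {for w, continuous A}.
  have c1 : {for w, continuous (fun w : I -> R => \sum_i w i * - ln (p i))}.
    exact: continuous_linear_form.
  exact: (continuous_at_sub (continuous_at_mul (cc w rho) (cchi w))
    (continuous_at_sub c1 (cc w (cross_entropy v (eta F p))))).
have cB w : {for w, continuous B}.
  have c1 : {for w, continuous (fun w : I -> R => \sum_i xlnx (w i))}.
    exact: continuous_entropy_sum.
  exact: (continuous_at_sub (continuous_at_mul (cc w m) (cchi w))
    (continuous_at_sub c1 (cc w (entropy v)))).
have ce w : {for w, continuous (fun w : I -> R => \sum_l `|eta F w l - v l|)}.
  apply: continuous_sumr => l _; apply: continuous_at_norm.
  have c1 : {for w, continuous (fun w : I -> R => eta F w l)}.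
    by apply: continuous_sumr => i _; exact: continuous_coord.
  exact: (continuous_at_sub c1 (cc w (v l))).
have cf w : prob_vec R I w -> {for w, continuous f}.
  move=> _; exact: (continuous_at_add (continuous_at_add (continuous_at_norm (cA w)) (ce w))
    (continuous_at_add (cB w) (continuous_at_norm (cB w)))).
have B0 w : 0 <= B w + `|B w|.
  by have := ler_norm (- B w); rewrite normrN -subr_ge0 opprK addrC.
have e0 (w : I -> R) : 0 <= \sum_l `|eta F w l - v l| by apply: sumr_ge0.
have AE w : prob_vec R I w -> A w = slope w.
  by move=> [w0 _]; rewrite /A /slope /fib_cost (cross_entropyE p w0).
have BE w : prob_vec R I w -> B w = m * chi2 F w - (entropy w - entropy v).
  by move=> [w0 _]; rewrite /B (entropyE w0).
have f0 w : prob_vec R I w -> 0 < f w.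
  move=> hw; have a0 := addr_ge0 (normr_ge0 (A w)) (e0 w).
  rewrite lt_neqAle (addr_ge0 a0 (B0 w)) andbT eq_sym; apply/negP.
  rewrite /f (paddr_eq0 a0 (B0 w)) (paddr_eq0 (normr_ge0 _) (e0 w)).
  move=> /andP[/andP[h1 h2] h3]; apply: nex; exists w; split=> //.
  - apply/funext => l; apply/eqP; rewrite -subr_eq0 -normr_eq0.
    by move: h2; rewrite psumr_eq0// => /allP/(_ l); rewrite mem_index_enum; exact.
  - by move: h1; rewrite normr_eq0 AE// /slope subr_eq0 => /eqP.
  have c2 := chi2_gt0 hGL hw; rewrite ler_pdivlMr// -subr_le0 -BE// leNgt.
  by apply/negP => lt0; move: h3; rewrite gtr0_norm// gt_eqF// addr_gt0.
have [d d0 hd] := compact_positive_bound (@compact_simplex R I) cf f0.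
pose C := #|I|%:R + `|m| * (\sum_i `|lyap2 F i|).
have C0 : 0 <= C by rewrite addr_ge0// mulr_ge0// sumr_ge0.
have hC w : prob_vec R I w -> entropy w - entropy v - m * chi2 F w <= C.
  move=> hw; have [w0 w1] := hw.
  have w_le1 i : w i <= 1 by rewrite -w1 (bigD1 i)//= lerDl sumr_ge0.
  have h1 : entropy w <= #|I|%:R.
    rewrite entropyE// -[leRHS]mulr1 mulr_natl -sumr_const; apply: ler_sum => i _.
    have := w0 i; rewrite le_eqVlt => /predU1P[<-|wi]; first by rewrite /xlnx mul0r.
    rewrite /xlnx -lnV ?posrE//.
    have := ln_sublinear (x := (w i)^-1); rewrite invr_gt0 => /(_ wi) /ltW h.
    by apply: le_trans (ler_wpM2l (w0 i) h) _; rewrite divff// gt_eqF.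
  have h2 := entropy_ge0 hv.
  have h3 : - (m * chi2 F w) <= `|m| * (\sum_i `|lyap2 F i|).
    apply: le_trans (ler_norm _) _; rewrite normrN normrM ler_wpM2l//.
    rewrite chi2E; apply: le_trans (ler_norm_sum _ _ _) _; apply: ler_sum => i _.
    by rewrite normrM (ger0_norm (w0 i)) ler_piMl.
  by rewrite /C; lra.
have far q : q * gap q <= 0 -> d <= `|gap q|.
  move=> qg; have hw := gibbs_vec_prob q; have := hd _ hw.
  rewrite /f AE// -/(gap q) eta_gibbs_vec big1 ?addr0; last by move=> l _; rewrite subrr normr0.
  suff -> : B (gibbs_vec q) + `|B (gibbs_vec q)| = 0 by rewrite addr0.
  by rewrite ler0_norm ?subrr// BE// subr_le0; have := hq q; lra.
(* For |q| >= Q, a nonpositive q * gap q would be at most - (C + 1), against [hq] and [hC]. So gap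
   has the sign of q at both Q and - Q, and vanishes in between. *)
pose Q := (C + 1) / d; have Q0 : 0 < Q by rewrite divr_gt0//; lra.
have Qd : Q * d = C + 1 by rewrite /Q divfK// gt_eqF.
have not_both q : 0 <= - (q * gap q) -> Q <= `|q| -> False.
  move=> qg Qq; have fg : d <= `|gap q| by apply: far; rewrite -oppr_ge0.
  have := hC _ (gibbs_vec_prob q); have := hq q.
  have : C + 1 <= `|q| * `|gap q|.
    by rewrite -Qd; apply: ler_pM => //; exact: ltW.
  by rewrite -normrM -normrN ger0_norm//; lra.
have gQ : gap Q < 0 \/ 0 < gap Q by have := gap0 Q; rewrite neq_lt => /orP.
have gQ' : 0 < gap Q.
  case: gQ => // gn; exfalso; apply: (not_both Q); last by rewrite ger0_norm// ltW.
  by rewrite -mulrN mulr_ge0 ?oppr_ge0 ?(ltW Q0) ?(ltW gn).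
have gNQ : gap (- Q) < 0.
  have := gap0 (- Q); rewrite neq_lt => /orP[//|gp]; exfalso.
  apply: (not_both (- Q)); last by rewrite normrN ger0_norm// ltW.
  by rewrite mulNr opprK mulr_ge0 ?(ltW Q0) ?(ltW gp).
have QQ : - Q <= Q by lra.
have cw : {within `[(- Q), Q], continuous gap}.
  by apply: continuous_subspaceT; exact: gap_continuous.
have [|q _ gq] := IVT QQ cw (v := 0).
  by rewrite ge_min (ltW gNQ) le_max (ltW gQ') orbT.
by have := gap0 q; rewrite gq eqxx.
Qed.

Lemma T_fib_conj_fin : T_fib_conj p v rho = -oo%E \/
  exists2 m : R, T_fib_conj p v rho = m%:E & forall q, m <= q * rho - T q.
Proof.
have lb q : (T_fib_conj p v rho <= (q * rho - T q)%:E)%E.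
  by apply: ereal_inf_lbound; exists q.
case E : (T_fib_conj p v rho) lb => [m| |] lb.
- by right; exists m => // q; rewrite -lee_fin.
- by have := lb 0; rewrite leye_eq.
- by left.
Qed.

End fibred_duality.

(** * The two variational formulas *)

Theorem theoremD (R : realType) (I : finType) (F : diag_ifs R I)
    (L : set (R * R)) (p : I -> R) (mu : probability (plane R) R)
    (hGL : gatzouras_lalley F)
    (hL : is_attractor F L)
    (hsep : principal_separation F L)
    (hcol : #|{: column F}| = 2%N)
    (hp : prob_vec R I p)
    (hp0 : forall i, 0 < p i)
    (hmu : is_self_affine F p mu)
    (alpha : R) :
  is_emax
    [set (v_dim F w)%:E | w in [set w | prob_vec R I w /\ u_dim F p w = alpha]]
    (multifractal_spectrum mu alpha) /\
  is_emax
    [set ((entropy v / chi1 v)%:E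
          + T_fib_conj p v (alpha - cross_entropy v (eta F p) / chi1 v))%E
      | v in prob_vec R (column F)]
    (multifractal_spectrum mu alpha).
Proof.
pose A := [set w | prob_vec R I w /\ u_dim F p w = alpha].
pose G (v : column F -> R) := ((entropy v / chi1 v)%:E
  + T_fib_conj p v (alpha - cross_entropy v (eta F p) / chi1 v))%E.
have fibre w : A w -> (cross_entropy w p - cross_entropy (eta F w) (eta F p) =
    (alpha - cross_entropy (eta F w) (eta F p) / chi1 (eta F w)) * chi2 F w) /\
    ((v_dim F w)%:E <= G (eta F w))%E.
  move=> [hw uw]; have hv := eta_prob F hw; have c2 := chi2_gt0 hGL hw.
  have E : cross_entropy w p - cross_entropy (eta F w) (eta F p) =
    (alpha - cross_entropy (eta F w) (eta F p) / chi1 (eta F w)) * chi2 F w.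
    by rewrite -uw /u_dim addrAC subrr add0r divfK// gt_eqF.
  split=> //; rewrite /v_dim EFinD; apply: leeD => //.
  exact: (T_fib_conj_ge hGL hp0 hv hw).
(* Strong duality on one fibre: a finite value of G is dominated by an admissible w, so the two
   maxima agree. *)
have lift v : prob_vec R (column F) v ->
    G v = -oo%E \/ exists2 w, A w & (G v <= (v_dim F w)%:E)%E.
  move=> hv; rewrite /G; set rho := alpha - _.
  have [->|[m -> hm]] := T_fib_conj_fin p v rho; first by left; rewrite addeNy.
  right; have [w [hw wv wr hmw]] := T_fib_conj_attained hGL hp0 hv hm.
  have c2 := chi2_gt0 hGL hw; exists w.
    split=> //; rewrite /u_dim wv wr mulfK ?gt_eqF//.
    by rewrite /rho addrC subrK.
  by rewrite -EFinD lee_fin /v_dim wv lerD2l.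
have [[w0 [hw0 uw0]]|nA] := pselect (A !=set0).
  have [w [hw uw wmax]] := v_dim_max hGL hw0 uw0.
  have -> : multifractal_spectrum mu alpha = (v_dim F w)%:E.
    apply/eqP; rewrite eq_le; apply/andP; split; last first.
      by rewrite -uw; exact: (spectrum_ge hGL hL hsep hp hp0 hmu hw).
    exact: (spectrum_le hGL hL hsep hcol hp hp0 hmu (v_dim_ge0 hGL hw) wmax).
  have Gub v : prob_vec R (column F) v -> (G v <= (v_dim F w)%:E)%E.
    move=> /lift[->|[w' [hw' uw'] h]]; first exact: leNye.
    by apply: le_trans h _; rewrite lee_fin; exact: wmax.
  split; left; split.
  - by exists w.
  - by move=> _ [w' [hw' uw'] <-]; rewrite lee_fin; exact: wmax.
  - exists (eta F w); first exact: eta_prob.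
    apply/eqP; rewrite eq_le; apply/andP; split.
      by apply: Gub; exact: eta_prob.
    exact: (fibre w (conj hw uw)).2.
  - by move=> _ [v hv <-]; exact: Gub.
have spE : multifractal_spectrum mu alpha = -oo%E.
  rewrite /multifractal_spectrum (level_set_empty hGL hL hsep hcol hp hp0 hmu).
    by rewrite /hausdorff_dim eqxx.
  by move=> w hw uw; apply: nA; exists w.
have GN v : prob_vec R (column F) v -> G v = -oo%E.
  by move=> hv; have [//|[w Aw _]] := lift v hv; case: nA; exists w.
rewrite spE; split.
  right; split=> //; apply/seteqP; split=> // y [w Aw _].
  by apply: nA; exists w.
(* The second family is nonempty, as eta F p belongs to the simplex; its maximum is attained with
   the value -oo. *)
left; split; last by move=> _ [v hv <-]; rewrite [X in (X <= _)%E]GN.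
by exists (eta F p); [exact: eta_prob|apply: GN; exact: eta_prob].
Qed.
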